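(* Let $s \geq 0$ and $2\leq m_1\leq\dots\leq m_t$ be integers (with $t\ge 1$). Assume $m=m_1+\dots+m_t\leq 10$, and that $n=s+m$ is an odd integer such that $n(n-1)\equiv 0 \pmod{2m}$. Then $\mathrm{HOP}(2^{\langle s \rangle},2m_1, \dots, 2m_t)$ has a solution.
   Context: Generalized Honeymoon Oberwolfach Problem. Let $s\ge 0$, $t\ge 1$ and $m_1,\dots,m_t\ge 2$ be integers and $n=s+m_1+\dots+m_t$. $\mathrm{HOP}(2^{\langle s\rangle},2m_1,\dots,2m_t)$ asks whether $2n$ participants consisting of $n$ couples can be seated, over several nights, at $s$ tables of size $2$ and $t$ round tables of sizes $2m_1,\dots,2m_t$ (all tables full each night) so that each participant sits next to their spouse every night and next to every other participant exactly once. Formally: let $I$ be a fixed $1$-factor (perfect matching) of the complete graph $K_{2n}$. For an integer $\gamma\ge 1$, $K_{2n}+(\gamma-1)I$ is the multigraph obtained from $K_{2n}$ by adjoining $\gamma-1$ additional parallel copies of each edge of $I$; all copies of edges of $I$ are called $I$-edges and the other edges non-$I$-edges. A $(K_2^{\langle s\rangle},C_{2m_1},\dots,C_{2m_t})$-factor is a spanning subgraph that is a vertex-disjoint union of $s$ copies of $K_2$ and $t$ cycles of lengths $2m_1,\dots,2m_t$; it is $I$-alternating if along every one of its cycles $I$-edges and non-$I$-edges alternate and each of its $K_2$ components is an $I$-edge. $\mathrm{HOP}(2^{\langle s\rangle},2m_1,\dots,2m_t)$ has a solution if and only if, for some $\gamma\geq 1$ (necessarily $\gamma=2n(n-1)/(m_1+\dots+m_t)$),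 the edge set of $K_{2n}+(\gamma-1)I$ can be partitioned into the edge sets of $I$-alternating $(K_2^{\langle s\rangle},C_{2m_1},\dots,C_{2m_t})$-factors. *)

(* Defs.v *)
From mathcomp Require Import all_boot.

Set Implicit Arguments.
Unset Strict Implicit.
Unset Printing Implicit Defensive.

Definition one_factor (V : finType) (I : {set {set V}}) : Prop :=
  partition I [set: V] /\ forall e : {set V}, e \in I -> #|e| = 2.

(* An edge of a multigraph on V with edge multiplicities at most gamma: its set
   of ends, together with a label telling parallel copies apart. *)
Definition medge (V : finType) (gamma : nat) : finType :=
  ({set V} * 'I_gamma)%type.

Section Multigraph.

Variables (V : finType) (gamma : nat) (I : {set {set V}}).

Implicit Types (e : medge V gamma) (H F : {set medge V gamma}).

Definition ends e : {set V} := e.1.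

Definition is_I_edge e : bool := ends e \in I.

(* The edge set of K_V + (gamma - 1) I: every pair of distinct vertices gives
   the copy labelled 0, and the pairs in I give all gamma copies. *)
Definition KI_edges : {set medge V gamma} :=
  [set e : medge V gamma |
    (#|ends e| == 2) && (is_I_edge e || (nat_of_ord e.2 == 0))].

Definition vertices H : {set V} := \bigcup_(e in H) ends e.

Definition is_K2 H : Prop := exists e, #|ends e| = 2 /\ H = [set e].

(* ordS is the cyclic successor on 'I_l. *)
Definition traverses l (vs : l.-tuple V) (es : l.-tuple (medge V gamma)) H :
    Prop :=
  [/\ uniq vs, uniq es,
      forall i : 'I_l, ends (tnth es i) = [set tnth vs i; tnth vs (ordS i)]
    & H = [set e in es]].

Definition is_cycle l H : Prop :=
  exists (vs : l.-tuple V) (es : l.-tuple (medge V gamma)), traverses vs es H.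

Definition alternating_cycle l H : Prop :=
  exists (vs : l.-tuple V) (es : l.-tuple (medge V gamma)),
    traverses vs es H /\
    forall i : 'I_l, is_I_edge (tnth es (ordS i)) = ~~ is_I_edge (tnth es i).

(* F is the edge set of a (K_2^<s>, C_{2 m_1}, ..., C_{2 m_t})-factor with
   components comp; a component is represented by its edge set, which determines
   it since it has no isolated vertex. *)
Definition factor_with_components (s t : nat) (m : 'I_t -> nat) F
    (comp : 'I_s + 'I_t -> {set medge V gamma}) : Prop :=
  [/\ F \subset KI_edges /\ F = \bigcup_x comp x,
      \bigcup_x vertices (comp x) = [set: V],
      forall x y, x != y -> [disjoint vertices (comp x) & vertices (comp y)],
      forall i : 'I_s, is_K2 (comp (inl i))
    & forall j : 'I_t, is_cycle (2 * m j) (comp (inr j))].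

Definition I_alternating_factor (s t : nat) (m : 'I_t -> nat) F : Prop :=
  exists comp : 'I_s + 'I_t -> {set medge V gamma},
    [/\ factor_with_components m F comp,
        forall i : 'I_s, forall e, e \in comp (inl i) -> is_I_edge e
      & forall j : 'I_t, alternating_cycle (2 * m j) (comp (inr j))].

End Multigraph.

(* The choice of the 1-factor I is immaterial, as any two 1-factors of K_{2n}
   differ by a permutation of the vertices. *)
Definition HOP_has_solution (s t : nat) (m : 'I_t -> nat) : Prop :=
  let n := s + \sum_(j < t) m j in
  forall I : {set {set 'I_(2 * n)}}, one_factor I ->
  exists gamma : nat, 1 <= gamma /\
  exists P : {set {set medge 'I_(2 * n) gamma}},
    partition P (KI_edges gamma I) /\
    forall F, F \in P -> I_alternating_factor I s m F.

(* Main.v *)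
Require Import Defs.
From mathcomp Require Import all_boot all_algebra zify.

(** A person is a pair (couple, bool), and in an I-alternating cycle whoever is entered
    from a non-I-edge is followed by the spouse. So such a cycle of length 2k is the same
    thing as a list d_1, ..., d_k of persons from k different couples: it runs d_1,
    spouse d_1, d_2, spouse d_2, ..., and its non-I-edges are the links from spouse d_i to
    d_(i+1). A night is then a block, a list of t such lists on pairwise different couples,
    while the remaining couples fill the s small tables. Take gamma to be the number of
    blocks and let the i-th block use the i-th copies of all the I-edges: a solution of the
    problem is a family of blocks whose links cover exactly once each pair of persons that
    are not spouses ([HOP_of_decomposition]).

    In this form partial solutions can be glued: [decomposable ms M] says that some family
    of blocks of shape ms covers the links between couples u and v exactly M u v times
    each, and such families add up and move along injections of the set of couples. For
    m <= 10 and n odd, the congruence on n leaves only n = 1 modulo 2m, n = m modulo 2m for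
    odd m, n = 9 modulo 12 for m = 6 and n = 5 modulo 20 for m = 10
    ([progressions_solve]). Each class is written n = q g + w with fixed g and w, and the
    couples are arranged in q groups of size g together with w extra couples.

    Links between different groups ([odd_groups], [even_groups]). For odd q, index the
    groups by the integers modulo q. For every z and every e in half of the nonzero
    residues, take the trio of groups z - e, z + e, z. Because 2 is invertible, two given
    groups are the outer pair of one trio, and each of them is the middle of one trio that
    has the other as an outer member. Hence if the pairs of positions (a, b) are split into
    a set S, its transpose and a symmetric remainder, and if in each trio the outer groups
    are joined along the remainder and both are joined to the middle along S, then
    everything between different groups is covered once. It suffices to decompose one such
    graph on 3g couples. For even q one further group sits at infinity and is attached to
    the trios with e = 1: every group belongs to three of them, once in each role, so the
    pairs of positions towards infinity are split into three classes, one per role. This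
    needs one more graph, on 4g couples.

    Links inside groups ([decomposable_fill]). Add to every group the w extra couples, and
    decompose the complete graph on g + w couples for one group and the same graph with a
    hole at the extra couples for the others.

    So for each of the 41 multisets of table sizes a few decompositions of small graphs
    settle all n, by [plan_sound]; they are listed as base blocks of a cyclic
    automorphism, and their validity is a computation. *)

Set Implicit Arguments.
Unset Strict Implicit.
Unset Printing Implicit Defensive.

Import GRing.Theory.

(** * Blocks and the links they cover *)

Section Darts.

Variable C : eqType.
Implicit Types (a b d : C * bool) (c : seq (C * bool)).

Definition spouse d : C * bool := (d.1, ~~ d.2).

(** The non-I-edges of the cycle d_1, spouse d_1, d_2, spouse d_2, ...; a list of two
    persons gives two different links, which is the alternating cycle of length 4. *)
Definition links c := zip (map spouse c) (rot 1 c).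

Definition block_links (B : seq (seq (C * bool))) := flatten (map links B).

Definition joins a b (e : (C * bool) * (C * bool)) := (e == (a, b)) || (e == (b, a)).

Definition mult (Bs : seq (seq (seq (C * bool)))) a b : nat :=
  count (joins a b) (flatten (map block_links Bs)).

Definition is_block (ms : seq nat) (B : seq (seq (C * bool))) :=
  (map size B == ms) && uniq (map fst (flatten B)).

(** M is a multiplicity, not a relation, so that decompositions can be added before the
    pieces are known to be edge-disjoint; it sees only the couples, since the four links
    between two couples always play the same part. *)
Definition decomposable ms (M : C -> C -> nat) : Prop :=
  exists2 Bs, all (is_block ms) Bs & forall a b, mult Bs a b = M a.1 b.1.

Lemma decomposable_eq ms M M' :
  decomposable ms M -> (forall u v, M u v = M' u v) -> decomposable ms M'.
Proof. by case=> Bs okBs multBs eqM; exists Bs => // a b; rewrite multBs eqM. Qed.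

Lemma decomposableD ms M M' :
  decomposable ms M -> decomposable ms M' ->
  decomposable ms (fun u v => M u v + M' u v).
Proof.
case=> Bs okBs multBs [Bs' okBs' multBs'].
exists (Bs ++ Bs'); first by rewrite all_cat okBs.
by move=> a b; rewrite /mult map_cat flatten_cat count_cat -multBs -multBs'.
Qed.

Lemma decomposable_sum ms (T : Type) (r : seq T) (P : pred T) (M : T -> C -> C -> nat) :
  (forall i, P i -> decomposable ms (M i)) ->
  decomposable ms (fun u v => \sum_(i <- r | P i) M i u v).
Proof.
move=> decM; elim: r => [|i r IHr].
  by exists nil => // a b; rewrite big_nil.
have [Pi|nPi] := boolP (P i).
  apply: decomposable_eq (decomposableD (decM i Pi) IHr) _ => u v.
  by rewrite big_cons Pi.
by apply: decomposable_eq IHr _ => u v; rewrite big_cons (negPf nPi).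
Qed.

End Darts.

Section Transport.

Variables (C C' : eqType) (f : C -> C') (f_inj : injective f).

Let fd (d : C * bool) : C' * bool := (f d.1, d.2).

Let fd_inj : injective fd.
Proof. by move=> [u p] [v q] [/f_inj -> ->]. Qed.

Lemma links_map c : links (map fd c) = [seq (fd e.1, fd e.2) | e <- links c].
Proof.
rewrite /links -map_rot -map_comp.
have -> : map (@spouse C' \o fd) c = map fd (map (@spouse C) c).
  by rewrite -map_comp; apply: eq_map.
elim: (map _ c) (rot 1 c) => [|x s IHs] [|y t] //=.
by rewrite IHs.
Qed.

Lemma is_block_map ms B : is_block ms (map (map fd) B) = is_block ms B.
Proof.
rewrite /is_block -map_comp (eq_map (fun c => size_map _ c)); congr (_ && _).
rewrite -map_flatten -map_comp.
have -> : [seq (fst \o fd) i | i <- flatten B] = map f (map fst (flatten B)).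
  by rewrite -map_comp.
by rewrite map_inj_uniq.
Qed.

Lemma links_of_map Bs :
  flatten (map (@block_links C') (map (map (map fd)) Bs)) =
  [seq (fd e.1, fd e.2) | e <- flatten (map (@block_links C) Bs)].
Proof.
rewrite map_flatten -!map_comp; congr flatten; apply: eq_map => B /=.
rewrite /block_links map_flatten -!map_comp; congr flatten.
by apply: eq_map => c /=; rewrite links_map.
Qed.

Lemma mult_map Bs a b : mult (map (map (map fd)) Bs) (fd a) (fd b) = mult Bs a b.
Proof.
rewrite /mult links_of_map count_map; apply: eq_count => -[d d'] /=.
by rewrite /joins !(xpair_eqE (fd d)) !(xpair_eqE d) !(inj_eq fd_inj).
Qed.

(** The second premise on M' makes it the push-forward of M: without it, pairs outside the
    image of f could be required to be covered. *)
Lemma decomposable_map ms (M : C -> C -> nat) (M' : C' -> C' -> nat) :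
    decomposable ms M ->
    (forall u v, M' (f u) (f v) = M u v) ->
    (forall u v, M' u v != 0 -> exists x y, u = f x /\ v = f y) ->
  decomposable ms M'.
Proof.
case=> Bs okBs multBs M'f M'0; exists (map (map (map fd)) Bs).
  by rewrite all_map; apply: sub_all okBs => B; rewrite /= is_block_map.
move=> a b.
have key d d' : a = fd d -> b = fd d' ->
    mult (map (map (map fd)) Bs) a b = M' a.1 b.1.
  by move=> -> ->; rewrite mult_map multBs M'f.
have [M'ab|/M'0[x [y [ax by_]]]] := eqVneq (M' a.1 b.1) 0; last first.
  by apply: (key (x, a.2) (y, b.2)); rewrite /fd /= -?ax -?by_ -surjective_pairing.
apply/eqP; rewrite M'ab -leqn0 leqNgt; apply/negP => mult_gt0.
have := mult_gt0; rewrite {1}/mult links_of_map -has_count.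
case/hasP=> _ /mapP[[d d'] _ ->] /= /orP[] /eqP[ed ed'].
  by move: mult_gt0; rewrite (key d d') ?M'ab.
by move: mult_gt0; rewrite (key d' d) ?M'ab.
Qed.

End Transport.

(** * From decompositions to seatings *)

Lemma set2_inj (V : finType) (a b c d : V) :
  [set a; b] = [set c; d] -> (a = c /\ b = d) \/ (a = d /\ b = c).
Proof.
move=> eqS.
have /set2P[ac|ad] : a \in [set c; d] by rewrite -eqS set21.
  have /set2P[bc|bd] : b \in [set c; d]; [by rewrite -eqS set22 | | by left].
  have /set2P[da|db] : d \in [set a; b]; [by rewrite eqS set22 | |].
    by left; rewrite da bc -ac.
  by left; rewrite ac db.
have /set2P[bc|bd] : b \in [set c; d]; [by rewrite -eqS set22 | by right |].
have /set2P[ca|cb] : c \in [set a; b]; [by rewrite eqS set21 | |].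
  by right; rewrite ad bd ca ad.
by right; rewrite ad.
Qed.

Lemma spouseK (C : eqType) : involutive (@spouse C).
Proof. by case=> u p; rewrite /spouse /= negbK. Qed.

Lemma spouse_neq (C : eqType) (d : C * bool) : spouse d != d.
Proof. by case: d => u [] /=; rewrite xpair_eqE eqxx. Qed.

Section Seating.

Variables (C V : finType) (phi : C * bool -> V) (phi_bij : bijective phi).
Variables (gamma : nat) (zero : 'I_gamma).

Let phi_inj : injective phi := bij_inj phi_bij.

Definition pair_set (a b : C * bool) : {set V} := [set phi a; phi b].

Definition couple_sets : {set {set V}} :=
  [set pair_set (u, false) (u, true) | u : C].

Lemma pair_setC a b : pair_set a b = pair_set b a.
Proof. exact: setUC. Qed.

Lemma pair_set_inj a b c d :
  pair_set a b = pair_set c d -> (a = c /\ b = d) \/ (a = d /\ b = c).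
Proof. by case/set2_inj => -[/phi_inj-> /phi_inj->]; [left | right]. Qed.

Lemma pair_set_couple a b : (pair_set a b \in couple_sets) = (b == spouse a).
Proof.
apply/imsetP/eqP => [[u _ /pair_set_inj[] [-> ->] //]|->].
case: a => u p; exists u => //; rewrite /spouse /=.
by case: p => //; rewrite pair_setC.
Qed.

Lemma card_pair_set a b : a != b -> #|pair_set a b| = 2.
Proof. by move=> nab; rewrite cards2 (inj_eq phi_inj) nab. Qed.

Section Table.

Variables (lab : 'I_gamma) (c : seq (C * bool)) (d0 : C * bool).
Hypotheses (c_ge2 : 2 <= size c) (c_uniq : uniq (map fst c)).

Let k := size c.

(** The person at position i, modulo 2k, of the cycle of length 2k: the entries of c sit at
    the even positions and their spouses at the odd ones. *)
Definition guest (i : nat) : C * bool :=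
  let d := nth d0 c i./2 in if odd i then spouse d else d.

Lemma guest_inj i j : i < 2 * k -> j < 2 * k -> guest i = guest j -> i = j.
Proof.
move=> ltik ltjk eqg.
have eqh : i./2 = j./2.
  apply/eqP; rewrite -(nth_uniq d0.1 _ _ c_uniq) ?size_map; try (rewrite -/k; lia).
  rewrite !(nth_map d0) -/k; try lia.
  by move/(congr1 fst): eqg; rewrite /guest; do 2 case: ifP => _; move=> /= ->.
have eqo : odd i = odd j.
  move: eqg; rewrite /guest eqh.
  case: (odd i); case: (odd j) => // /eqP; first by rewrite (negPf (spouse_neq _)).
  by rewrite eq_sym (negPf (spouse_neq _)).
by rewrite -(odd_double_half i) eqo eqh odd_double_half.
Qed.

Definition guests : (2 * k).-tuple V := [tuple phi (guest i) | i < 2 * k].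

(** The edge leaving an even position joins spouses and is the copy reserved for the night,
    the one leaving an odd position is a link and exists only with label 0. *)
Definition seats : (2 * k).-tuple (medge V gamma) :=
  [tuple (pair_set (guest i) (guest (ordS i)), if odd i then zero else lab)
   | i < 2 * k].

Lemma guestS i : i < 2 * k -> ~~ odd i -> guest (i.+1 %% (2 * k)) = spouse (guest i).
Proof.
move=> ltik ei; rewrite modn_small; last lia.
by rewrite /guest /= ei (negPf ei) uphalf_half (negPf ei).
Qed.

Lemma spouse_guest i : odd i -> spouse (guest i) = guest i.-1.
Proof.
case: i => // i /= oi; rewrite /guest /= oi (negPf oi) uphalf_half (negPf oi).
by rewrite spouseK.
Qed.

Lemma is_I_edge_seats (i : 'I_(2 * k)) :
  is_I_edge couple_sets (tnth seats i) = ~~ odd i.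
Proof.
rewrite /is_I_edge /ends tnth_mktuple /= pair_set_couple.
have ltik := ltn_ord i.
have [oi|/guestS->//] := boolP (odd i); last by rewrite eqxx.
rewrite spouse_guest //; apply/negP => /eqP/guest_inj.
rewrite ltn_mod muln_gt0 /= => /(_ (ltnW c_ge2)) inj1.
have {inj1} := inj1 _; rewrite -/k => /(_ ltac:(lia)).
have [lt|ge] := ltnP i.+1 (2 * k); first by rewrite modn_small //; lia.
have -> : i.+1 = 2 * k by lia.
rewrite modnn; lia.
Qed.

(** Two edges with the same ends at different positions would make the cycle
    a digon, and its length is at least 4. *)
Lemma seats_uniq : uniq seats.
Proof.
apply/tuple_uniqP => i j; rewrite !tnth_mktuple => -[/pair_set_inj eqij _].
have [ltik ltjk] := (ltn_ord i, ltn_ord j).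
apply: val_inj; case: eqij => -[/guest_inj e1 /guest_inj e2]; first exact: e1.
have /= iS := e1 ltik (ltn_ord (ordS j)).
have /= jS := e2 (ltn_ord (ordS i)) ltjk.
move: iS jS; have [lt|ge] := ltnP i.+1 (2 * k); last first.
  have -> : i.+1 = 2 * k by lia.
  rewrite modnn => iS jS; move: iS; rewrite -jS modn_small; lia.
rewrite (modn_small lt) => iS jS; move: iS; rewrite -jS.
have [lt2|ge2] := ltnP i.+2 (2 * k); first by rewrite modn_small //; lia.
have -> : i.+2 = 2 * k by lia.
by rewrite modnn; lia.
Qed.

Lemma guests_uniq : uniq guests.
Proof.
apply/tuple_uniqP => i j; rewrite !tnth_mktuple => /phi_inj/guest_inj eqij.
by apply: val_inj; apply: eqij.
Qed.

Lemma guests_traverse : traverses guests seats [set e in seats].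
Proof.
split=> //; [exact: guests_uniq | exact: seats_uniq | move=> i].
by rewrite /ends !tnth_mktuple.
Qed.

Lemma seats_alternate (i : 'I_(2 * k)) :
  is_I_edge couple_sets (tnth seats (ordS i)) =
  ~~ is_I_edge couple_sets (tnth seats i).
Proof.
rewrite !is_I_edge_seats /=; congr negb.
have ltik := ltn_ord i; have [lt|ge] := ltnP i.+1 (2 * k).
  by rewrite modn_small.
have iE : i.+1 = 2 * k by lia.
by rewrite iE modnn; move/(congr1 odd): iE; rewrite oddM /= => ->.
Qed.

Lemma couple_guest i : i < 2 * k -> (guest i).1 \in map fst c.
Proof.
move=> ltik; suff -> : (guest i).1 = (nth d0 c i./2).1.
  by apply: map_f; apply: mem_nth; rewrite -/k; lia.
by rewrite /guest; case: ifP.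
Qed.

Lemma guest_onto x : x.1 \in map fst c -> exists i : 'I_(2 * k), guest i = x.
Proof.
case/mapP=> d d_c xd.
have ltq : index d c < k by rewrite index_mem.
have [-> | ndx] := eqVneq x d.
  have lti : (index d c).*2 < 2 * k by lia.
  by exists (Ordinal lti); rewrite /guest /= odd_double doubleK nth_index.
have lti : (index d c).*2.+1 < 2 * k by lia.
exists (Ordinal lti); rewrite /guest /= odd_double /= uphalf_double nth_index //.
move: ndx xd; case: x d {d_c ltq lti} => u p [v q] /= + uv.
by rewrite uv /spouse xpair_eqE eqxx /=; case: p; case: q.
Qed.

Lemma vertices_seats x :
  (phi x \in vertices [set e in seats]) = (x.1 \in map fst c).
Proof.
apply/bigcupP/idP => [[e]|/guest_onto[i <-]].
  rewrite inE => /tnthP[i ->]; rewrite /ends tnth_mktuple /=.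
  by case/set2P => /phi_inj ->; apply: couple_guest;
    [exact: ltn_ord i | exact: (ltn_ord (ordS i))].
exists (tnth seats i); first by rewrite inE mem_tnth.
by rewrite /ends tnth_mktuple set21.
Qed.

(** The last link closes the cycle, whence the index modulo k. *)
Lemma linksP l : reflect (exists2 q, q < k &
  l = (spouse (nth d0 c q), nth d0 c (q.+1 %% k))) (l \in links c).
Proof.
have szl : size (links c) = k by rewrite size_zip size_map size_rot minnn.
have nthl q : q < k -> nth (d0, d0) (links c) q =
    (spouse (nth d0 c q), nth d0 c (q.+1 %% k)).
  move=> ltq; rewrite nth_zip ?size_map ?size_rot //.
  rewrite (set_nth_default (spouse d0)) ?size_map // (nth_map d0) //; congr pair.
  move: (ltq) (c_ge2); rewrite /k; case: (c) => // d c' ltq' _.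
  rewrite rot1_cons nth_rcons; case: ltngtP => [lt|gt|->]; rewrite /=.
  - by rewrite modn_small.
  - by move: ltq' => /=; lia.
  - by rewrite modnn.
apply: (iffP (nthP (d0, d0))) => [[q]|[q ltq ->]].
  by rewrite szl => ltq <-; exists q; rewrite ?nthl.
by exists q; rewrite ?szl ?nthl.
Qed.

Lemma mem_seats e : (e \in seats) =
  (e.2 == lab) && has (fun d => e.1 == pair_set d (spouse d)) c
  || (e.2 == zero) && has (fun l => e.1 == pair_set l.1 l.2) (links c).
Proof.
have oddlink q : q < k ->
    (guest q.*2.+1, guest (q.*2.+2 %% (2 * k))) =
    (spouse (nth d0 c q), nth d0 c (q.+1 %% k)).
  move=> ltq; rewrite /guest /= odd_double /= uphalf_double; congr pair.
  have -> : q.*2.+2 = 2 * q.+1 by lia.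
  by rewrite -muln_modr mul2n odd_double doubleK.
apply/tnthP/orP => [[i ->]|[]].
- rewrite tnth_mktuple /=; have ltik := ltn_ord i; have [oi|ei] := boolP (odd i).
    right; rewrite eqxx /=.
    have ltq : i./2 < k by lia.
    apply/hasP; exists (spouse (nth d0 c i./2), nth d0 c (i./2.+1 %% k)).
      by apply/linksP; exists i./2.
    have iE : i./2.*2.+1 = i by move: (odd_double_half i); rewrite oi.
    by have := oddlink _ ltq; rewrite iE => -[<- <-].
  left; rewrite eqxx /=; apply/hasP; exists (nth d0 c i./2).
    by apply: mem_nth; rewrite -/k; lia.
  by rewrite guestS //= /guest (negPf ei).
- case: e => E l /= /andP[/eqP-> /hasP[d d_c /eqP->]].
  have /guest_onto[i0 iE] : d.1 \in map fst c by apply: map_f.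
  have ltq : index d c < k by rewrite index_mem.
  have lti : (index d c).*2 < 2 * k by lia.
  exists (Ordinal lti); rewrite tnth_mktuple /= odd_double /=.
  by rewrite guestS ?odd_double //= /guest odd_double doubleK nth_index.
- case: e => E l /= /andP[/eqP-> /hasP[l' /linksP[q ltq ->] /eqP->]] /=.
  have lti : q.*2.+1 < 2 * k by lia.
  exists (Ordinal lti); rewrite tnth_mktuple /= odd_double /=.
  by have := oddlink _ ltq; case=> <- <-.
Qed.

End Table.
Section Night.

Variables (s t : nat) (mm : 'I_t -> nat) (B : seq (seq (C * bool))).
Variables (lab : 'I_gamma) (d0 : C * bool).
Hypotheses (zero0 : zero = 0 :> nat) (mm_ge2 : forall j, 2 <= mm j).
Hypothesis B_block : is_block [seq mm j | j <- enum 'I_t] B.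
Hypothesis C_card : #|C| = s + \sum_(j < t) mm j.

Let seated : seq C := map fst (flatten B).

Definition idle (i : 'I_s) : C :=
  nth d0.1 [seq u <- enum C | u \notin seated] i.

Definition table (x : 'I_s + 'I_t) : {set medge V gamma} :=
  match x with
  | inl i => [set (pair_set (idle i, false) (idle i, true), lab)]
  | inr j => [set e in seats lab (nth [::] B j) d0]
  end.

Definition night : {set medge V gamma} := \bigcup_x table x.

Let diners (x : 'I_s + 'I_t) : seq C :=
  match x with
  | inl i => [:: idle i]
  | inr j => map fst (nth [::] B j)
  end.

Let B_size : size B = t.
Proof.
by case/andP: B_block => /eqP/(congr1 size); rewrite 2!size_map size_enum_ord => ->.
Qed.

Let table_size (j : 'I_t) : size (nth [::] B j) = mm j.
Proof.
case/andP: B_block => /eqP/(congr1 (fun r => nth 0 r j)) + _.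
rewrite (nth_map [::]) ?B_size // (nth_map j) ?nth_ord_enum //.
by rewrite size_enum_ord.
Qed.

Let seatedE : seated = flatten [seq map fst c | c <- B].
Proof. by rewrite /seated map_flatten. Qed.

Let seated_uniq : uniq seated. Proof. by case/andP: B_block. Qed.

Let seated_size : size seated = \sum_(j < t) mm j.
Proof.
rewrite size_map size_flatten /shape; case/andP: B_block => /eqP -> _.
by rewrite sumnE big_map big_enum.
Qed.

Let idle_size : size [seq u <- enum C | u \notin seated] = s.
Proof.
rewrite size_filter -(@eq_count _ (predC (mem seated))) //.
have := count_predC (mem seated) (enum C).
rewrite -cardE C_card addnC -seated_size => /eqP.
suff -> : count (mem seated) (enum C) = size seated by rewrite eqn_add2r => /eqP.
rewrite -size_filter; apply/perm_size/uniq_perm => //.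
  by rewrite filter_uniq ?enum_uniq.
by move=> u; rewrite mem_filter mem_enum andbT.
Qed.

Let idle_notin i : idle i \notin seated.
Proof.
have: idle i \in [seq u <- enum C | u \notin seated].
  by rewrite mem_nth // idle_size.
by rewrite mem_filter => /andP[].
Qed.

Let idle_inj : injective idle.
Proof.
move=> i j /eqP; rewrite nth_uniq ?idle_size ?(filter_uniq _ (enum_uniq C)) //.
by move/eqP/val_inj.
Qed.

Let idle_onto u : u \notin seated -> exists i, idle i = u.
Proof.
move=> nu; have: u \in [seq v <- enum C | v \notin seated].
  by rewrite mem_filter nu mem_enum.
case/(nthP d0.1) => q; rewrite idle_size => ltq <-.
by exists (Ordinal ltq).
Qed.

Let nth_sub_seated (j : 'I_t) u : u \in map fst (nth [::] B j) -> u \in seated.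
Proof.
move=> uj; rewrite seatedE; apply/flattenP.
by exists (map fst (nth [::] B j)) => //; apply/map_f/mem_nth; rewrite B_size.
Qed.

Let seatedP u : u \in seated -> exists j : 'I_t, u \in map fst (nth [::] B j).
Proof.
rewrite seatedE => /flattenP[_ /mapP[c cB ->] uc].
have ltj : index c B < t by rewrite -B_size index_mem.
by exists (Ordinal ltj); rewrite /= nth_index.
Qed.

Let diners_onto u : exists x, u \in diners x.
Proof.
have [/seatedP[j uj]|/idle_onto[i <-]] := boolP (u \in seated); first by exists (inr j).
by exists (inl i); rewrite /= inE.
Qed.

Let table_uniq (j : 'I_t) : uniq (map fst (nth [::] B j)).
Proof.
have ltj : j < size B by rewrite B_size.
move: seated_uniq; rewrite seatedE -{1}(cat_take_drop j B) (drop_nth [::] ltj).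
by rewrite map_cat flatten_cat cat_uniq /= cat_uniq => /and4P[_ _ ->].
Qed.

Let diners_inj x y u : u \in diners x -> u \in diners y -> x = y.
Proof.
wlog: x y / (if x is inr j then if y is inr j' then j <= j' else false else true).
  case: x y => [i|j] [i'|j'] wlg ux uy; try exact: wlg.
    by apply/esym; apply: wlg.
  case/orP: (leq_total j j') => le; first exact: wlg.
  by apply/esym; apply: wlg.
case: x y => [i|j] [i'|j'] //=; rewrite ?inE.
- by move=> _ /eqP -> /eqP /idle_inj ->.
- by move=> _ /eqP -> /nth_sub_seated; rewrite (negPf (idle_notin i)).
rewrite leq_eqVlt => /orP[/eqP/val_inj-> //|ltjj] uj uj'.
have ltj : j' < size B by rewrite B_size.
move: seated_uniq; rewrite seatedE -{1}(cat_take_drop j' B) (drop_nth [::] ltj).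
rewrite map_cat flatten_cat cat_uniq /= => /and3P[_ /hasPn/(_ u)+ _].
rewrite mem_cat uj' => /(_ isT) /negP; case.
apply/flattenP; exists (map fst (nth [::] B j)) => //; apply: map_f.
by rewrite -(nth_take _ ltjj) mem_nth // size_take B_size ltn_ord.
Qed.

Let vertices_table x w : (phi w \in vertices (table x)) = (w.1 \in diners x).
Proof.
case: x => [i|j] /=; last by rewrite vertices_seats ?table_size ?mm_ge2.
rewrite /vertices big_set1 /ends /= /pair_set !inE !(inj_eq phi_inj).
by case: w => u []; rewrite !xpair_eqE /= ?andbF ?andbT ?orbF.
Qed.

Let unphi v : exists w, v = phi w.
Proof. by case: phi_bij => psi _ psiK; exists (psi v). Qed.

Let table_disjoint x y : x != y -> [disjoint vertices (table x) & vertices (table y)].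
Proof.
apply: contraNT; rewrite -setI_eq0 => /set0Pn[v].
have [w ->] := unphi v; rewrite inE !vertices_table => /andP[wx wy].
by apply/eqP; apply: diners_inj wx wy.
Qed.

(** All tables together: the copies with label lab of the whole 1-factor, whether at round
    or at small tables, and the links of the block. The tables themselves have
    disappeared, which is what makes disjointness of nights a matter of links only. *)
Lemma mem_night e : (e \in night) =
  (e.2 == lab) && (e.1 \in couple_sets)
  || (e.2 == zero) && has (fun l => e.1 == pair_set l.1 l.2) (block_links B).
Proof.
apply/bigcupP/orP.
  case=> -[i|j] _ /=; first by rewrite inE => /eqP-> /=; left; rewrite eqxx pair_set_couple eqxx.
  have uniqj := table_uniq j; rewrite inE mem_seats ?table_size //.
  case/orP => /andP[-> /=].
    by case/hasP=> d _ /eqP ->; left; rewrite pair_set_couple eqxx.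
  case/hasP=> l lB el; right; apply/hasP; exists l => //.
  apply/flattenP; exists (links (nth [::] B j)) => //.
  by apply/map_f/mem_nth; rewrite B_size.
case=> /andP[e2].
  case/imsetP=> u _ e1; have [[i|j] ux] := diners_onto u.
    exists (inl i) => //=; rewrite inE; move: ux; rewrite inE => /eqP <-.
    by rewrite -e1 -(eqP e2) -surjective_pairing eqxx.
  have uniqj := table_uniq j.
  exists (inr j) => //=; rewrite inE mem_seats ?table_size //.
  rewrite e2 e1 /=; case/mapP: ux => d dj ud; apply/orP; left.
  apply/hasP; exists d => //; rewrite ud /spouse; case: (d) => v [] //=.
  by rewrite pair_setC.
case/hasP=> l /flattenP[_ /mapP[c cB ->] lc] e1.
have ltj : index c B < t by rewrite -B_size index_mem.
have := table_uniq (Ordinal ltj); have := table_size (Ordinal ltj).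
rewrite /= nth_index // => szc uniqc.
exists (inr (Ordinal ltj)) => //=; rewrite inE nth_index // mem_seats ?szc //.
by rewrite e2 /=; apply/orP; right; apply/hasP; exists l.
Qed.

Lemma block_links_neq l : l \in block_links B -> l.1.1 != l.2.1.
Proof.
case/flattenP=> _ /mapP[c cB ->].
have ltj : index c B < t by rewrite -B_size index_mem.
have := table_uniq (Ordinal ltj); have := table_size (Ordinal ltj).
rewrite /= nth_index // => szc uniqc.
have c_ge2 : 2 <= size c by rewrite szc.
case/(linksP d0 c_ge2 uniqc) => q ltq -> /=; have ltm := ltn_pmod q.+1 (ltnW c_ge2).
rewrite -!(nth_map d0 d0.1 fst) // nth_uniq ?size_map //.
have [lt|ge] := ltnP q.+1 (size c); first by rewrite modn_small // neq_ltn ltnSn.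
have qE : q.+1 = size c by apply/eqP; rewrite eqn_leq ltq.
rewrite qE modnn -lt0n -ltnS qE; exact: c_ge2.
Qed.

Lemma night_sub : night \subset KI_edges gamma couple_sets.
Proof.
apply/subsetP => e; rewrite mem_night inE /is_I_edge /ends.
case/orP => /andP[/eqP e2].
  case/imsetP=> u _ e1; rewrite e1 card_pair_set ?eqxx ?pair_set_couple ?eqxx //.
  by rewrite xpair_eqE eqxx.
case/hasP=> l /block_links_neq nl /eqP->; rewrite card_pair_set ?eqxx.
  by rewrite e2 zero0 eqxx orbT.
by apply: contraNneq nl => ->.
Qed.

Lemma night_factor : I_alternating_factor couple_sets s mm night.
Proof.
exists table; split.
- split.
  + by split; [exact: night_sub | ].
  + apply/setP=> v; have [w ->] := unphi v; rewrite inE; apply/bigcupP.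
    by have [x wx] := diners_onto w.1; exists x; rewrite ?vertices_table.
  + exact: table_disjoint.
  + move=> i; exists (pair_set (idle i, false) (idle i, true), lab); split=> //.
    by rewrite /ends card_pair_set // xpair_eqE eqxx.
  + move=> j; rewrite -(table_size j) /=.
    exists (guests (nth [::] B j) d0), (seats lab (nth [::] B j) d0).
    by apply: guests_traverse; rewrite ?table_size // table_uniq.
- move=> i e; rewrite inE => /eqP ->.
  by rewrite /is_I_edge /ends /= pair_set_couple.
- move=> j; rewrite -(table_size j) /=.
  exists (guests (nth [::] B j) d0), (seats lab (nth [::] B j) d0); split.
    by apply: guests_traverse; rewrite ?table_size // table_uniq.
  by move=> i; apply: seats_alternate; rewrite ?table_size // table_uniq.
Qed.

End Night.
End Seating.

Section Schedule.

Variables (C V : finType) (phi : C * bool -> V) (phi_bij : bijective phi).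
Variables (s t : nat) (mm : 'I_t -> nat) (mm_ge2 : forall j, 2 <= mm j).
Hypotheses (C_card : #|C| = s + \sum_(j < t) mm j) (C_gt1 : 1 < #|C|).

(** With one night per block and the label of the copies of I equal to the index of the
    block, copies of I-edges are used once by construction, and links are used once because
    the multiplicity is 1. *)
Lemma schedule_of_decomposition :
    decomposable [seq mm j | j <- enum 'I_t] (fun u v : C => u != v) ->
  exists gamma : nat, 1 <= gamma /\
  exists P : {set {set medge V gamma}},
    partition P (KI_edges gamma (couple_sets phi)) /\
    forall F, F \in P -> I_alternating_factor (couple_sets phi) s mm F.
Proof.
case=> Bs okBs multBs; have phi_inj := bij_inj phi_bij.
have [u0 [v0 [_ _ uv0]]] := card_gt1P C_gt1.
pose d0 := (u0, false).
have gamma_gt0 : 0 < size Bs.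
  rewrite lt0n size_eq0; apply: contraPneq (multBs d0 (v0, false)) => ->.
  by rewrite /mult /= uv0.
pose zero := Ordinal gamma_gt0.
pose F (i : 'I_(size Bs)) := @night C V phi _ zero s t (nth [::] Bs i) i d0.
have okB (i : 'I_(size Bs)) : is_block [seq mm j | j <- enum 'I_t] (nth [::] Bs i).
  by apply: (allP okBs); apply: mem_nth.
have memF i := @mem_night C V phi phi_bij _ zero s t mm _ i d0 mm_ge2 (okB i) C_card.
have linksN i := block_links_neq d0 mm_ge2 (okB i).
have joinsE a b l : pair_set phi a b = pair_set phi l.1 l.2 -> joins a b l.
  move/(pair_set_inj phi_bij); rewrite /joins; case: l => x y /=.
  by case=> -[-> ->]; rewrite eqxx ?orbT.
have multE a b : mult Bs a b = \sum_(i < size Bs) count (joins a b) (block_links (nth [::] Bs i)).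
  by rewrite /mult count_flatten -map_comp sumnE big_map (big_nth [::]) big_mkord.
(* A common I-edge would carry two labels, a common link would have multiplicity 2. *)
have disjF (i j : 'I_(size Bs)) : j != i -> [disjoint F i & F j].
  move=> nij; rewrite -setI_eq0; apply/negPn/negP => /set0Pn[e].
  have couple_link k l : l \in block_links (nth [::] Bs (k : 'I_(size Bs))) ->
      pair_set phi l.1 l.2 \notin couple_sets phi.
    move/linksN => nl; rewrite pair_set_couple //; apply: contraNneq nl => ->.
    by rewrite eqxx.
  rewrite inE !memF => /andP[] /orP[] /andP[e2 He] /orP[] /andP[e2' He'].
  - by move: nij; rewrite -(eqP e2) -(eqP e2') eqxx.
  - by case/hasP: He' => l /couple_link + /eqP eE; rewrite -eE He.
  - by case/hasP: He => l /couple_link + /eqP eE; rewrite -eE He'.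
  case/hasP: He He' => -[a b] li /eqP eE /hasP[l' lj /eqP eE'] /=.
  have nab := linksN _ _ li; have := multBs a b; rewrite multE nab /= => mE.
  have cnt k l : l \in block_links (nth [::] Bs k) -> e.1 = pair_set phi l.1 l.2 ->
      0 < count (joins a b) (block_links (nth [::] Bs k)).
    move=> lk el; rewrite -has_count; apply/hasP; exists l => //.
    by apply: joinsE; rewrite -el.
  move: mE; rewrite (bigD1 i) //= (bigD1 j) //=.
  have := cnt _ _ li eE; have := cnt _ _ lj eE'; rewrite /=.
  by case: (count _ _) => // x _; case: (count _ _) => // y _; rewrite addSn addnS.
exists (size Bs); split=> //; exists [set F i | i : 'I_(size Bs)]; split; last first.
  by move=> _ /imsetP[i _ ->]; apply: night_factor.
have nF0 : set0 \notin [set F i | i : 'I_(size Bs)].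
  apply/imsetP => -[i _ F0]; have : (pair_set phi d0 (spouse d0), i) \in F i.
    by rewrite memF /= eqxx pair_set_couple // eqxx.
  by rewrite -F0 inE.
have [trivF _] := trivIimset (in2W disjF) nF0.
apply/and3P; split=> //; rewrite eqEsubset; apply/andP; split.
  by apply/bigcupsP => _ /imsetP[i _ ->]; apply: night_sub.
apply/subsetP => -[E l]; rewrite inE /is_I_edge /ends /= => /andP[/cards2P[x [y [nxy EE]]]].
have [EI _|nEI /= l0] := boolP (E \in couple_sets phi).
  by apply/bigcupP; exists (F l); rewrite ?imset_f // memF /= EI eqxx.
case: phi_bij => psi psiK phiK.
have EE' : E = pair_set phi (psi x) (psi y) by rewrite /pair_set !phiK.
have nab : (psi x).1 != (psi y).1.
  apply: contraNneq nEI => eq1; rewrite EE' pair_set_couple //.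
  have : psi x != psi y by rewrite (inj_eq (can_inj phiK)).
  case: (psi x) (psi y) eq1 => u p [v q] /= ->.
  by rewrite /spouse !xpair_eqE eqxx /=; case: p; case: q.
have := multBs (psi x) (psi y); rewrite nab /= multE => mE.
have [i] : exists i : 'I_(size Bs), 0 < count (joins (psi x) (psi y)) (block_links (nth [::] Bs i)).
  apply/existsP; apply: contraPT isT => /existsPn none.
  by move: mE; rewrite big1 // => i _; apply/eqP; rewrite -leqn0 leqNgt.
rewrite -has_count => /hasP[l' li jl].
apply/bigcupP; exists (F i); rewrite ?imset_f // memF /=; apply/orP; right.
apply/andP; split; first by apply/eqP/val_inj/eqP.
apply/hasP; exists l' => //; rewrite EE'.
by case/orP: jl => /eqP -> //=; rewrite pair_setC.
Qed.

End Schedule.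

(** A 1-factor of 2n vertices has n members; choosing an order on the two ends of each
    identifies the vertices with persons. *)
Lemma one_factor_couples (V : finType) (I : {set {set V}}) (n : nat) :
    one_factor I -> #|V| = 2 * n ->
  exists phi : 'I_n * bool -> V, bijective phi /\ couple_sets phi = I.
Proof.
case=> partI card2 cardV.
have cardI : #|I| = n.
  have := card_partition partI; rewrite cardsT cardV.
  rewrite (eq_bigr (fun=> 2)) ?sum_nat_const => [|e /card2 //]; lia.
pose e (u : 'I_n) : {set V} := enum_val (cast_ord (esym cardI) u).
have eI u : e u \in I by apply: enum_valP.
have e_inj : injective e by move=> u v /enum_val_inj/cast_ord_inj.
have ends_e u : exists p : V * V, p.1 != p.2 /\ e u = [set p.1; p.2].
  have /cards2P[x [y]] := introT eqP (card2 _ (eI u)).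
  by exists (x, y).
have [f fP] := fin_all_exists ends_e.
pose phi (d : 'I_n * bool) := if d.2 then (f d.1).2 else (f d.1).1.
have phi_e d : phi d \in e d.1.
  by rewrite (fP d.1).2 /phi; case: ifP; rewrite !inE eqxx ?orbT.
have trivI := elimT and3P partI; case: trivI => _ /trivIsetP trivI _.
have phi_inj : injective phi.
  move=> [u p] [v q] eqd; have uv : u = v.
    apply: e_inj; apply/eqP/negPn/negP => /(trivI _ _ (eI u) (eI v)).
    rewrite -setI_eq0 => /eqP/setP/(_ (phi (u, p))); rewrite !inE (phi_e (u, p)).
    by rewrite eqd (phi_e (v, q)).
  move: eqd; rewrite uv /phi; have [nf _] := fP v.
  by case: p; case: q => //= /eqP; rewrite ?(negPf nf) // eq_sym (negPf nf).
have sets_e u : [set phi (u, false); phi (u, true)] = e u by rewrite (fP u).2.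
exists phi; split.
  by apply: inj_card_bij => //; rewrite card_prod card_bool card_ord cardV mulnC.
apply/setP => E; apply/imsetP/idP => [[u _ ->]|EI].
  by rewrite [pair_set _ _ _]sets_e.
exists (cast_ord cardI (enum_rank_in EI E)) => //.
by rewrite [pair_set _ _ _]sets_e /e cast_ordK enum_rankK_in.
Qed.

Theorem HOP_of_decomposition (s t : nat) (mm : 'I_t -> nat) :
    (forall j, 2 <= mm j) -> 1 < s + \sum_(j < t) mm j ->
    decomposable [seq mm j | j <- enum 'I_t]
      (fun u v : 'I_(s + \sum_(j < t) mm j) => u != v) ->
  HOP_has_solution s mm.
Proof.
move=> mm_ge2 n_gt1 dec n I I_factor.
have [phi [phi_bij <-]] := one_factor_couples I_factor (card_ord _).
by apply: schedule_of_decomposition; rewrite ?card_ord.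
Qed.

(** * Gluing groups of couples *)

Lemma sum_pick (T : finType) (x : T) (F : T -> nat) :
  \sum_y (x == y) * F y = F x.
Proof.
rewrite (bigD1 x) //= eqxx mul1n big1 ?addn0 // => y.
by rewrite eq_sym => /negPf ->.
Qed.

(** Roles of groups: 0 and 1 are the outer members of a trio, 2 is its middle and 3 the
    group at infinity. Positions a in group i and b in group j are to be joined when this
    is true; cl a b is the role that takes charge of joining position a to position b of
    the group at infinity. *)
Definition group_pattern (S : rel nat) (cl : nat -> nat -> nat) (i j a b : nat) : bool :=
  match i, j with
  | 0, 1 | 1, 0 => ~~ S a b && ~~ S b a
  | 0, 2 | 1, 2 => S a b
  | 2, 0 | 2, 1 => S b a
  | 3, (0 | 1 | 2) => cl b a == j
  | (0 | 1 | 2), 3 => cl a b == i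
  | _, _ => false
  end.

Arguments group_pattern : simpl never.

(** The same with couple u coded as position u mod g of group u / g. *)
Definition groups_pattern g S cl (u v : nat) : bool :=
  group_pattern S cl (u %/ g) (v %/ g) (u %% g) (v %% g).

Section Embedding.

Variables (ms : seq nat) (k g : nat) (S : rel nat) (cl : nat -> nat -> nat).

(** The sum is the push-forward of the pattern when the k groups are placed at the indices
    h 0, ..., h (k - 1); in this form the covers by many placements are evaluated by
    exchanging sums. *)
Lemma decomposable_groups (T : eqType) (h : 'I_k -> T) :
    injective h ->
    decomposable ms (fun u v : 'I_(k * g) => groups_pattern g S cl u v : nat) ->
  decomposable ms (fun u v : T * 'I_g =>
    \sum_(i < k) \sum_(j < k)
      (u.1 == h i) * ((v.1 == h j) * group_pattern S cl i j u.2 v.2)).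
Proof.
move=> h_inj dec.
have g_gt0 (u : 'I_(k * g)) : 0 < g.
  by case: (g) u => // -[m]; rewrite muln0.
have ltq (u : 'I_(k * g)) : u %/ g < k by rewrite ltn_divLR ?(g_gt0 u) ?ltn_ord.
have ltr (u : 'I_(k * g)) : u %% g < g by rewrite ltn_pmod ?(g_gt0 u).
pose f (u : 'I_(k * g)) : T * 'I_g := (h (Ordinal (ltq u)), Ordinal (ltr u)).
have sumE i j a b : \sum_(i' < k) \sum_(j' < k)
    (h i == h i') * ((h j == h j') * group_pattern S cl i' j' a b) =
    group_pattern S cl i j a b.
  under eq_bigr => i' _ do rewrite -big_distrr (inj_eq h_inj) /=.
  rewrite sum_pick; under eq_bigr => j' _ do rewrite (inj_eq h_inj).
  by rewrite sum_pick.
have f_inj : injective f.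
  move=> u v [/h_inj/(congr1 val) /= eqq eqr].
  by apply: val_inj; rewrite /= (divn_eq u g) (divn_eq v g) eqq eqr.
apply: (decomposable_map f_inj dec) => [u v|u v]; first by rewrite sumE.
have onto i (a : 'I_g) : exists x, (h i, a) = f x.
  have ltx : i * g + a < k * g.
    apply: (@leq_trans (i.+1 * g)); first by rewrite mulSn addnC ltn_add2r.
    by rewrite leq_mul2r ltn_ord orbT.
  exists (Ordinal ltx); congr (h _, _); apply: val_inj => /=.
    by rewrite divnMDl ?(leq_ltn_trans _ (ltn_ord a)) // divn_small ?addn0.
  by rewrite modnMDl modn_small.
rewrite sum_nat_eq0 negb_forall => /existsP[i /=]; rewrite sum_nat_eq0 negb_forall.
case/existsP=> j /=; rewrite !muln_eq0 !negb_or !eqb0 !negbK => /and3P[/eqP ui /eqP vj _].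
have [x ux] := onto i u.2; have [y vy] := onto j v.2.
by exists x, y; rewrite -ux -vy -ui -vj -!surjective_pairing.
Qed.

End Embedding.

Section OddCycle.

Variable h : nat.
Let R := 'I_(h.*2.+3).
Local Open Scope ring_scope.

(** One residue out of each pair e, - e of nonzero residues. *)
Definition positive (e : R) : bool := (0 < e <= h.+1)%N.

(** The inverse of 2 modulo 2h + 3, because 2 (h + 2) = (2h + 3) + 1. *)
Definition half : R := inZp h.+2.

Lemma half2 : half + half = 1.
Proof.
apply: val_inj; rewrite /= modnDm.
have -> : (h.+2 + h.+2 = 1 + h.*2.+3)%N by lia.
by rewrite modnDr.
Qed.

Lemma double_eq (e x : R) : (e + e == x) = (e == x * half).
Proof.
apply/eqP/eqP => [<-|->]; last by rewrite -mulrDr half2 mulr1.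
by rewrite mulrDl -mulrDr half2 mulr1.
Qed.

Lemma positive0 : positive 0 = false. Proof. by []. Qed.

Lemma positiveN (e : R) : e != 0 -> (positive e + positive (- e) = 1)%N.
Proof.
move=> e0; have lte := ltn_ord e; have : (nat_of_ord e != 0)%N by [].
rewrite /positive /= => e0'; rewrite modn_small; lia.
Qed.

Definition trio (z e : R) (i : nat) : R :=
  match i with 0 => z - e | 1 => z + e | _ => z end.

Lemma trio_inj z e : positive e -> injective (fun i : 'I_3 => trio z e i).
Proof.
move=> pe; have e0 : e != 0 by apply: contraTneq pe => ->.
have ee0 : e + e != 0 by rewrite double_eq mul0r.
have n1 : z - e != z + e by rewrite -subr_eq0 opprD addrACA subrr add0r -opprD oppr_eq0.
have n2 : z - e != z by rewrite -subr_eq0 addrAC subrr add0r oppr_eq0.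
have n3 : z + e != z by rewrite -subr_eq0 addrAC subrr add0r.
move=> [[|[|[|//]]] lti] [[|[|[|//]]] ltj] /= => [_|eqt|eqt|eqt|_|eqt|eqt|eqt|_];
  apply: val_inj => //=; first [by move: n1; rewrite eqt eqxx | by move: n1; rewrite -eqt eqxx
  | by move: n2; rewrite eqt eqxx | by move: n2; rewrite -eqt eqxx
  | by move: n3; rewrite eqt eqxx | by move: n3; rewrite -eqt eqxx].
Qed.

Local Open Scope nat_scope.

(** For given outer group X and middle group Y the trio is forced: z = Y and
    e = Y - X, or e = X - Y when X is in the other outer role. *)
Lemma count_sub_mid (X Y : R) :
  \sum_z \sum_(e | positive e) (X == z - e)%R * (Y == z) = positive (Y - X)%R.
Proof.
under eq_bigr => z _ do rewrite -big_distrl /= mulnC.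
rewrite sum_pick big_mkcond /=.
have [p|np] := boolP (positive _).
  rewrite (bigD1 (Y - X)%R) //= p subKr eqxx big1 // => e ne.
  case: ifP => // _; apply/eqP; rewrite eqb0; apply: contraNneq ne => ->.
  by rewrite subKr.
rewrite big1 // => e _; case: ifP => // pe; apply/eqP; rewrite eqb0.
by apply: contraNneq np => ->; rewrite subKr.
Qed.

Lemma count_add_mid (X Y : R) :
  \sum_z \sum_(e | positive e) (X == z + e)%R * (Y == z) = positive (X - Y)%R.
Proof.
under eq_bigr => z _ do rewrite -big_distrl /= mulnC.
rewrite sum_pick big_mkcond /=.
have [p|np] := boolP (positive _).
  rewrite (bigD1 (X - Y)%R) //= p addrC subrK eqxx big1 // => e ne.
  case: ifP => // _; apply/eqP; rewrite eqb0; apply: contraNneq ne => ->.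
  by rewrite addrAC subrr add0r.
rewrite big1 // => e _; case: ifP => // pe; apply/eqP; rewrite eqb0.
by apply: contraNneq np => ->; rewrite addrAC subrr add0r.
Qed.

(** For given outer groups X = z - e and Y = z + e the trio is forced by 2e = Y - X. *)
Lemma count_sub_add (X Y : R) :
  \sum_z \sum_(e | positive e) (X == z - e)%R * (Y == z + e)%R =
  positive ((Y - X) * half)%R.
Proof.
rewrite exchange_big /=.
have pick e : \sum_z (X == z - e)%R * (Y == z + e)%R = (e == (Y - X) * half)%R.
  under eq_bigr => z _ do rewrite -subr_eq opprK.
  by rewrite sum_pick -double_eq -addrA addrC -subr_eq eq_sym.
under eq_bigr => e _ do rewrite pick.
rewrite big_mkcond /=; have [p|np] := boolP (positive _).
  rewrite (bigD1 ((Y - X) * half)%R) //= p eqxx big1 // => e /negPf ->.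
  by rewrite if_same.
by rewrite big1 // => e _; case: ifP => // pe; case: eqP => // ee; rewrite -ee pe in np.
Qed.

Section Trios.

Variables (g : nat) (S : rel nat) (cl : nat -> nat -> nat).
Hypothesis S_asym : forall a b, a < g -> b < g -> ~~ (S a b && S b a).

(** A pair of roles contributes the number of trios placing X and Y in those roles, which
    is 0 or 1 according to the sign of Y - X or X - Y, halved for the two outer roles. Of
    two opposite nonzero residues exactly one is positive, so S a b, S b a and the
    symmetric remainder each count once, and they exclude one another. *)
Lemma trios_cover (X Y : R) (a b : 'I_g) :
  \sum_z \sum_(e | positive e) \sum_(i < 3) \sum_(j < 3)
    (X == trio z e i) * ((Y == trio z e j) * group_pattern S cl i j a b)
  = (X != Y).
Proof.
pose N i j := \sum_z \sum_(e | positive e) (X == trio z e i) * (Y == trio z e j).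
have -> : \sum_z \sum_(e | positive e) \sum_(i < 3) \sum_(j < 3)
    (X == trio z e i) * ((Y == trio z e j) * group_pattern S cl i j a b) =
  \sum_(i < 3) \sum_(j < 3) N i j * group_pattern S cl i j a b.
  rewrite /N; under [RHS]eq_bigr => i _ do under eq_bigr => j _ do rewrite big_distrl /=.
  under [RHS]eq_bigr => i _ do rewrite exchange_big /=.
  rewrite [RHS]exchange_big /=; apply: eq_bigr => z _.
  under [RHS]eq_bigr => i _ do under eq_bigr => j _ do rewrite big_distrl /=.
  under [RHS]eq_bigr => i _ do rewrite exchange_big /=.
  rewrite [RHS]exchange_big /=; apply: eq_bigr => e _.
  by apply: eq_bigr => i _; apply: eq_bigr => j _; rewrite mulnA.
have N01 : N 0 1 = positive ((Y - X) * half)%R by apply: count_sub_add.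
have N02 : N 0 2 = positive (Y - X)%R by apply: count_sub_mid.
have N12 : N 1 2 = positive (X - Y)%R by apply: count_add_mid.
have swapN i j : N i j = \sum_z \sum_(e | positive e) (Y == trio z e j) * (X == trio z e i).
  by apply: eq_bigr => z _; apply: eq_bigr => e _; rewrite mulnC.
have N10 : N 1 0 = positive ((X - Y) * half)%R by rewrite swapN; apply: count_sub_add.
have N20 : N 2 0 = positive (X - Y)%R by rewrite swapN; apply: count_sub_mid.
have N21 : N 2 1 = positive (Y - X)%R by rewrite swapN; apply: count_add_mid.
rewrite !big_ord_recl !big_ord0 /= /bump /= /group_pattern N01 N02 N12 N10 N20 N21 !muln0 !addn0 !add0n.
have [<-|nXY] := eqVneq X Y; first by rewrite subrr mul0r positive0.
have d0 : (Y - X != 0)%R by rewrite subr_eq0 eq_sym.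
have dh0 : ((Y - X) * half != 0)%R by rewrite eq_sym -double_eq addr0 eq_sym.
have := positiveN dh0; have := positiveN d0; rewrite -mulNr opprB.
have := S_asym (ltn_ord a) (ltn_ord b).
by case: (S a b); case: (S b a); do 4 case: (positive _).
Qed.

Hypothesis cl_lt3 : forall a b, a < g -> b < g -> cl a b < 3.

Definition quartet (z : R) (i : nat) : option R :=
  if i < 3 then Some (trio z 1%R i) else None.

Lemma positive1 : positive 1%R. Proof. by []. Qed.

Lemma quartet_inj z : injective (fun i : 'I_4 => quartet z i).
Proof.
move=> i j; rewrite /quartet; case: (ltnP i 3) (ltnP j 3) => [lti|gei] [ltj|gej] //.
  case=> /(@trio_inj z 1%R positive1 (Ordinal lti) (Ordinal ltj)).
  by move/(congr1 val) => /= eqij; apply: val_inj.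
by move=> _; apply: val_inj => /=; have := ltn_ord i; have := ltn_ord j; lia.
Qed.

(** Every group occurs in each role in exactly one of the trios with e = 1. *)
Lemma count_trio (Y : R) j : \sum_z (Y == trio z 1 j)%R = 1.
Proof.
have [t tE] : exists t : R, forall z, (Y == trio z 1%R j) = (t == z).
  case: j => [|[|j]] /=.
  - by exists (Y + 1)%R => z; rewrite -(inj_eq (addIr 1%R)) subrK.
  - by exists (Y - 1)%R => z; rewrite -(inj_eq (addIr (-1)%R)) addrK.
  - by exists Y.
rewrite (bigD1 t) //= tE eqxx big1 // => z; rewrite tE eq_sym => /negPf ->.
by [].
Qed.

(** Between finite groups the quartets do what the trios with e = 1 did; towards infinity
    position a of a group meets position b in the quartet where that group has role
    cl a b, and there is one such quartet. *)
Lemma quartets_cover (X Y : option R) (a b : 'I_g) :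
  \sum_z (\sum_(e | positive e && (e != 1%R)) \sum_(i < 3) \sum_(j < 3)
    (X == Some (trio z e i)) * ((Y == Some (trio z e j)) * group_pattern S cl i j a b)
  + \sum_(i < 4) \sum_(j < 4)
    (X == quartet z i) * ((Y == quartet z j) * group_pattern S cl i j a b))
  = (X != Y).
Proof.
have classE c d : c < g -> d < g -> \sum_(j < 3) (cl c d == j) = 1.
  move=> ltc ltd; have ltcl := cl_lt3 ltc ltd.
  rewrite (bigD1 (Ordinal ltcl)) //= eqxx big1 // => j.
  by rewrite -val_eqE eq_sym /= => /negPf ->.
have some_eq (U V : R) : (Some U == Some V) = (U == V) by [].
have split4 z : \sum_(i < 4) \sum_(j < 4)
    (X == quartet z i) * ((Y == quartet z j) * group_pattern S cl i j a b) =
    \sum_(i < 3) \sum_(j < 3) (X == Some (trio z 1%R i)) *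
      ((Y == Some (trio z 1%R j)) * group_pattern S cl i j a b)
    + \sum_(i < 3) (X == Some (trio z 1%R i)) * ((Y == None) * (cl a b == i))
    + \sum_(j < 3) (X == None) * ((Y == Some (trio z 1%R j)) * (cl b a == j)).
  have qlt (i : 'I_3) : quartet z i = Some (trio z 1%R i) by rewrite /quartet ltn_ord.
  have p3 (i : 'I_3) c d : (group_pattern S cl i 3 c d = (cl c d == i))
      * (group_pattern S cl 3 i c d = (cl d c == i)) by case: i => -[|[|[|]]].
  rewrite big_ord_recr -big_split /=; congr (_ + _).
    by apply: eq_bigr => i _; rewrite big_ord_recr /= p3 qlt; congr (_ + _);
      apply: eq_bigr => j _; rewrite qlt.
  rewrite big_ord_recr /= !muln0 addn0.
  by apply: eq_bigr => j _; rewrite p3 qlt.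
under eq_bigr => z _ do rewrite split4; case: X Y {split4} => [X|] [Y|] /=.
- rewrite some_eq -(trios_cover X Y a b); apply: eq_bigr => z _.
  rewrite [RHS](bigD1 1%R positive1) /= addnC; congr (_ + _).
  rewrite [X in _ + X]big1 ?addn0 => [|j _ //].
  by rewrite [X in _ + X]big1 ?addn0 // => i _; rewrite muln0.
- under eq_bigr => z _.
    rewrite big1 ?add0n; last first.
      by move=> e _; rewrite big1 // => i _; rewrite big1 // => j _; rewrite muln0.
    rewrite [X in X + _ + _]big1 ?add0n; last first.
      by move=> i _; rewrite big1 // => j _; rewrite muln0.
    rewrite [X in _ + X]big1 ?addn0 //.
    under eq_bigr => i _ do rewrite mul1n.
    over.
  rewrite exchange_big -[RHS](classE a b) //=; apply: eq_bigr => i _.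
  by rewrite -big_distrl /= count_trio mul1n.
- under eq_bigr => z _.
    rewrite big1 ?add0n; last first.
      by move=> e _; rewrite big1 // => i _; rewrite big1.
    rewrite [X in X + _ + _]big1 ?add0n; last by move=> i _; rewrite big1.
    rewrite big1 ?add0n //.
    under eq_bigr => i _ do rewrite mul1n.
    over.
  rewrite exchange_big -[RHS](classE b a) //=; apply: eq_bigr => i _.
  by rewrite -big_distrl /= count_trio mul1n.
- rewrite big1 // => z _; by rewrite !big1 // => i _; rewrite big1.
Qed.

End Trios.

Variables (ms : seq nat) (g : nat) (S : rel nat) (cl : nat -> nat -> nat).
Hypothesis S_asym : forall a b, a < g -> b < g -> ~~ (S a b && S b a).
Hypothesis dec3 :
  decomposable ms (fun u v : 'I_(3 * g) => groups_pattern g S cl u v : nat).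

Lemma odd_groups : decomposable ms (fun u v : R * 'I_g => u.1 != v.1 : nat).
Proof.
apply: decomposable_eq (decomposable_sum (index_enum R) (P := predT) _) _; last first.
  by move=> u v; rewrite -(trios_cover cl S_asym u.1 v.1 u.2 v.2).
move=> z _; apply: decomposable_sum => e pe.
exact: (decomposable_groups (@trio_inj z e pe) dec3).
Qed.

Hypothesis cl_lt3 : forall a b, a < g -> b < g -> cl a b < 3.
Hypothesis dec4 :
  decomposable ms (fun u v : 'I_(4 * g) => groups_pattern g S cl u v : nat).

Lemma even_groups : decomposable ms (fun u v : option R * 'I_g => u.1 != v.1 : nat).
Proof.
apply: decomposable_eq (decomposable_sum (index_enum R) (P := predT) _) _; last first.
  by move=> u v; rewrite -(quartets_cover S_asym cl_lt3 u.1 v.1 u.2 v.2).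
move=> z _; apply: decomposableD; last first.
  exact: (decomposable_groups (@quartet_inj z) dec4).
apply: decomposable_sum => e /andP[pe _].
apply: (@decomposable_groups _ _ _ _ _ _ (fun i : 'I_3 => Some (trio z e i)) _ dec3).
by move=> i j [/(trio_inj pe)].
Qed.

End OddCycle.

Lemma decomposable_card ms (C C' : finType) :
    decomposable ms (fun u v : C => u != v : nat) -> #|C| = #|C'| ->
  decomposable ms (fun u v : C' => u != v : nat).
Proof.
move=> dec eqC.
pose f (u : C) : C' := enum_val (cast_ord eqC (enum_rank u)).
pose f' (u : C') : C := enum_val (cast_ord (esym eqC) (enum_rank u)).
have fK : cancel f f' by move=> u; rewrite /f /f' enum_valK cast_ordK enum_rankK.
have f'K : cancel f' f by move=> u; rewrite /f /f' enum_valK cast_ordKV enum_rankK.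
apply: (decomposable_map (can_inj fK) dec) => u v.
  by rewrite (inj_eq (can_inj fK)).
by exists (f' u), (f' v); rewrite !f'K.
Qed.

Section Fill.

Variables (ms : seq nat) (T : finType) (g w : nat) (x0 : T).
Hypothesis dec_groups : decomposable ms (fun u v : T * 'I_g => u.1 != v.1 : nat).
Hypothesis dec_full : decomposable ms (fun u v : 'I_(g + w) => u != v : nat).
Hypothesis dec_hole : decomposable ms
  (fun u v : 'I_(g + w) => (u != v) && ~~ ((g <= u) && (g <= v)) : nat).

Let C := (T * 'I_g + 'I_w)%type.

(** What the filling of group x has to cover; only the group x0 also covers the pairs of
    extra couples, which all groups share. *)
Let group_part (x : T) (u v : C) : nat :=
  match u, v with
  | inl p, inl q => [&& p.1 == x, q.1 == x & p.2 != q.2]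
  | inl p, inr _ | inr _, inl p => p.1 == x
  | inr a, inr b => (x == x0) && (a != b)
  end.

Lemma decomposable_fill (n : nat) : n = #|T| * g + w ->
  decomposable ms (fun u v : 'I_n => u != v : nat).
Proof.
move=> nE; apply: (@decomposable_card _ C); last first.
  by rewrite card_sum card_prod !card_ord nE.
have dec_part x : decomposable ms (group_part x).
  pose f (u : 'I_(g + w)) : C :=
    match split u with inl a => inl (x, a) | inr b => inr b end.
  have fl a : f (lshift w a) = inl (x, a) by rewrite /f (unsplitK (inl a)).
  have fr b : f (rshift g b) = inr b by rewrite /f (unsplitK (inr b)).
  have f_inj : injective f.
    move=> u v; case: (split_ordP u) => a ->; case: (split_ordP v) => b ->;
    by rewrite ?fl ?fr // => -[->].
  have onto u v : group_part x u v != 0 ->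
      exists y z, u = f y /\ v = f z.
    case: u v => [[y a]|a] [[z b]|b] /=; rewrite eqb0 negbK.
    - by case/and3P=> /eqP-> /eqP-> _; exists (lshift w a), (lshift w b); rewrite !fl.
    - by move/eqP->; exists (lshift w a), (rshift g b); rewrite fl fr.
    - by move/eqP->; exists (rshift g a), (lshift w b); rewrite fl fr.
    - by exists (rshift g a), (rshift g b); rewrite !fr.
  have [xx0|nxx0] := eqVneq x x0.
    apply: (decomposable_map f_inj dec_full _ onto) => u v.
    case: (split_ordP u) => a ->; case: (split_ordP v) => b ->;
      rewrite ?fl ?fr /= ?xx0 ?eqxx ?(inj_eq (@lshift_inj _ _)) ?(inj_eq (@rshift_inj _ _)) //.
    - by rewrite eq_lrshift.
    - by rewrite eq_rlshift.
  apply: (decomposable_map f_inj dec_hole _ onto) => u v.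
  case: (split_ordP u) => a ->; case: (split_ordP v) => b ->;
    rewrite ?fl ?fr /= ?eqxx ?leq_addr ?(leqNgt g a) ?(leqNgt g b) ?ltn_ord /= ?andbT ?andbF ?(negPf nxx0) //.
  - by rewrite eq_lrshift.
  - by rewrite eq_rlshift.
have dec_between : decomposable ms (fun u v : C =>
    match u, v with inl p, inl q => p.1 != q.1 : nat | _, _ => 0 end).
  apply: (decomposable_map (f := @inl _ _) _ dec_groups) => [p q []|//|] //.
  by case=> [p|a] [q|b] // _; exists p, q.
apply: decomposable_eq (decomposableD dec_between
  (decomposable_sum (index_enum T) (P := predT) (fun x _ => dec_part x))) _.
have inl_eq (p q : T * 'I_g) : ((inl p : C) == inl q) = (p == q) by [].
have sum_eq (y : T) (F : bool) : \sum_x (y == x) * F = F by apply: sum_pick.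
case=> [[y a]|a] [[z b]|b] /=.
- have [<-|nyz] := eqVneq y z.
    rewrite add0n (eq_bigr (fun x => (y == x) * (a != b))) ?sum_eq.
      by rewrite inl_eq xpair_eqE eqxx.
    by move=> x _; case: (y == x); rewrite ?mul1n.
  rewrite big1 => [|x _]; last first.
    by have [<-|] := eqVneq y x; rewrite // eq_sym (negPf nyz).
  by rewrite inl_eq xpair_eqE (negPf nyz).
- rewrite add0n (eq_bigr (fun x => (y == x) * true)) ?sum_eq // => x _.
  by rewrite muln1.
- rewrite add0n (eq_bigr (fun x => (z == x) * true)) ?sum_eq // => x _.
  by rewrite muln1.
- rewrite add0n (eq_bigr (fun x => (x0 == x) * (a != b))) ?sum_eq // => x _.
  by rewrite eq_sym; case: (x0 == x); rewrite ?mul1n.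
Qed.

End Fill.

(** * Certificates *)

Definition code (d : nat * bool) : nat := d.2 + d.1.*2.

Definition decode (k : nat) : nat * bool := (k./2, odd k).

Lemma codeK : cancel code decode.
Proof. by case=> u p; rewrite /code /decode half_bit_double oddD odd_double addbF; case: p. Qed.

Definition key (e : (nat * bool) * (nat * bool)) : nat * nat :=
  let x := code e.1 in let y := code e.2 in if x <= y then (x, y) else (y, x).

(** Any relation would give a sound test below; this one sorts lexicographically. *)
Definition key_le (p q : nat * nat) : bool :=
  if Nat.eqb p.1 q.1 then Nat.leb p.2 q.2 else Nat.leb p.1 q.1.

Definition target N (pat : rel nat) : seq (nat * nat) :=
  [seq (code (e.1, pq.1), code (e.2, pq.2))
    | e <- [seq e <- [seq (u, v) | u <- iota 0 N, v <- iota 0 N] | (e.1 < e.2) && pat e.1 e.2],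
      pq <- [:: (false, false); (false, true); (true, false); (true, true)]].

(** Equality of the two sorted lists says that every required link occurs exactly once and
    that nothing else does. *)
Definition valid ms N pat (Bs : seq (seq (seq (nat * bool)))) : bool :=
  all (fun B => is_block ms B && all (fun d => d.1 < N) (flatten B)) Bs
  && (sort key_le (map key (flatten (map (@block_links _) Bs))) == sort key_le (target N pat)).

Lemma key_joins a b e : (key e == key (a, b)) = joins a b e.
Proof.
case: e => x y; rewrite /key /joins /=.
have codeE d d' : (code d == code d') = (d == d') by apply: (inj_eq (can_inj codeK)).
rewrite !xpair_eqE -!codeE.
case: (leqP (code x) (code y)) => ?; case: (leqP (code a) (code b)) => ?;
  rewrite xpair_eqE; apply/andP/orP => [[/eqP e1 /eqP e2]|[]/andP[/eqP e1 /eqP e2]];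
  try (split; apply/eqP; lia).
all: try (by left; rewrite e1 e2 !eqxx).
all: by right; rewrite ?e1 ?e2 ?eqxx.
Qed.

Lemma target_uniq N pat : uniq (target N pat).
Proof.
apply: allpairs_uniq => //.
  by apply/filter_uniq/allpairs_uniq; rewrite ?iota_uniq // => -[? ?] [? ?].
move=> [[u v] [p q]] [[u' v'] [p' q']] _ _ [] eu ev.
by have [-> ->] := can_inj codeK eu; have [-> ->] := can_inj codeK ev.
Qed.

Lemma mem_target N (pat : rel nat) a b :
    symmetric pat -> irreflexive pat -> a.1 < N -> b.1 < N ->
  (key (a, b) \in target N pat) = pat a.1 b.1.
Proof.
move=> pat_sym pat_irr.
have aux x y : x.1 < N -> y.1 < N -> code x <= code y ->
    ((code x, code y) \in target N pat) = pat x.1 y.1.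
  move=> ltx lty lexy; apply/allpairsP/idP => [[[[u v] [p q]]] /= []|pxy].
    rewrite mem_filter /= => /andP[/andP[_ puv] _] _ [] ex ey.
    by rewrite (can_inj codeK ex) (can_inj codeK ey).
  (* Codes increase with the couple, and the pattern excludes equal couples. *)
  have ltxy : x.1 < y.1.
    have nxy : x.1 != y.1 by apply: contraTneq pxy => ->; rewrite pat_irr.
    by move: lexy nxy; rewrite /code; case: (x.2); case: (y.2) => /=; lia.
  exists ((x.1, y.1), (x.2, y.2)); split; rewrite -?surjective_pairing //=.
    by rewrite mem_filter /= ltxy pxy allpairs_f // mem_iota.
  by case: (x.2); case: (y.2).
move=> lta ltb; rewrite /key /=; case: leqP => le; first exact: aux.
by rewrite pat_sym; apply: aux => //; apply: ltnW.
Qed.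

(** The blocks found on natural numbers are those of the ordinals below N, along the
    injection of the latter, because all their couples are below N. *)
Lemma valid_decomposable ms N (pat : rel nat) Bs :
    symmetric pat -> irreflexive pat -> valid ms N pat Bs ->
  decomposable ms (fun u v : 'I_N => pat u v : nat).
Proof.
move=> pat_sym pat_irr /andP[okBs /eqP sortE].
case: N => [|N] in okBs sortE *; first by exists nil => // -[[]].
pose fd (d : 'I_N.+1 * bool) := (val d.1, d.2).
pose Bs' := map (map (map (fun d => (inord d.1 : 'I_N.+1, d.2)))) Bs.
have BsE : map (map (map fd)) Bs' = Bs.
  rewrite -map_comp -[RHS]map_id; apply/eq_in_map => B BBs /=.
  have /andP[_ /allP ltB] := allP okBs B BBs.
  rewrite -map_comp -[RHS]map_id; apply/eq_in_map => c cB /=.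
  rewrite -map_comp -[RHS]map_id; apply/eq_in_map => d dc /=.
  rewrite /fd /= inordK -?surjective_pairing //; apply: ltB.
  by apply/flattenP; exists c.
exists Bs' => [|a b].
  apply/allP => B BBs; rewrite -(is_block_map (@val_inj _ _ 'I_N.+1)).
  have : map (map fd) B \in Bs by rewrite -BsE map_f.
  by case/(allP okBs)/andP.
rewrite -(mult_map (@val_inj _ _ 'I_N.+1)) -/fd BsE.
rewrite -(mem_target (a := fd a) (b := fd b) pat_sym pat_irr (ltn_ord _) (ltn_ord _)).
rewrite -count_uniq_mem ?target_uniq //.
rewrite -(permP (permEl (perm_sort key_le _))) -sortE.
rewrite (permP (permEl (perm_sort _ _))) count_map.
by apply: eq_count => e; rewrite /= key_joins.
Qed.

(** Base blocks, flat and with person (u, p) coded as 2u + p, to be developed under two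
    commuting permutations: rotation by one step of each run of [period] consecutive couples
    among the first [moved] ones, and exchange of the spouses in each of the first [flipped]
    couples. *)
Record certificate := Certificate
  { period : nat; moved : nat; flipped : nat; base : seq (seq nat) }.

Definition turn c l (d : nat * bool) : nat * bool :=
  (if d.1 < l then (if d.1.+1 %% c == 0 then d.1.+1 - c else d.1.+1) else d.1, d.2).

Definition flip f (d : nat * bool) : nat * bool :=
  (d.1, if d.1 < f then ~~ d.2 else d.2).

Definition develop ms (C : certificate) : seq (seq (seq (nat * bool))) :=
  let start := [seq reshape ms (map decode B) | B <- base C] in
  let start2 := if flipped C == 0 then start
                else start ++ map (map (map (flip (flipped C)))) start in
  flatten (traject (map (map (map (turn (period C) (moved C))))) start2 (period C)).

Definition certifies ms N pat C := valid ms N pat (develop ms C).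

Definition complete_pattern (u v : nat) : bool := u != v.

Definition holed_pattern g (u v : nat) : bool :=
  (u != v) && ~~ ((g <= u) && (g <= v)).

(** Both relations on positions are invariant under simultaneous rotation of the groups,
    so that the decompositions may be rotation-invariant as well. *)
Definition residue_rel g (D : seq nat) (a b : nat) : bool := (b + g - a) %% g \in D.

Definition residue_class g (cl : seq nat) (a b : nat) : nat := nth 0 cl ((b + g - a) %% g).

(** Decompositions on g + w couples for w extra couples: complete, and with a hole at the
    extra couples (the same thing when w <= 1). The optional one, on 2g + w couples, handles
    two groups, which are too few for a trio. *)
Record filling := Filling
  { extra : nat; full : certificate; holed : certificate; doubled : option certificate }.

(** The field forward lists the differences of positions that belong to S. Without quartets,
    a plan covers odd numbers of groups only. *)
Record plan := Plan
  { tables : seq nat; group_size : nat; forward : seq nat; trios : certificate;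
    quartets : option (seq nat * certificate); fillings : seq filling }.

Definition filling_ok ms g has_quartets (F : filling) : bool :=
  [&& certifies ms (g + extra F) complete_pattern (full F),
      (extra F <= 1) || certifies ms (g + extra F) (holed_pattern g) (holed F)
    & if doubled F is Some C then
        has_quartets && certifies ms (2 * g + extra F) complete_pattern C
      else true].

Definition plan_ok (p : plan) : bool :=
  let g := group_size p in let S := residue_rel g (forward p) in
  [&& all (fun a => all (fun b => ~~ (S a b && S b a)) (iota 0 g)) (iota 0 g),
      certifies (tables p) (3 * g) (groups_pattern g S (fun _ _ => 0)) (trios p),
      if quartets p is Some (cl, C) then
        all (fun i => i < 3) cl &&
        certifies (tables p) (4 * g) (groups_pattern g S (residue_class g cl)) C
      else true
    & all (filling_ok (tables p) g (isSome (quartets p))) (fillings p)].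

Lemma complete_pattern_sym : symmetric complete_pattern.
Proof. by move=> u v; rewrite /complete_pattern eq_sym. Qed.

Lemma complete_pattern_irr : irreflexive complete_pattern.
Proof. by move=> u; rewrite /complete_pattern eqxx. Qed.

Lemma holed_pattern_sym g : symmetric (holed_pattern g).
Proof. by move=> u v; rewrite /holed_pattern eq_sym andbC [X in ~~ X]andbC andbC. Qed.

Lemma holed_pattern_irr g : irreflexive (holed_pattern g).
Proof. by move=> u; rewrite /holed_pattern eqxx. Qed.

Lemma groups_pattern_sym g S cl : symmetric (groups_pattern g S cl).
Proof.
move=> u v; rewrite /groups_pattern /group_pattern.
case: (u %/ g) => [|[|[|[|i]]]]; case: (v %/ g) => [|[|[|[|j]]]] //.
all: by rewrite andbC.
Qed.

Lemma groups_pattern_irr g S cl : irreflexive (groups_pattern g S cl).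
Proof.
by move=> u; rewrite /groups_pattern /group_pattern; case: (u %/ g) => [|[|[|[|i]]]].
Qed.

(** Below 3g there is no group at infinity. *)
Lemma groups_pattern3 g S cl cl' u v : u < 3 * g -> v < 3 * g ->
  groups_pattern g S cl u v = groups_pattern g S cl' u v.
Proof.
have [->|g_gt0] := posnP g; first by rewrite muln0.
rewrite -!ltn_divLR // /groups_pattern /group_pattern.
by case: (u %/ g) => [|[|[|[|i]]]] //; case: (v %/ g) => [|[|[|[|j]]]].
Qed.

Lemma all_has_witness (T : Type) (a b : pred T) s : all a s -> has b s -> exists2 x, a x & b x.
Proof.
elim: s => //= x s IHs /andP[ax /IHs{}IHs] /orP[bx|/IHs//]; by exists x.
Qed.

(** The plan applies with w extra couples to all q >= 1, or to odd q only. *)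
Definition reaches (even_too : bool) w (p : plan) : bool :=
  has (fun F => (extra F == w) && (even_too ==> isSome (doubled F))) (fillings p).

(** One group is the filling itself and two groups are decomposed directly; from three on,
    the groups are indexed by the integers modulo q, or modulo q - 1 together with
    infinity. *)
Lemma plan_sound p w even_too q :
    plan_ok p -> reaches even_too w p -> 0 < q -> even_too || odd q ->
  decomposable (tables p)
    (fun u v : 'I_(q * group_size p + w) => u != v : nat).
Proof.
case: p => ms g D trio quart fills; rewrite /plan_ok /reaches /=.
set S := residue_rel g D => /and4P[asymS trioS quartS /all_has_witness fillsS].
case/fillsS=> {fillsS} -[w' K H K2] /= /and3P[/= fullS holeS doubleS] /andP[/eqP/= wE evenS] q_gt0 q_par.
rewrite {w'}wE /= in fullS holeS doubleS.
have S_asym a b : a < g -> b < g -> ~~ (S a b && S b a).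
  move=> lta ltb; move/allP: asymS => /(_ a); rewrite mem_iota lta => /(_ isT).
  by move/allP=> /(_ b); rewrite mem_iota ltb => /(_ isT).
have dec_full : decomposable ms (fun u v : 'I_(g + w) => u != v : nat).
  exact: valid_decomposable complete_pattern_sym complete_pattern_irr fullS.
have dec_hole : decomposable ms
    (fun u v : 'I_(g + w) => (u != v) && ~~ ((g <= u) && (g <= v)) : nat).
  case/orP: holeS => [le1|]; last first.
    exact: valid_decomposable (holed_pattern_sym g) (holed_pattern_irr g).
  apply: decomposable_eq dec_full _ => u v; congr nat_of_bool.
  have [//|nuv] := eqVneq u v; symmetry; rewrite /=.
  have := ltn_ord u; have := ltn_ord v; have : (u : nat) != v by [].
  lia.
have dec3 cl : decomposable ms (fun u v : 'I_(3 * g) => groups_pattern g S cl u v : nat).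
  apply: decomposable_eq (valid_decomposable (groups_pattern_sym g S _)
    (groups_pattern_irr g S _) trioS) _ => u v.
  by rewrite (groups_pattern3 S _ cl).
have [q1|q_gt1] := eqVneq q 1.
  by rewrite q1 mul1n.
have [q_odd|q_even] := boolP (odd q).
  have [h qE] : exists h, q = h.*2.+3 by exists (q - 3)./2; lia.
  apply: (@decomposable_fill ms 'I_(h.*2.+3) g w ord0) => //; last by rewrite card_ord qE.
  exact: odd_groups S_asym (dec3 (fun _ _ => 0)).
move: q_par; rewrite (negPf q_even) orbF => evenT; move: evenS; rewrite evenT /=.
case: K2 doubleS => // C2 /andP[quart_some doubleS] _.
have [q2|q_neq2] := eqVneq q 2.
  rewrite q2; exact: valid_decomposable complete_pattern_sym complete_pattern_irr doubleS.
case: quart quartS quart_some => // -[cl C4] /andP[cl3 quartS] _.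
have [h qE] : exists h, q = h.*2.+4 by exists (q - 4)./2; lia.
(* The missing group index, None, is the one at infinity. *)
apply: (@decomposable_fill ms (option 'I_(h.*2.+3)) g w None) => //; last first.
  by rewrite card_option card_ord qE.
apply: (@even_groups h ms g S (residue_class g cl) S_asym (dec3 _)).
  move=> a b _ _; rewrite /residue_class; set i := _ %% _.
  have [lti|gei] := ltnP i (size cl); last by rewrite nth_default.
  exact: (allP cl3) (mem_nth 0 lti).
exact: valid_decomposable (groups_pattern_sym g S _) (groups_pattern_irr g S _) quartS.
Qed.

(** * The certificates, by the number of couples at round tables *)

(** A placeholder for holed decompositions with at most one extra couple. *)
Definition no_certificate := Certificate 0 0 0 [::].

Definition plans_of_2 : seq plan :=
  [:: Plan [:: 2] 2 [::]
    (Certificate 2 6 0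
      [:: [:: 2; 5]; [:: 1; 4]; [:: 0; 4]; [:: 1; 7]])
    (Some ([:: 2; 1],
      (Certificate 2 8 0
        [:: [:: 6; 3]; [:: 5; 15]; [:: 11; 14]; [:: 1; 6]; [:: 5; 1]; [:: 10; 14]; [:: 12; 7];
            [:: 3; 5]])))
    [:: Filling 1
        (Certificate 3 3 0
          [:: [:: 1; 2]; [:: 3; 1]])
        no_certificate
        (Some (Certificate 5 5 0
          [:: [:: 3; 0]; [:: 8; 2]; [:: 5; 0]; [:: 9; 1]]))]].

Definition plans_of_3 : seq plan :=
  [:: Plan [:: 3] 6 [:: 1; 4]
    (Certificate 6 18 12
      [:: [:: 24; 10; 16]; [:: 3; 35; 20]; [:: 16; 4; 30]; [:: 7; 26; 18]])
    (Some ([:: 1; 0; 2; 0; 1; 2],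
      (Certificate 6 24 18
        [:: [:: 23; 30; 10]; [:: 29; 45; 21]; [:: 3; 21; 40]; [:: 16; 4; 30]; [:: 47; 25; 22];
            [:: 39; 9; 28]; [:: 38; 19; 0]; [:: 29; 2; 45]])))
    [:: Filling 1
        (Certificate 7 7 0
          [:: [:: 13; 5; 6]; [:: 11; 0; 13]; [:: 5; 10; 0]; [:: 0; 6; 4]])
        no_certificate
        (Some (Certificate 13 13 13
          [:: [:: 3; 18; 21]; [:: 1; 17; 15]; [:: 7; 13; 0]; [:: 15; 19; 10]]))];
  Plan [:: 3] 3 [:: 1]
    (Certificate 3 9 0
      [:: [:: 4; 13; 10]; [:: 2; 16; 9]; [:: 1; 14; 6]; [:: 0; 6; 14]])
    None
    [:: Filling 0
        (Certificate 1 0 0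
          [:: [:: 3; 4; 0]; [:: 5; 1; 3]; [:: 3; 0; 5]; [:: 0; 2; 5]])
        no_certificate
        None]].

Definition plans_of_4 : seq plan :=
  [:: Plan [:: 2; 2] 4 [:: 3]
    (Certificate 4 12 0
      [:: [:: 4; 18; 21; 14]; [:: 8; 5; 3; 15]; [:: 22; 8; 5; 12]; [:: 8; 0; 19; 4]])
    (Some ([:: 2; 0; 1; 1],
      (Certificate 4 16 0
        [:: [:: 30; 23; 4; 19]; [:: 5; 30; 2; 10]; [:: 8; 22; 7; 11]; [:: 18; 26; 1; 12];
            [:: 28; 9; 25; 11]; [:: 6; 24; 19; 12]; [:: 12; 24; 21; 7]; [:: 12; 27; 3; 10]])))
    [:: Filling 1
        (Certificate 5 5 0
          [:: [:: 3; 5; 1; 8]; [:: 9; 5; 1; 6]])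
        no_certificate
        (Some (Certificate 9 9 0
          [:: [:: 12; 14; 0; 11]; [:: 2; 9; 4; 0]; [:: 16; 6; 14; 2]; [:: 9; 4; 17; 0]]))];
  Plan [:: 4] 4 [::]
    (Certificate 4 12 8
      [:: [:: 10; 2; 9; 6]; [:: 1; 12; 5; 11]])
    (Some ([:: 1; 1; 0; 0],
      (Certificate 4 16 12
        [:: [:: 26; 6; 28; 11]; [:: 13; 5; 8; 3]; [:: 6; 15; 3; 9]; [:: 12; 30; 0; 28]])))
    [:: Filling 1
        (Certificate 5 5 5
          [:: [:: 3; 0; 6; 8]])
        no_certificate
        (Some (Certificate 9 9 9
          [:: [:: 4; 10; 2; 15]; [:: 16; 1; 5; 3]]))]].

Definition plans_of_5 : seq plan :=
  [:: Plan [:: 2; 3] 5 [:: 4]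
    (Certificate 5 15 0
      [:: [:: 0; 15; 6; 16; 25]; [:: 8; 12; 17; 6; 25]; [:: 19; 3; 17; 24; 6];
          [:: 10; 5; 27; 9; 19]])
    (Some ([:: 0; 1; 2; 1; 2],
      (Certificate 5 20 0
        [:: [:: 15; 4; 24; 38; 17]; [:: 16; 1; 35; 5; 18]; [:: 37; 29; 9; 38; 12];
            [:: 10; 4; 16; 24; 6]; [:: 10; 32; 20; 13; 34]; [:: 35; 26; 3; 33; 17];
            [:: 33; 28; 37; 10; 6]; [:: 27; 8; 21; 3; 13]])))
    [:: Filling 1
        (Certificate 3 6 0
          [:: [:: 4; 0; 8; 2; 7]; [:: 1; 9; 7; 3; 4]; [:: 8; 10; 5; 6; 2]; [:: 0; 7; 5; 8; 11]])
        no_certificate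
        (Some (Certificate 11 11 0
          [:: [:: 0; 15; 7; 9; 3]; [:: 15; 8; 1; 21; 17]; [:: 1; 4; 14; 6; 17];
              [:: 10; 0; 21; 8; 7]]));
      Filling 0
        (Certificate 1 0 4
          [:: [:: 5; 8; 1; 6; 3]; [:: 9; 3; 6; 4; 0]; [:: 7; 9; 3; 0; 5]; [:: 9; 1; 4; 7; 3]])
        no_certificate
        None];
  Plan [:: 5] 5 [:: 2]
    (Certificate 5 15 0
      [:: [:: 10; 2; 12; 0; 25]; [:: 9; 22; 18; 7; 16]; [:: 16; 21; 7; 14; 5];
          [:: 18; 22; 8; 10; 0]])
    (Some ([:: 2; 2; 1; 2; 0],
      (Certificate 5 20 15
        [:: [:: 20; 6; 15; 5; 33]; [:: 22; 18; 7; 15; 39]; [:: 13; 26; 39; 14; 2];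
            [:: 31; 21; 6; 34; 25]])))
    [:: Filling 1
        (Certificate 3 6 0
          [:: [:: 1; 2; 7; 8; 4]; [:: 10; 4; 6; 8; 1]; [:: 5; 6; 10; 9; 3]; [:: 2; 6; 1; 5; 10]])
        no_certificate
        (Some (Certificate 11 11 0
          [:: [:: 10; 5; 3; 6; 9]; [:: 5; 1; 11; 2; 12]; [:: 0; 5; 7; 11; 16];
              [:: 18; 4; 15; 1; 7]]));
      Filling 0
        (Certificate 1 0 5
          [:: [:: 0; 9; 7; 5; 2]; [:: 7; 4; 1; 2; 8]; [:: 6; 0; 4; 9; 2]; [:: 1; 9; 5; 3; 6]])
        no_certificate
        None]].

Definition plans_of_6 : seq plan :=
  [:: Plan [:: 2; 2; 2] 6 [:: 1; 4]
    (Certificate 6 18 0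
      [:: [:: 19; 7; 16; 30; 24; 10]; [:: 2; 34; 9; 15; 11; 30]; [:: 14; 9; 18; 7; 33; 13];
          [:: 26; 19; 17; 30; 35; 8]])
    (Some ([:: 2; 2; 2; 2; 0; 0],
      (Certificate 6 24 0
        [:: [:: 2; 21; 31; 43; 45; 26]; [:: 35; 9; 2; 47; 17; 5]; [:: 4; 38; 31; 45; 26; 42];
            [:: 39; 24; 12; 32; 18; 27]; [:: 23; 25; 10; 45; 3; 47]; [:: 26; 6; 25; 22; 2; 29];
            [:: 16; 5; 40; 34; 28; 45]; [:: 33; 44; 27; 6; 23; 5]])))
    [:: Filling 1
        (Certificate 7 7 0
          [:: [:: 4; 9; 11; 1; 13; 6]; [:: 8; 6; 13; 0; 10; 2]])
        no_certificate
        (Some (Certificate 13 13 0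
          [:: [:: 14; 21; 25; 8; 4; 1]; [:: 4; 3; 22; 6; 0; 15]; [:: 4; 22; 10; 16; 1; 3];
              [:: 18; 14; 7; 24; 16; 4]]));
      Filling 3
        (Certificate 3 9 0
          [:: [:: 7; 10; 3; 1; 8; 16]; [:: 7; 16; 5; 2; 1; 10]; [:: 7; 1; 4; 12; 15; 9];
              [:: 15; 16; 6; 5; 1; 12]; [:: 11; 9; 13; 15; 16; 4]; [:: 4; 14; 10; 13; 2; 6];
              [:: 4; 6; 15; 0; 13; 9]; [:: 17; 10; 8; 3; 4; 15]])
        (Certificate 1 0 0
          [:: [:: 13; 0; 7; 11; 9; 17]; [:: 1; 11; 3; 4; 17; 6]; [:: 6; 9; 15; 5; 1; 10];
              [:: 17; 4; 13; 1; 3; 10]; [:: 1; 5; 11; 14; 3; 6]; [:: 10; 14; 7; 1; 4; 8];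
              [:: 9; 13; 0; 15; 6; 2]; [:: 15; 1; 12; 6; 2; 8]; [:: 3; 11; 4; 9; 7; 14];
              [:: 0; 7; 12; 9; 17; 10]; [:: 0; 17; 4; 11; 3; 12]; [:: 11; 17; 14; 6; 13; 3];
              [:: 3; 17; 5; 13; 10; 9]; [:: 4; 6; 9; 16; 2; 15]; [:: 17; 2; 12; 7; 9; 15];
              [:: 1; 17; 4; 2; 10; 7]; [:: 14; 9; 11; 13; 5; 0]; [:: 8; 3; 5; 14; 7; 17];
              [:: 8; 6; 0; 3; 4; 16]; [:: 10; 8; 5; 12; 3; 1]; [:: 8; 0; 5; 11; 2; 14];
              [:: 11; 12; 6; 5; 1; 8]])
        None];
  Plan [:: 2; 4] 6 [:: 1; 4]
    (Certificate 6 18 12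
      [:: [:: 8; 34; 12; 26; 19; 0]; [:: 9; 28; 4; 17; 24; 22]])
    (Some ([:: 0; 0; 2; 2; 1; 1],
      (Certificate 6 24 18
        [:: [:: 22; 44; 20; 34; 3; 40]; [:: 28; 47; 45; 13; 32; 6]; [:: 5; 41; 0; 27; 19; 32];
            [:: 32; 37; 9; 14; 3; 21]])))
    [:: Filling 1
        (Certificate 7 7 0
          [:: [:: 9; 7; 10; 3; 13; 4]; [:: 2; 13; 6; 9; 1; 5]])
        no_certificate
        (Some (Certificate 13 13 0
          [:: [:: 20; 6; 18; 1; 16; 23]; [:: 2; 12; 15; 17; 10; 7]; [:: 11; 8; 24; 15; 0; 22];
              [:: 19; 25; 3; 21; 12; 16]]));
      Filling 3
        (Certificate 3 9 0
          [:: [:: 14; 17; 4; 2; 12; 11]; [:: 11; 5; 17; 6; 14; 1]; [:: 15; 8; 10; 0; 5; 7];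
              [:: 12; 14; 4; 17; 8; 3]; [:: 4; 12; 11; 9; 0; 2]; [:: 9; 13; 16; 7; 2; 10];
              [:: 12; 3; 10; 8; 5; 16]; [:: 12; 0; 3; 16; 8; 7]])
        (Certificate 1 0 6
          [:: [:: 12; 3; 6; 15; 11; 0]; [:: 16; 11; 5; 8; 14; 3]; [:: 17; 8; 3; 10; 4; 0];
              [:: 2; 16; 12; 10; 0; 9]; [:: 7; 13; 4; 8; 15; 1]; [:: 1; 16; 4; 3; 9; 6];
              [:: 12; 4; 1; 15; 7; 3]; [:: 17; 7; 2; 9; 13; 10]; [:: 12; 1; 6; 8; 10; 5];
              [:: 14; 5; 11; 8; 0; 7]; [:: 4; 16; 6; 11; 15; 3]])
        None];
  Plan [:: 3; 3] 6 [:: 1; 4]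
    (Certificate 6 18 12
      [:: [:: 24; 10; 16; 3; 35; 20]; [:: 16; 4; 30; 7; 26; 18]])
    (Some ([:: 1; 0; 2; 0; 1; 2],
      (Certificate 6 24 18
        [:: [:: 23; 30; 10; 29; 45; 21]; [:: 3; 21; 40; 16; 4; 30]; [:: 47; 25; 22; 39; 9; 28];
            [:: 38; 19; 0; 29; 2; 45]])))
    [:: Filling 1
        (Certificate 1 0 6
          [:: [:: 3; 4; 9; 1; 13; 10]; [:: 5; 3; 11; 9; 6; 13]; [:: 8; 4; 1; 6; 10; 3];
              [:: 4; 0; 6; 2; 9; 13]; [:: 11; 1; 9; 7; 12; 4]; [:: 5; 12; 10; 6; 2; 1];
              [:: 11; 8; 6; 13; 0; 2]])
        no_certificate
        (Some (Certificate 13 13 13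
          [:: [:: 3; 18; 21; 1; 17; 15]; [:: 7; 13; 0; 15; 19; 10]]));
      Filling 3
        (Certificate 3 9 9
          [:: [:: 10; 3; 0; 16; 6; 15]; [:: 17; 13; 3; 5; 14; 8]; [:: 3; 5; 16; 12; 10; 9];
              [:: 5; 17; 10; 6; 8; 0]])
        (Certificate 1 0 6
          [:: [:: 3; 7; 15; 17; 11; 5]; [:: 15; 5; 9; 12; 10; 7]; [:: 9; 1; 11; 3; 5; 6];
              [:: 13; 11; 7; 0; 2; 16]; [:: 8; 2; 17; 15; 6; 1]; [:: 3; 0; 11; 9; 6; 4];
              [:: 1; 4; 15; 13; 8; 3]; [:: 0; 13; 4; 15; 10; 3]; [:: 11; 17; 4; 9; 13; 0];
              [:: 11; 15; 8; 7; 17; 1]; [:: 16; 8; 6; 4; 13; 3]])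
        None];
  Plan [:: 6] 6 [:: 1; 4]
    (Certificate 6 18 18
      [:: [:: 12; 0; 33; 18; 27; 7]; [:: 17; 4; 31; 23; 25; 11]])
    (Some ([:: 0; 2; 0; 2; 1; 0],
      (Certificate 6 24 18
        [:: [:: 42; 22; 30; 4; 38; 3]; [:: 26; 1; 33; 46; 6; 12]; [:: 47; 10; 17; 5; 39; 32];
            [:: 14; 29; 8; 21; 40; 35]])))
    [:: Filling 1
        (Certificate 7 7 0
          [:: [:: 6; 0; 3; 5; 13; 11]; [:: 12; 7; 4; 1; 11; 2]])
        no_certificate
        (Some (Certificate 13 13 13
          [:: [:: 13; 2; 1; 23; 8; 5]; [:: 0; 2; 14; 4; 25; 19]]));
      Filling 3
        (Certificate 3 9 9
          [:: [:: 9; 1; 15; 6; 10; 12]; [:: 7; 10; 16; 15; 2; 1]; [:: 1; 5; 12; 3; 7; 17];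
              [:: 17; 10; 1; 8; 3; 15]])
        (Certificate 1 0 6
          [:: [:: 5; 17; 9; 7; 15; 0]; [:: 17; 1; 8; 10; 4; 2]; [:: 7; 16; 11; 15; 8; 12];
              [:: 6; 2; 16; 0; 13; 5]; [:: 9; 6; 0; 11; 3; 4]; [:: 2; 1; 6; 17; 11; 12];
              [:: 7; 10; 3; 1; 9; 5]; [:: 8; 13; 0; 10; 5; 14]; [:: 16; 9; 3; 14; 0; 4];
              [:: 12; 4; 15; 10; 6; 3]; [:: 13; 7; 14; 3; 8; 11]])
        None]].

Definition plans_of_7 : seq plan :=
  [:: Plan [:: 2; 2; 3] 7 [:: 3; 6]
    (Certificate 7 21 0
      [:: [:: 27; 3; 24; 7; 9; 22; 35]; [:: 23; 12; 17; 36; 1; 41; 14];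
          [:: 40; 7; 11; 36; 1; 15; 35]; [:: 23; 35; 0; 18; 41; 21; 7]])
    (Some ([:: 0; 1; 2; 2; 2; 1; 0],
      (Certificate 7 28 0
        [:: [:: 34; 9; 1; 24; 40; 45; 14]; [:: 27; 9; 24; 37; 29; 46; 17];
            [:: 28; 49; 27; 8; 10; 20; 50]; [:: 47; 41; 10; 25; 44; 36; 3];
            [:: 19; 42; 51; 33; 17; 3; 37]; [:: 42; 35; 7; 33; 5; 19; 39];
            [:: 22; 29; 16; 54; 40; 48; 7]; [:: 46; 7; 42; 0; 45; 5; 15]])))
    [:: Filling 1
        (Certificate 1 0 0
          [:: [:: 1; 10; 6; 14; 5; 13; 8]; [:: 5; 3; 14; 11; 6; 1; 13];
              [:: 3; 9; 5; 11; 7; 0; 12]; [:: 15; 1; 4; 7; 13; 10; 3];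
              [:: 7; 14; 0; 5; 2; 10; 9]; [:: 6; 8; 11; 1; 12; 5; 14];
              [:: 10; 12; 2; 15; 8; 7; 5]; [:: 8; 14; 0; 4; 6; 2; 12];
              [:: 5; 15; 0; 8; 11; 2; 6]; [:: 3; 0; 15; 11; 12; 9; 6];
              [:: 6; 10; 13; 14; 4; 8; 3]; [:: 2; 0; 8; 10; 4; 15; 13];
              [:: 1; 8; 2; 14; 13; 5; 10]; [:: 12; 8; 15; 0; 6; 3; 11];
              [:: 3; 12; 6; 0; 10; 5; 9]; [:: 9; 14; 0; 13; 4; 3; 6]])
        no_certificate
        (Some (Certificate 15 15 0
          [:: [:: 2; 4; 6; 19; 29; 0; 11]; [:: 0; 7; 4; 26; 14; 17; 20];
              [:: 18; 27; 6; 16; 8; 5; 20]; [:: 27; 23; 10; 24; 21; 0; 6]]));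
      Filling 0
        (Certificate 3 6 0
          [:: [:: 9; 11; 0; 4; 13; 2; 7]; [:: 7; 8; 1; 2; 10; 5; 13]; [:: 2; 11; 7; 1; 12; 9; 4];
              [:: 5; 9; 10; 2; 13; 7; 0]])
        no_certificate
        None];
  Plan [:: 2; 5] 7 [:: 1; 5]
    (Certificate 7 21 14
      [:: [:: 19; 34; 22; 1; 38; 15; 8]; [:: 40; 10; 6; 14; 1; 21; 30]])
    (Some ([:: 0; 2; 1; 2; 0; 1; 2],
      (Certificate 7 28 21
        [:: [:: 49; 36; 19; 13; 26; 4; 34]; [:: 6; 48; 41; 43; 18; 11; 25];
            [:: 47; 40; 35; 50; 19; 29; 4]; [:: 53; 2; 33; 22; 47; 14; 9]])))
    [:: Filling 1
        (Certificate 1 0 0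
          [:: [:: 2; 10; 5; 1; 14; 8; 7]; [:: 1; 6; 5; 9; 2; 13; 11]; [:: 8; 11; 15; 3; 6; 0; 5];
              [:: 8; 15; 10; 4; 2; 12; 7]; [:: 13; 15; 0; 11; 2; 9; 5];
              [:: 9; 1; 12; 15; 6; 11; 4]; [:: 3; 4; 6; 15; 9; 13; 0];
              [:: 0; 10; 13; 4; 14; 2; 7]; [:: 12; 11; 4; 0; 9; 7; 15];
              [:: 9; 3; 1; 10; 14; 5; 13]; [:: 1; 15; 8; 12; 5; 3; 7];
              [:: 7; 4; 13; 2; 11; 14; 1]; [:: 3; 14; 7; 11; 9; 0; 13];
              [:: 3; 1; 7; 12; 9; 11; 15]; [:: 9; 4; 10; 15; 12; 2; 6];
              [:: 1; 2; 13; 8; 6; 4; 11]])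
        no_certificate
        (Some (Certificate 15 15 0
          [:: [:: 15; 22; 2; 0; 24; 11; 21]; [:: 10; 5; 27; 23; 2; 1; 16];
              [:: 5; 17; 28; 25; 22; 18; 20]; [:: 10; 26; 29; 24; 7; 15; 5]]));
      Filling 0
        (Certificate 3 6 0
          [:: [:: 0; 6; 2; 11; 12; 9; 4]; [:: 6; 8; 5; 2; 10; 0; 12]; [:: 8; 11; 7; 3; 12; 4; 0];
              [:: 13; 11; 8; 0; 5; 6; 3]])
        no_certificate
        None];
  Plan [:: 3; 4] 7 [:: 2; 6]
    (Certificate 7 21 0
      [:: [:: 8; 17; 35; 28; 2; 24; 11]; [:: 28; 25; 2; 13; 26; 4; 18];
          [:: 14; 40; 9; 29; 24; 10; 16]; [:: 26; 6; 38; 25; 36; 11; 29]])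
    (Some ([:: 0; 0; 2; 0; 1; 2; 1],
      (Certificate 7 28 28
        [:: [:: 42; 13; 39; 9; 50; 41; 15]; [:: 52; 34; 17; 26; 5; 30; 13];
            [:: 21; 39; 7; 25; 47; 3; 51]; [:: 20; 12; 47; 17; 10; 52; 28]])))
    [:: Filling 1
        (Certificate 1 0 8
          [:: [:: 3; 9; 15; 7; 4; 12; 1]; [:: 13; 7; 10; 15; 5; 0; 8];
              [:: 0; 9; 7; 13; 11; 2; 4]; [:: 7; 14; 11; 13; 2; 5; 9];
              [:: 14; 3; 6; 1; 13; 8; 11]; [:: 1; 10; 2; 6; 4; 15; 13];
              [:: 8; 10; 5; 12; 2; 0; 15]; [:: 2; 9; 6; 0; 4; 10; 14]])
        no_certificate
        (Some (Certificate 15 15 0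
          [:: [:: 10; 16; 6; 3; 20; 18; 28]; [:: 18; 14; 27; 7; 25; 10; 9];
              [:: 26; 10; 2; 7; 12; 23; 20]; [:: 20; 6; 1; 18; 27; 22; 10]]));
      Filling 0
        (Certificate 3 6 6
          [:: [:: 12; 7; 2; 11; 8; 1; 4]; [:: 4; 6; 12; 1; 3; 9; 11]])
        no_certificate
        None];
  Plan [:: 7] 7 [:: 5]
    (Certificate 7 21 14
      [:: [:: 10; 16; 2; 24; 9; 33; 23]; [:: 11; 23; 8; 24; 3; 40; 16]])
    (Some ([:: 2; 1; 2; 0; 0; 1; 0],
      (Certificate 7 28 28
        [:: [:: 54; 16; 8; 44; 30; 21; 7]; [:: 46; 23; 52; 12; 36; 26; 11];
            [:: 24; 5; 28; 46; 12; 14; 3]; [:: 50; 20; 7; 27; 1; 54; 37]])))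
    [:: Filling 1
        (Certificate 1 0 8
          [:: [:: 14; 5; 11; 9; 2; 6; 12]; [:: 0; 7; 8; 4; 3; 12; 10];
              [:: 0; 12; 15; 7; 9; 4; 2]; [:: 9; 0; 6; 11; 14; 3; 13];
              [:: 1; 12; 11; 3; 9; 14; 4]; [:: 8; 0; 11; 15; 6; 4; 13];
              [:: 15; 3; 10; 6; 13; 5; 1]; [:: 4; 11; 8; 14; 1; 2; 7]])
        no_certificate
        (Some (Certificate 15 15 0
          [:: [:: 28; 20; 14; 19; 4; 13; 25]; [:: 21; 12; 8; 15; 2; 10; 1];
              [:: 8; 27; 16; 14; 18; 2; 22]; [:: 18; 20; 5; 29; 17; 14; 13]]));
      Filling 0
        (Certificate 3 6 0
          [:: [:: 6; 1; 2; 13; 10; 8; 5]; [:: 2; 4; 8; 1; 10; 6; 12]; [:: 11; 8; 13; 3; 7; 0; 5];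
              [:: 2; 0; 8; 11; 5; 7; 13]])
        no_certificate
        None]].

Definition plans_of_8 : seq plan :=
  [:: Plan [:: 2; 2; 2; 2] 8 [:: 2; 5; 7]
    (Certificate 8 24 0
      [:: [:: 9; 16; 21; 40; 43; 1; 24; 44]; [:: 1; 16; 4; 34; 42; 29; 20; 12];
          [:: 33; 6; 29; 13; 16; 46; 44; 15]; [:: 6; 42; 25; 35; 5; 40; 47; 20]])
    (Some ([:: 0; 0; 2; 1; 2; 0; 1; 2],
      (Certificate 8 32 0
        [:: [:: 38; 58; 48; 40; 3; 53; 10; 37]; [:: 52; 25; 37; 0; 47; 20; 28; 32];
            [:: 30; 40; 50; 29; 17; 61; 38; 9]; [:: 24; 62; 26; 40; 19; 3; 44; 49];
            [:: 40; 21; 1; 59; 13; 39; 43; 57]; [:: 15; 62; 28; 13; 25; 0; 9; 39];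
            [:: 14; 49; 3; 60; 17; 9; 25; 38]; [:: 2; 38; 61; 46; 8; 56; 34; 59]])))
    [:: Filling 1
        (Certificate 9 9 0
          [:: [:: 10; 4; 16; 7; 13; 3; 14; 9]; [:: 9; 7; 1; 14; 4; 3; 16; 12]])
        no_certificate
        (Some (Certificate 17 17 0
          [:: [:: 6; 30; 9; 29; 16; 32; 11; 14]; [:: 31; 2; 17; 11; 18; 9; 24; 28];
              [:: 32; 21; 30; 13; 24; 17; 14; 22]; [:: 14; 2; 23; 8; 27; 28; 32; 0]]))];
  Plan [:: 2; 2; 4] 8 [:: 1; 5; 6]
    (Certificate 8 24 16
      [:: [:: 22; 41; 18; 44; 46; 13; 39; 5]; [:: 34; 22; 11; 39; 0; 16; 9; 24]])
    (Some ([:: 2; 1; 0; 0; 1; 2; 1; 2],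
      (Certificate 8 32 24
        [:: [:: 41; 50; 39; 54; 22; 14; 31; 6]; [:: 57; 22; 29; 53; 47; 19; 36; 2];
            [:: 54; 41; 31; 58; 44; 3; 47; 18]; [:: 63; 9; 6; 59; 36; 18; 45; 3]])))
    [:: Filling 1
        (Certificate 9 9 0
          [:: [:: 12; 2; 0; 11; 17; 5; 8; 14]; [:: 7; 9; 0; 14; 17; 10; 5; 2]])
        no_certificate
        (Some (Certificate 17 17 0
          [:: [:: 1; 25; 18; 7; 13; 26; 11; 20]; [:: 6; 1; 3; 33; 20; 25; 16; 19];
              [:: 5; 11; 30; 8; 24; 32; 23; 7]; [:: 16; 30; 9; 7; 0; 15; 23; 5]]))];
  Plan [:: 2; 3; 3] 8 [:: 1; 2; 5]
    (Certificate 8 24 16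
      [:: [:: 1; 36; 19; 10; 44; 4; 46; 28]; [:: 47; 26; 39; 28; 12; 18; 3; 37]])
    (Some ([:: 2; 2; 2; 1; 0; 0; 0; 1],
      (Certificate 8 32 24
        [:: [:: 37; 53; 21; 40; 58; 35; 15; 54]; [:: 48; 5; 23; 14; 40; 56; 0; 37];
            [:: 8; 51; 33; 14; 31; 47; 27; 48]; [:: 30; 60; 0; 24; 34; 47; 4; 20]])))
    [:: Filling 1
        (Certificate 9 9 0
          [:: [:: 4; 0; 10; 3; 13; 14; 17; 7]; [:: 16; 10; 12; 9; 14; 0; 7; 5]])
        no_certificate
        (Some (Certificate 17 17 0
          [:: [:: 17; 9; 30; 33; 18; 5; 21; 26]; [:: 6; 3; 31; 15; 19; 11; 22; 13];
              [:: 16; 2; 19; 20; 26; 8; 6; 25]; [:: 12; 22; 7; 32; 26; 9; 5; 14]]))];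
  Plan [:: 2; 6] 8 [:: 1; 6]
    (Certificate 8 24 16
      [:: [:: 33; 5; 17; 44; 27; 1; 22; 6]; [:: 3; 36; 4; 28; 41; 22; 15; 21]])
    (Some ([:: 1; 1; 2; 1; 0; 2; 2; 1],
      (Certificate 8 32 24
        [:: [:: 53; 31; 26; 57; 23; 35; 0; 45]; [:: 55; 42; 28; 5; 21; 14; 31; 60];
            [:: 57; 36; 48; 31; 33; 20; 10; 38]; [:: 15; 55; 5; 30; 8; 16; 48; 39]])))
    [:: Filling 1
        (Certificate 9 9 0
          [:: [:: 10; 6; 17; 1; 8; 5; 13; 14]; [:: 0; 13; 10; 4; 15; 9; 7; 2]])
        no_certificate
        (Some (Certificate 17 17 0
          [:: [:: 29; 4; 13; 30; 26; 1; 21; 24]; [:: 0; 26; 6; 22; 32; 20; 17; 15];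
              [:: 20; 15; 6; 26; 24; 30; 11; 22]; [:: 30; 33; 11; 24; 14; 8; 27; 23]]))];
  Plan [:: 3; 5] 8 [:: 1; 5; 6]
    (Certificate 8 24 0
      [:: [:: 2; 45; 19; 43; 30; 33; 22; 15]; [:: 26; 44; 10; 33; 7; 23; 41; 14];
          [:: 43; 8; 16; 20; 32; 5; 47; 13]; [:: 35; 6; 23; 42; 16; 45; 1; 25]])
    (Some ([:: 2; 0; 2; 1; 2; 0; 0; 1],
      (Certificate 8 32 24
        [:: [:: 10; 45; 60; 0; 42; 16; 9; 51]; [:: 47; 29; 13; 59; 21; 50; 42; 14];
            [:: 6; 30; 33; 59; 39; 62; 46; 21]; [:: 33; 4; 21; 55; 12; 56; 37; 24]])))
    [:: Filling 1
        (Certificate 9 9 9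
          [:: [:: 13; 0; 14; 16; 3; 11; 5; 7]])
        no_certificate
        (Some (Certificate 17 17 17
          [:: [:: 27; 7; 11; 8; 20; 17; 24; 18]; [:: 2; 23; 21; 0; 33; 8; 16; 29]]))];
  Plan [:: 4; 4] 8 [:: 5; 7]
    (Certificate 8 24 16
      [:: [:: 21; 34; 24; 8; 11; 30; 6; 18]; [:: 35; 9; 24; 4; 45; 18; 33; 2]])
    (Some ([:: 1; 0; 2; 0; 1; 1; 2; 2],
      (Certificate 8 32 24
        [:: [:: 1; 43; 13; 51; 27; 15; 40; 11]; [:: 60; 47; 50; 18; 25; 34; 21; 12];
            [:: 35; 21; 4; 25; 56; 7; 27; 3]; [:: 25; 48; 36; 50; 60; 21; 52; 33]])))
    [:: Filling 1
        (Certificate 9 9 9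
          [:: [:: 14; 5; 16; 0; 13; 8; 2; 10]])
        no_certificate
        (Some (Certificate 17 17 17
          [:: [:: 27; 16; 1; 3; 9; 23; 31; 13]; [:: 0; 13; 4; 33; 11; 17; 29; 24]]))];
  Plan [:: 8] 8 [:: 5; 6; 7]
    (Certificate 8 24 24
      [:: [:: 14; 43; 17; 46; 2; 32; 6; 22]; [:: 18; 11; 40; 28; 42; 1; 16; 45]])
    (Some ([:: 1; 1; 1; 2; 2; 2; 0; 0],
      (Certificate 8 32 32
        [:: [:: 47; 19; 51; 4; 34; 58; 24; 57]; [:: 22; 15; 41; 27; 11; 54; 19; 32];
            [:: 8; 39; 28; 13; 21; 57; 32; 54]; [:: 59; 15; 42; 49; 38; 10; 37; 24]])))
    [:: Filling 1
        (Certificate 9 9 9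
          [:: [:: 13; 17; 9; 15; 10; 3; 5; 6]])
        no_certificate
        (Some (Certificate 17 17 17
          [:: [:: 20; 25; 2; 32; 0; 10; 19; 28]; [:: 32; 12; 15; 3; 22; 28; 1; 17]]))]].

Definition plans_of_9 : seq plan :=
  [:: Plan [:: 2; 2; 2; 3] 9 [:: 1; 4; 7]
    (Certificate 9 27 0
      [:: [:: 27; 53; 16; 36; 4; 23; 33; 47; 8]; [:: 49; 22; 5; 37; 1; 30; 33; 8; 47];
          [:: 43; 23; 32; 14; 19; 50; 13; 25; 44]; [:: 50; 6; 9; 52; 19; 13; 22; 43; 10]])
    (Some ([:: 0; 0; 2; 1; 0; 1; 2; 1; 2],
      (Certificate 9 36 0
        [:: [:: 70; 21; 42; 64; 38; 0; 63; 6; 51]; [:: 32; 57; 31; 45; 41; 62; 48; 60; 4];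
            [:: 16; 49; 46; 21; 59; 31; 60; 18; 44]; [:: 35; 5; 45; 6; 57; 12; 16; 55; 23];
            [:: 7; 18; 36; 4; 50; 63; 65; 23; 49]; [:: 32; 15; 23; 42; 17; 61; 2; 27; 47];
            [:: 20; 2; 7; 60; 68; 53; 64; 32; 8]; [:: 47; 32; 67; 20; 0; 54; 7; 51; 31]])))
    [:: Filling 1
        (Certificate 5 10 0
          [:: [:: 8; 15; 7; 10; 1; 17; 12; 4; 3]; [:: 4; 18; 12; 0; 11; 15; 17; 9; 6];
              [:: 3; 1; 6; 16; 8; 5; 11; 19; 12]; [:: 9; 5; 19; 6; 11; 2; 16; 13; 15]])
        no_certificate
        (Some (Certificate 19 19 0
          [:: [:: 28; 36; 31; 34; 24; 5; 12; 0; 16]; [:: 25; 10; 21; 3; 5; 12; 1; 16; 15];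
              [:: 22; 12; 28; 19; 5; 30; 21; 9; 25]; [:: 37; 5; 31; 33; 21; 14; 8; 25; 22]]));
      Filling 0
        (Certificate 1 0 0
          [:: [:: 14; 17; 3; 13; 0; 8; 7; 4; 11]; [:: 17; 8; 1; 11; 5; 15; 7; 3; 12];
              [:: 5; 13; 10; 14; 2; 0; 8; 7; 16]; [:: 0; 4; 12; 10; 8; 2; 16; 7; 14];
              [:: 2; 1; 4; 17; 7; 10; 8; 12; 15]; [:: 11; 9; 14; 6; 3; 16; 5; 12; 0];
              [:: 9; 5; 14; 1; 17; 10; 12; 3; 7]; [:: 6; 16; 15; 3; 11; 5; 9; 13; 0];
              [:: 7; 2; 4; 15; 10; 13; 16; 1; 8]; [:: 8; 11; 1; 6; 3; 5; 17; 13; 15];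
              [:: 15; 9; 4; 6; 2; 10; 16; 12; 1]; [:: 9; 2; 0; 14; 16; 13; 7; 11; 4];
              [:: 15; 10; 7; 9; 2; 16; 1; 4; 13]; [:: 0; 16; 3; 10; 9; 4; 14; 7; 13];
              [:: 15; 2; 4; 16; 11; 0; 9; 6; 12]; [:: 4; 3; 7; 1; 11; 17; 8; 15; 13]])
        no_certificate
        None];
  Plan [:: 2; 2; 5] 9 [:: 1; 4; 7]
    (Certificate 9 27 0
      [:: [:: 8; 41; 37; 17; 48; 29; 10; 22; 4]; [:: 52; 32; 0; 24; 29; 48; 34; 17; 43];
          [:: 15; 52; 5; 34; 50; 7; 39; 12; 19]; [:: 25; 51; 30; 39; 26; 14; 46; 33; 8]])
    (Some ([:: 1; 0; 0; 1; 2; 2; 2; 1; 0],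
      (Certificate 9 36 0
        [:: [:: 38; 6; 10; 67; 21; 9; 65; 32; 57]; [:: 47; 14; 19; 6; 43; 23; 48; 10; 68];
            [:: 65; 12; 37; 29; 46; 54; 15; 41; 3]; [:: 60; 49; 21; 52; 54; 46; 57; 16; 42];
            [:: 13; 31; 0; 25; 66; 35; 36; 29; 10]; [:: 61; 19; 59; 7; 23; 43; 71; 28; 11];
            [:: 31; 66; 52; 15; 36; 22; 43; 29; 65]; [:: 68; 18; 1; 25; 53; 60; 48; 5; 63]])))
    [:: Filling 1
        (Certificate 5 10 0
          [:: [:: 10; 13; 5; 16; 2; 14; 7; 19; 8]; [:: 4; 11; 7; 2; 17; 9; 19; 14; 12];
              [:: 6; 8; 17; 1; 4; 18; 10; 2; 13]; [:: 7; 10; 18; 12; 8; 1; 15; 5; 2]])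
        no_certificate
        (Some (Certificate 19 19 0
          [:: [:: 15; 11; 0; 2; 21; 36; 16; 26; 29]; [:: 4; 31; 23; 14; 8; 3; 26; 18; 24];
              [:: 31; 34; 23; 2; 37; 0; 11; 4; 20]; [:: 24; 0; 34; 22; 37; 26; 3; 9; 19]]));
      Filling 0
        (Certificate 1 0 0
          [:: [:: 0; 6; 3; 12; 11; 14; 16; 9; 4]; [:: 0; 13; 6; 3; 11; 15; 4; 17; 8];
              [:: 1; 5; 3; 14; 12; 17; 9; 11; 7]; [:: 16; 10; 1; 13; 3; 7; 5; 9; 15];
              [:: 0; 10; 12; 4; 7; 15; 17; 2; 9]; [:: 4; 10; 13; 9; 15; 7; 16; 3; 0];
              [:: 2; 0; 14; 4; 10; 17; 12; 7; 9]; [:: 17; 14; 11; 6; 2; 12; 9; 0; 5];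
              [:: 8; 2; 13; 15; 16; 1; 4; 7; 11]; [:: 8; 0; 12; 16; 14; 5; 7; 3; 10];
              [:: 13; 14; 0; 7; 2; 16; 4; 8; 10]; [:: 0; 11; 13; 7; 15; 9; 17; 4; 3];
              [:: 0; 14; 7; 17; 12; 2; 11; 4; 9]; [:: 6; 15; 12; 11; 9; 2; 4; 16; 0];
              [:: 4; 13; 6; 9; 0; 16; 2; 10; 15]; [:: 8; 15; 10; 12; 1; 16; 7; 4; 2]])
        no_certificate
        None];
  Plan [:: 2; 3; 4] 9 [:: 1; 4; 7]
    (Certificate 9 27 18
      [:: [:: 51; 18; 39; 1; 31; 32; 15; 21; 41]; [:: 49; 17; 37; 35; 10; 15; 53; 8; 26]])
    (Some ([:: 0; 2; 1; 2; 0; 2; 2; 2; 1],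
      (Certificate 9 36 27
        [:: [:: 54; 44; 53; 32; 67; 3; 41; 21; 46]; [:: 56; 50; 24; 58; 38; 45; 30; 6; 19];
            [:: 59; 19; 6; 69; 39; 10; 22; 4; 29]; [:: 61; 6; 64; 53; 3; 59; 38; 1; 45]])))
    [:: Filling 1
        (Certificate 5 10 0
          [:: [:: 14; 19; 17; 5; 1; 12; 10; 8; 3]; [:: 15; 0; 5; 9; 16; 19; 2; 12; 11];
              [:: 17; 11; 9; 7; 0; 13; 14; 4; 2]; [:: 16; 8; 5; 6; 10; 1; 15; 2; 18]])
        no_certificate
        (Some (Certificate 19 19 0
          [:: [:: 15; 12; 19; 27; 0; 35; 9; 28; 4]; [:: 14; 32; 28; 2; 26; 35; 24; 22; 6];
              [:: 37; 2; 15; 20; 26; 35; 18; 28; 13]; [:: 10; 6; 37; 29; 4; 32; 9; 19; 25]]));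
      Filling 0
        (Certificate 1 0 8
          [:: [:: 16; 15; 6; 9; 10; 0; 4; 2; 13]; [:: 11; 16; 1; 9; 13; 7; 2; 14; 4];
              [:: 17; 3; 12; 11; 4; 0; 7; 9; 15]; [:: 13; 17; 0; 14; 9; 2; 10; 7; 5];
              [:: 16; 8; 1; 11; 2; 15; 4; 13; 7]; [:: 0; 16; 10; 8; 4; 14; 12; 7; 3];
              [:: 5; 17; 3; 8; 13; 11; 0; 6; 15]; [:: 6; 16; 13; 11; 14; 3; 1; 4; 9]])
        no_certificate
        None];
  Plan [:: 2; 7] 9 [:: 1; 4; 7]
    (Certificate 9 27 18
      [:: [:: 40; 8; 44; 19; 0; 39; 30; 6; 24]; [:: 40; 14; 50; 19; 7; 30; 44; 25; 12]])
    (Some ([:: 2; 2; 0; 0; 1; 1; 1; 0; 2],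
      (Certificate 9 36 27
        [:: [:: 2; 61; 54; 36; 5; 34; 65; 48; 28]; [:: 51; 70; 5; 29; 37; 16; 48; 34; 43];
            [:: 16; 58; 20; 3; 47; 63; 33; 8; 53]; [:: 57; 6; 54; 28; 49; 66; 20; 8; 26]])))
    [:: Filling 1
        (Certificate 5 10 0
          [:: [:: 1; 7; 12; 16; 11; 8; 18; 5; 3]; [:: 10; 18; 7; 9; 17; 1; 13; 4; 15];
              [:: 2; 7; 9; 13; 18; 1; 14; 4; 11]; [:: 1; 2; 16; 5; 10; 19; 13; 9; 15]])
        no_certificate
        (Some (Certificate 19 19 0
          [:: [:: 34; 32; 10; 22; 27; 1; 31; 9; 37]; [:: 15; 19; 22; 16; 2; 25; 4; 10; 29];
              [:: 22; 33; 2; 35; 15; 28; 31; 13; 37]; [:: 15; 22; 24; 37; 34; 11; 26; 16; 32]]));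
      Filling 0
        (Certificate 1 0 0
          [:: [:: 16; 5; 0; 7; 14; 12; 2; 9; 11]; [:: 7; 15; 0; 17; 11; 8; 13; 2; 4];
              [:: 4; 13; 2; 10; 0; 6; 9; 14; 16]; [:: 1; 3; 15; 17; 8; 4; 10; 6; 12];
              [:: 13; 17; 7; 2; 8; 10; 4; 1; 14]; [:: 1; 9; 10; 17; 3; 15; 5; 7; 13];
              [:: 5; 14; 11; 17; 7; 3; 9; 0; 12]; [:: 9; 15; 0; 3; 5; 13; 6; 11; 16];
              [:: 12; 17; 1; 4; 9; 6; 10; 3; 14]; [:: 11; 4; 12; 14; 9; 17; 1; 6; 2];
              [:: 7; 9; 1; 15; 16; 4; 12; 3; 10]; [:: 11; 13; 5; 15; 1; 7; 17; 9; 2];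
              [:: 13; 9; 0; 4; 6; 3; 11; 14; 17]; [:: 12; 1; 16; 9; 4; 7; 10; 15; 3];
              [:: 10; 14; 4; 16; 3; 0; 9; 12; 7]; [:: 7; 16; 10; 9; 5; 2; 15; 12; 0]])
        no_certificate
        None];
  Plan [:: 3; 3; 3] 9 [:: 1; 4; 7]
    (Certificate 9 27 18
      [:: [:: 41; 20; 3; 26; 47; 14; 38; 31; 13]; [:: 14; 47; 21; 19; 6; 51; 39; 0; 24]])
    (Some ([:: 1; 2; 0; 2; 1; 1; 0; 0; 2],
      (Certificate 9 36 27
        [:: [:: 11; 22; 68; 31; 51; 57; 62; 12; 39]; [:: 45; 13; 61; 23; 11; 58; 26; 41; 2];
            [:: 14; 33; 47; 36; 10; 28; 43; 34; 63]; [:: 63; 5; 43; 29; 48; 65; 31; 6; 56]])))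
    [:: Filling 1
        (Certificate 5 10 0
          [:: [:: 9; 14; 13; 11; 1; 5; 16; 6; 3]; [:: 9; 13; 16; 1; 19; 3; 11; 15; 4];
              [:: 3; 8; 1; 14; 12; 17; 11; 19; 6]; [:: 19; 0; 13; 11; 3; 9; 7; 4; 16]])
        no_certificate
        (Some (Certificate 19 19 0
          [:: [:: 28; 24; 15; 18; 33; 36; 31; 13; 34]; [:: 25; 13; 29; 32; 18; 7; 2; 16; 23];
              [:: 3; 8; 24; 19; 13; 10; 29; 27; 1]; [:: 32; 2; 0; 22; 21; 30; 14; 35; 7]]));
      Filling 0
        (Certificate 1 0 9
          [:: [:: 4; 6; 10; 0; 9; 12; 17; 14; 3]; [:: 11; 0; 8; 7; 4; 2; 12; 17; 15];
              [:: 6; 1; 12; 5; 8; 15; 2; 11; 17]; [:: 6; 2; 13; 11; 9; 16; 5; 14; 0];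
              [:: 11; 3; 1; 9; 7; 15; 17; 13; 5]; [:: 17; 6; 9; 1; 14; 2; 12; 10; 5];
              [:: 4; 3; 8; 0; 16; 6; 15; 13; 10]; [:: 3; 13; 9; 0; 17; 4; 11; 6; 15]])
        no_certificate
        None];
  Plan [:: 3; 6] 9 [:: 1; 4; 7]
    (Certificate 9 27 18
      [:: [:: 21; 2; 46; 4; 35; 48; 11; 42; 28]; [:: 5; 28; 36; 21; 3; 33; 53; 15; 41]])
    (Some ([:: 0; 0; 2; 2; 2; 0; 1; 1; 1],
      (Certificate 9 36 27
        [:: [:: 49; 55; 16; 42; 29; 63; 39; 65; 35]; [:: 23; 43; 17; 7; 70; 49; 10; 28; 61];
            [:: 40; 15; 26; 16; 35; 36; 58; 5; 28]; [:: 37; 17; 63; 44; 12; 69; 34; 66; 18]])))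
    [:: Filling 1
        (Certificate 5 10 0
          [:: [:: 8; 13; 10; 14; 17; 3; 0; 19; 7]; [:: 0; 13; 5; 14; 10; 18; 8; 7; 3];
              [:: 17; 2; 0; 13; 6; 8; 19; 15; 5]; [:: 7; 11; 0; 9; 3; 19; 12; 17; 15]])
        no_certificate
        (Some (Certificate 19 19 0
          [:: [:: 14; 28; 13; 4; 2; 32; 34; 17; 0]; [:: 34; 24; 1; 9; 36; 30; 3; 29; 20];
              [:: 29; 13; 17; 9; 22; 32; 0; 20; 4]; [:: 23; 16; 9; 31; 4; 7; 27; 19; 36]]));
      Filling 0
        (Certificate 1 0 9
          [:: [:: 15; 17; 8; 11; 12; 2; 0; 5; 6]; [:: 9; 0; 7; 3; 5; 10; 12; 14; 17];
              [:: 4; 12; 8; 17; 10; 1; 14; 3; 7]; [:: 16; 10; 8; 15; 5; 12; 1; 2; 7];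
              [:: 5; 14; 8; 2; 13; 16; 7; 1; 11]; [:: 17; 4; 0; 8; 2; 10; 15; 6; 13];
              [:: 17; 2; 5; 14; 0; 12; 6; 9; 10]; [:: 5; 7; 11; 17; 1; 9; 2; 14; 13]])
        no_certificate
        None];
  Plan [:: 4; 5] 9 [:: 1; 4; 7]
    (Certificate 9 27 0
      [:: [:: 8; 20; 3; 40; 17; 48; 10; 43; 22]; [:: 40; 32; 47; 27; 18; 44; 1; 31; 13];
          [:: 31; 45; 7; 50; 17; 28; 10; 23; 43]; [:: 2; 26; 53; 21; 15; 41; 32; 8; 47]])
    (Some ([:: 2; 0; 2; 0; 0; 0; 0; 2; 0],
      (Certificate 9 36 36
        [:: [:: 30; 44; 67; 1; 16; 59; 12; 54; 37]; [:: 41; 32; 52; 26; 45; 0; 62; 6; 58];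
            [:: 14; 63; 45; 67; 9; 32; 2; 20; 41]; [:: 51; 0; 19; 13; 16; 55; 10; 56; 42]])))
    [:: Filling 1
        (Certificate 5 10 0
          [:: [:: 1; 2; 6; 14; 8; 17; 12; 10; 19]; [:: 19; 0; 7; 15; 3; 5; 9; 11; 12];
              [:: 5; 0; 3; 19; 9; 7; 12; 16; 11]; [:: 13; 0; 10; 6; 16; 5; 18; 8; 14]])
        no_certificate
        (Some (Certificate 19 19 0
          [:: [:: 15; 36; 27; 11; 3; 13; 30; 1; 17]; [:: 3; 26; 31; 11; 12; 15; 8; 35; 0];
              [:: 8; 15; 2; 20; 4; 34; 17; 31; 32]; [:: 31; 37; 35; 6; 27; 23; 17; 19; 10]]));
      Filling 0
        (Certificate 1 0 9
          [:: [:: 15; 9; 10; 16; 7; 3; 0; 13; 5]; [:: 7; 13; 8; 15; 1; 16; 5; 3; 11];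
              [:: 7; 9; 13; 14; 2; 17; 10; 4; 0]; [:: 7; 1; 9; 17; 14; 3; 13; 10; 5];
              [:: 14; 10; 6; 1; 4; 16; 13; 2; 8]; [:: 9; 0; 5; 2; 14; 12; 10; 7; 16];
              [:: 4; 14; 2; 7; 9; 11; 0; 12; 16]; [:: 5; 8; 7; 12; 17; 1; 15; 10; 3]])
        no_certificate
        None];
  Plan [:: 9] 9 [:: 1; 4; 7]
    (Certificate 9 27 18
      [:: [:: 16; 48; 28; 4; 34; 42; 11; 37; 23]; [:: 16; 34; 43; 5; 22; 37; 11; 49; 29]])
    (Some ([:: 2; 2; 0; 0; 2; 1; 0; 1; 1],
      (Certificate 9 36 36
        [:: [:: 42; 60; 52; 21; 47; 3; 62; 5; 35]; [:: 56; 25; 7; 18; 71; 21; 67; 47; 8];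
            [:: 61; 42; 17; 59; 38; 65; 31; 45; 12]; [:: 62; 35; 11; 28; 48; 16; 23; 42; 4]])))
    [:: Filling 1
        (Certificate 5 10 0
          [:: [:: 19; 1; 16; 3; 12; 8; 4; 14; 6]; [:: 0; 7; 8; 14; 12; 11; 18; 3; 16];
              [:: 17; 12; 18; 1; 3; 15; 11; 9; 7]; [:: 3; 14; 5; 8; 1; 18; 13; 11; 7]])
        no_certificate
        (Some (Certificate 19 19 0
          [:: [:: 30; 3; 6; 29; 25; 18; 33; 9; 17]; [:: 15; 19; 31; 4; 7; 27; 33; 24; 37];
              [:: 16; 24; 19; 34; 27; 37; 31; 10; 15]; [:: 37; 26; 2; 4; 20; 1; 29; 17; 35]]));
      Filling 0
        (Certificate 1 0 9
          [:: [:: 0; 12; 8; 2; 16; 5; 10; 15; 7]; [:: 15; 8; 3; 4; 0; 10; 13; 7; 16];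
              [:: 4; 9; 17; 0; 6; 10; 2; 12; 14]; [:: 5; 12; 10; 16; 6; 15; 3; 0; 9];
              [:: 11; 15; 1; 9; 6; 13; 16; 3; 5]; [:: 5; 14; 16; 11; 9; 7; 2; 0; 13];
              [:: 6; 11; 2; 13; 14; 8; 17; 1; 4]; [:: 7; 3; 14; 1; 10; 9; 12; 16; 4]])
        no_certificate
        None]].

Definition plans_of_10 : seq plan :=
  [:: Plan [:: 2; 2; 2; 2; 2] 10 [:: 2; 9]
    (Certificate 10 30 0
      [:: [:: 16; 37; 19; 39; 24; 49; 34; 0; 23; 14]; [:: 44; 7; 39; 9; 27; 51; 33; 18; 21; 10];
          [:: 0; 45; 49; 31; 8; 21; 2; 34; 40; 23]; [:: 11; 49; 22; 16; 37; 9; 14; 58; 32; 7]])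
    (Some ([:: 0; 2; 0; 2; 1; 1; 0; 1; 2; 2],
      (Certificate 10 40 0
        [:: [:: 58; 75; 12; 26; 2; 67; 34; 8; 22; 17]; [:: 1; 44; 76; 23; 33; 51; 65; 49; 9; 73];
            [:: 74; 15; 43; 61; 59; 1; 10; 21; 77; 23];
            [:: 37; 64; 12; 33; 45; 71; 78; 57; 28; 0];
            [:: 26; 19; 23; 72; 33; 56; 7; 79; 31; 11];
            [:: 37; 2; 17; 77; 33; 57; 48; 75; 63; 10];
            [:: 15; 25; 46; 65; 38; 57; 41; 17; 71; 21];
            [:: 38; 6; 4; 43; 34; 3; 44; 66; 72; 24]])))
    [:: Filling 1
        (Certificate 11 11 0
          [:: [:: 2; 21; 1; 8; 4; 11; 18; 12; 14; 6]; [:: 13; 14; 8; 20; 3; 1; 5; 16; 11; 7]])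
        no_certificate
        (Some (Certificate 21 21 0
          [:: [:: 26; 32; 1; 13; 23; 5; 9; 10; 29; 19];
              [:: 37; 12; 24; 11; 27; 5; 3; 29; 41; 33]; [:: 5; 36; 21; 19; 6; 3; 30; 1; 29; 8];
              [:: 0; 38; 4; 41; 23; 6; 2; 16; 27; 34]]));
      Filling 5
        (Certificate 7 14 0
          [:: [:: 12; 7; 18; 11; 25; 9; 16; 5; 3; 27]; [:: 25; 29; 5; 14; 10; 16; 7; 3; 18; 13];
              [:: 21; 15; 28; 6; 22; 27; 24; 9; 19; 17]; [:: 5; 6; 18; 27; 9; 1; 13; 21; 10; 15];
              [:: 2; 29; 15; 1; 16; 20; 19; 4; 10; 7]; [:: 13; 17; 7; 9; 22; 25; 3; 15; 19; 28]])
        (Certificate 1 0 0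
          [:: [:: 4; 3; 21; 6; 29; 10; 17; 0; 15; 23]; [:: 12; 21; 29; 6; 22; 2; 11; 5; 25; 17];
              [:: 14; 26; 11; 9; 1; 24; 16; 28; 2; 6]; [:: 16; 4; 24; 10; 6; 28; 2; 12; 19; 23];
              [:: 5; 9; 15; 20; 3; 17; 0; 6; 12; 26]; [:: 11; 21; 5; 12; 14; 1; 3; 25; 19; 28];
              [:: 28; 2; 12; 10; 22; 19; 20; 9; 1; 4]; [:: 2; 11; 19; 12; 1; 28; 21; 5; 23; 6];
              [:: 5; 27; 18; 12; 29; 1; 25; 15; 6; 8]; [:: 3; 11; 14; 20; 0; 8; 18; 28; 6; 12];
              [:: 2; 21; 1; 22; 19; 8; 7; 17; 27; 12]; [:: 18; 11; 13; 25; 14; 3; 26; 9; 17; 21];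
              [:: 5; 7; 16; 26; 21; 9; 11; 0; 19; 2]; [:: 8; 7; 13; 0; 15; 3; 23; 17; 5; 10];
              [:: 1; 18; 24; 6; 23; 5; 12; 9; 16; 27]; [:: 8; 15; 13; 28; 2; 1; 4; 7; 16; 10];
              [:: 26; 11; 18; 20; 15; 5; 2; 0; 9; 16]; [:: 8; 22; 24; 15; 19; 6; 13; 2; 4; 27];
              [:: 11; 6; 19; 24; 5; 13; 16; 15; 0; 26]; [:: 10; 0; 14; 7; 19; 9; 5; 29; 17; 2];
              [:: 8; 25; 4; 19; 23; 2; 16; 7; 14; 12]; [:: 10; 15; 12; 22; 28; 8; 17; 19; 0; 24];
              [:: 6; 1; 12; 28; 20; 17; 3; 8; 15; 26]; [:: 8; 14; 7; 21; 18; 24; 16; 13; 4; 23];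
              [:: 22; 9; 16; 14; 1; 5; 11; 20; 3; 19]; [:: 9; 27; 24; 7; 29; 15; 10; 17; 18; 0];
              [:: 26; 18; 5; 24; 23; 14; 7; 12; 9; 17]; [:: 21; 1; 27; 11; 22; 6; 4; 2; 17; 24];
              [:: 7; 2; 12; 0; 28; 15; 21; 4; 19; 11]; [:: 4; 17; 2; 27; 13; 9; 28; 10; 15; 19];
              [:: 15; 4; 2; 25; 23; 16; 27; 18; 10; 9]; [:: 0; 27; 9; 3; 10; 14; 24; 13; 18; 4];
              [:: 21; 0; 12; 15; 17; 28; 8; 5; 11; 22]; [:: 2; 29; 0; 16; 7; 27; 25; 5; 18; 15];
              [:: 9; 28; 13; 21; 27; 6; 16; 19; 10; 22];
              [:: 19; 7; 20; 2; 10; 25; 12; 16; 1; 23]; [:: 9; 0; 13; 10; 27; 3; 7; 15; 28; 5];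
              [:: 1; 15; 12; 23; 7; 11; 25; 9; 21; 18]])
        (Some (Certificate 5 25 0
          [:: [:: 24; 39; 23; 9; 14; 33; 4; 41; 18; 11];
              [:: 31; 23; 45; 34; 40; 32; 16; 0; 24; 5];
              [:: 11; 15; 49; 28; 38; 36; 7; 16; 21; 26];
              [:: 13; 40; 27; 24; 32; 0; 44; 20; 23; 17];
              [:: 22; 9; 6; 42; 35; 41; 29; 25; 36; 45];
              [:: 44; 11; 29; 41; 21; 37; 7; 30; 34; 22];
              [:: 14; 7; 48; 17; 20; 18; 28; 44; 11; 25];
              [:: 30; 17; 44; 14; 10; 46; 37; 23; 2; 6];
              [:: 24; 47; 45; 1; 42; 3; 27; 17; 9; 30]; [:: 12; 8; 45; 5; 1; 2; 11; 24; 7; 27];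
              [:: 13; 11; 47; 30; 6; 37; 49; 34; 20; 3];
              [:: 37; 30; 44; 49; 8; 26; 17; 41; 47; 4];
              [:: 35; 6; 21; 14; 11; 4; 26; 44; 25; 16];
              [:: 11; 16; 2; 14; 34; 9; 19; 37; 29; 38];
              [:: 40; 25; 44; 6; 8; 16; 34; 46; 33; 11];
              [:: 6; 41; 43; 49; 5; 20; 26; 15; 36; 25];
              [:: 8; 34; 41; 2; 29; 36; 38; 0; 27; 16];
              [:: 44; 47; 37; 20; 6; 48; 43; 12; 0; 22];
              [:: 20; 40; 13; 8; 11; 1; 32; 17; 37; 38];
              [:: 46; 36; 0; 23; 33; 44; 4; 38; 34; 30]; [:: 24; 8; 15; 47; 3; 5; 7; 18; 12; 20];
              [:: 13; 32; 14; 41; 25; 23; 37; 27; 1; 4];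
              [:: 12; 38; 36; 40; 10; 30; 46; 44; 33; 19];
              [:: 44; 21; 46; 29; 1; 31; 34; 13; 42; 14]]))];
  Plan [:: 2; 2; 2; 4] 10 [:: 2; 7; 9]
    (Certificate 10 30 20
      [:: [:: 12; 47; 45; 0; 52; 15; 7; 36; 9; 39]; [:: 22; 57; 43; 25; 58; 34; 30; 11; 39; 19]])
    (Some ([:: 2; 1; 0; 1; 1; 0; 2; 1; 2; 0],
      (Certificate 10 40 0
        [:: [:: 45; 1; 70; 12; 5; 59; 25; 43; 39; 73];
            [:: 72; 31; 18; 27; 10; 60; 34; 49; 65; 14];
            [:: 37; 5; 24; 58; 39; 8; 34; 68; 19; 62];
            [:: 45; 0; 62; 18; 12; 51; 75; 55; 17; 28];
            [:: 24; 16; 67; 38; 75; 43; 51; 70; 7; 27];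
            [:: 77; 22; 28; 74; 58; 35; 63; 46; 8; 21];
            [:: 58; 71; 55; 0; 36; 6; 69; 27; 72; 52];
            [:: 11; 68; 50; 33; 26; 7; 62; 43; 28; 46]])))
    [:: Filling 1
        (Certificate 11 11 0
          [:: [:: 7; 21; 18; 12; 16; 14; 8; 1; 4; 11]; [:: 17; 6; 20; 10; 5; 9; 3; 18; 15; 0]])
        no_certificate
        (Some (Certificate 21 21 0
          [:: [:: 8; 6; 41; 25; 14; 22; 37; 17; 26; 13];
              [:: 37; 38; 27; 17; 5; 30; 0; 14; 25; 18];
              [:: 35; 4; 30; 9; 27; 33; 14; 7; 40; 28]; [:: 0; 5; 38; 34; 6; 25; 26; 33; 11; 41]]));
      Filling 5
        (Certificate 7 14 0
          [:: [:: 24; 26; 21; 0; 28; 15; 13; 11; 23; 5];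
              [:: 27; 24; 15; 13; 29; 0; 23; 8; 20; 5]; [:: 28; 0; 21; 27; 14; 23; 5; 2; 7; 9];
              [:: 6; 20; 19; 15; 9; 26; 11; 22; 13; 2]; [:: 5; 15; 28; 18; 17; 20; 10; 13; 6; 2];
              [:: 8; 14; 26; 4; 0; 23; 16; 3; 18; 7]])
        (Certificate 1 0 0
          [:: [:: 8; 18; 25; 7; 4; 10; 21; 1; 16; 12]; [:: 25; 12; 21; 10; 19; 15; 6; 17; 1; 3];
              [:: 7; 26; 0; 28; 4; 12; 17; 8; 24; 14]; [:: 0; 5; 27; 18; 12; 15; 23; 9; 21; 17];
              [:: 10; 3; 8; 29; 7; 27; 16; 13; 23; 19]; [:: 26; 11; 23; 1; 29; 15; 3; 13; 21; 8];
              [:: 25; 17; 11; 23; 15; 6; 13; 2; 5; 29]; [:: 22; 6; 25; 14; 19; 13; 2; 10; 16; 4];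
              [:: 14; 0; 7; 10; 19; 24; 2; 12; 8; 5]; [:: 29; 16; 0; 4; 9; 3; 20; 15; 27; 13];
              [:: 9; 7; 27; 0; 4; 23; 19; 3; 28; 12]; [:: 28; 1; 5; 6; 10; 19; 13; 9; 2; 23];
              [:: 20; 10; 6; 16; 1; 12; 26; 5; 3; 15]; [:: 18; 7; 22; 1; 4; 8; 15; 10; 13; 27];
              [:: 28; 13; 14; 19; 9; 27; 17; 6; 3; 1]; [:: 20; 3; 5; 18; 9; 29; 11; 15; 0; 7];
              [:: 27; 1; 22; 17; 3; 18; 14; 4; 28; 6]; [:: 17; 19; 14; 8; 25; 6; 23; 10; 0; 12];
              [:: 19; 21; 29; 4; 1; 10; 9; 23; 12; 16]; [:: 11; 24; 7; 12; 20; 5; 18; 17; 3; 22];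
              [:: 24; 9; 19; 11; 27; 12; 20; 16; 14; 1];
              [:: 13; 7; 10; 24; 19; 28; 15; 23; 17; 26];
              [:: 11; 16; 24; 4; 26; 9; 21; 14; 3; 0]; [:: 8; 19; 0; 24; 5; 27; 11; 12; 14; 29];
              [:: 17; 27; 4; 11; 0; 19; 3; 14; 6; 28]; [:: 15; 22; 9; 10; 7; 3; 19; 12; 0; 25];
              [:: 9; 11; 23; 18; 14; 5; 24; 17; 12; 3]; [:: 19; 20; 8; 13; 16; 5; 11; 7; 0; 3];
              [:: 11; 28; 8; 15; 6; 4; 16; 3; 19; 25]; [:: 22; 2; 28; 7; 26; 18; 21; 16; 10; 15];
              [:: 1; 7; 25; 13; 2; 26; 17; 5; 8; 20]; [:: 1; 8; 4; 20; 18; 6; 17; 14; 24; 3];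
              [:: 20; 6; 3; 29; 27; 11; 16; 1; 24; 8]; [:: 6; 9; 16; 28; 23; 5; 12; 20; 2; 14];
              [:: 7; 20; 19; 1; 13; 4; 10; 23; 15; 28]; [:: 3; 26; 22; 9; 19; 5; 10; 14; 20; 0];
              [:: 3; 25; 28; 18; 8; 0; 27; 4; 14; 16]; [:: 6; 23; 12; 10; 25; 4; 21; 3; 16; 8]])
        (Some (Certificate 3 24 0
          [:: [:: 5; 44; 10; 41; 34; 9; 30; 49; 0; 7]; [:: 24; 1; 40; 29; 44; 47; 8; 5; 35; 18];
              [:: 5; 9; 17; 10; 33; 21; 18; 14; 30; 48];
              [:: 43; 1; 21; 22; 13; 11; 29; 36; 24; 26];
              [:: 20; 28; 12; 2; 14; 40; 0; 31; 26; 24];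
              [:: 16; 33; 20; 12; 48; 2; 23; 8; 18; 5];
              [:: 24; 10; 42; 29; 40; 35; 30; 14; 18; 48];
              [:: 22; 2; 37; 44; 27; 42; 15; 12; 40; 0];
              [:: 38; 43; 34; 29; 9; 47; 32; 1; 36; 14];
              [:: 16; 47; 25; 35; 45; 10; 20; 7; 40; 9];
              [:: 15; 22; 12; 19; 38; 34; 33; 2; 20; 46];
              [:: 7; 21; 18; 15; 16; 9; 26; 13; 46; 2]; [:: 36; 5; 38; 29; 7; 26; 2; 8; 10; 23];
              [:: 25; 20; 22; 38; 12; 42; 34; 36; 29; 7];
              [:: 23; 31; 9; 35; 28; 21; 4; 36; 39; 27];
              [:: 29; 13; 26; 9; 49; 46; 33; 39; 44; 36];
              [:: 14; 39; 23; 47; 17; 6; 21; 36; 26; 32];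
              [:: 34; 17; 42; 1; 10; 7; 46; 23; 30; 21];
              [:: 45; 17; 29; 1; 18; 38; 46; 13; 37; 2];
              [:: 29; 12; 16; 31; 46; 10; 22; 45; 33; 35];
              [:: 29; 45; 18; 36; 9; 33; 38; 3; 6; 41];
              [:: 2; 30; 4; 23; 47; 14; 34; 28; 38; 36];
              [:: 34; 33; 45; 47; 19; 13; 26; 31; 40; 1];
              [:: 12; 25; 18; 2; 49; 8; 47; 22; 43; 35];
              [:: 39; 43; 35; 19; 10; 36; 27; 28; 30; 4];
              [:: 14; 28; 1; 44; 48; 16; 37; 9; 11; 42];
              [:: 13; 48; 7; 37; 45; 26; 47; 39; 15; 33];
              [:: 28; 49; 15; 1; 45; 27; 11; 4; 6; 34];
              [:: 6; 16; 37; 14; 46; 48; 20; 26; 10; 43];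
              [:: 42; 31; 34; 37; 20; 8; 29; 14; 13; 2];
              [:: 44; 34; 8; 14; 21; 23; 41; 48; 3; 18];
              [:: 46; 14; 25; 45; 1; 12; 23; 43; 34; 30];
              [:: 24; 9; 37; 22; 39; 12; 18; 3; 16; 28];
              [:: 27; 1; 10; 3; 40; 23; 39; 6; 35; 48]; [:: 24; 38; 12; 14; 43; 6; 5; 11; 33; 0];
              [:: 29; 11; 16; 30; 18; 25; 23; 48; 21; 27];
              [:: 38; 2; 47; 19; 45; 34; 12; 0; 32; 24];
              [:: 0; 35; 29; 49; 40; 46; 11; 39; 37; 3]; [:: 29; 30; 43; 9; 41; 49; 13; 1; 4; 2];
              [:: 48; 6; 0; 46; 8; 19; 34; 40; 2; 4]]))];
  Plan [:: 2; 2; 3; 3] 10 [:: 1; 2; 7]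
    (Certificate 10 30 0
      [:: [:: 36; 16; 21; 12; 14; 48; 26; 22; 44; 10];
          [:: 37; 58; 27; 14; 56; 32; 13; 30; 0; 44];
          [:: 35; 58; 52; 19; 40; 17; 36; 11; 55; 21]; [:: 15; 24; 53; 11; 44; 31; 3; 33; 46; 5]])
    (Some ([:: 0; 1; 0; 1; 2; 2; 1; 1; 0; 2],
      (Certificate 10 40 0
        [:: [:: 74; 21; 69; 41; 27; 48; 6; 53; 62; 19];
            [:: 3; 46; 15; 59; 65; 4; 33; 48; 34; 67]; [:: 35; 7; 21; 9; 79; 33; 2; 45; 11; 74];
            [:: 44; 20; 65; 55; 27; 73; 16; 29; 71; 42];
            [:: 20; 9; 5; 25; 30; 55; 73; 49; 7; 26]; [:: 6; 49; 8; 43; 15; 79; 25; 68; 51; 37];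
            [:: 8; 68; 72; 27; 23; 46; 64; 43; 28; 70];
            [:: 4; 60; 53; 31; 14; 75; 23; 7; 37; 71]])))
    [:: Filling 1
        (Certificate 11 11 0
          [:: [:: 9; 15; 21; 0; 4; 19; 17; 2; 12; 10]; [:: 18; 14; 0; 7; 20; 11; 3; 16; 13; 4]])
        no_certificate
        (Some (Certificate 21 21 0
          [:: [:: 15; 37; 34; 7; 28; 3; 31; 8; 12; 20];
              [:: 16; 22; 12; 21; 6; 27; 31; 33; 41; 14];
              [:: 28; 26; 13; 18; 16; 15; 4; 34; 20; 2];
              [:: 24; 29; 9; 35; 14; 32; 3; 26; 36; 5]]));
      Filling 5
        (Certificate 7 14 0
          [:: [:: 4; 11; 9; 14; 17; 25; 27; 2; 22; 29]; [:: 27; 24; 21; 11; 22; 6; 28; 2; 14; 5];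
              [:: 13; 24; 0; 23; 28; 4; 18; 27; 16; 21];
              [:: 6; 14; 11; 5; 28; 13; 25; 21; 17; 1]; [:: 7; 11; 16; 23; 5; 19; 8; 13; 2; 0];
              [:: 27; 12; 0; 18; 7; 24; 9; 23; 21; 4]])
        (Certificate 1 0 10
          [:: [:: 21; 9; 1; 29; 6; 19; 15; 13; 4; 10]; [:: 24; 19; 22; 3; 15; 13; 11; 28; 6; 16];
              [:: 3; 24; 1; 27; 7; 5; 29; 17; 19; 23]; [:: 11; 21; 28; 9; 16; 12; 3; 15; 5; 26];
              [:: 13; 27; 28; 19; 16; 0; 4; 2; 9; 14]; [:: 24; 17; 13; 28; 19; 4; 3; 9; 0; 11];
              [:: 3; 21; 25; 11; 7; 15; 9; 0; 13; 22]; [:: 14; 25; 7; 26; 1; 18; 11; 2; 16; 8];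
              [:: 22; 15; 1; 25; 18; 13; 8; 7; 11; 16]; [:: 25; 5; 3; 29; 10; 15; 16; 20; 0; 18];
              [:: 20; 6; 26; 18; 17; 12; 8; 2; 4; 1]; [:: 22; 11; 25; 8; 6; 18; 12; 1; 15; 21];
              [:: 9; 27; 23; 5; 19; 21; 14; 2; 10; 7]; [:: 11; 28; 13; 24; 5; 27; 14; 7; 8; 0];
              [:: 23; 8; 13; 20; 28; 16; 5; 2; 0; 6]; [:: 20; 4; 7; 25; 13; 3; 14; 22; 17; 18];
              [:: 27; 16; 15; 28; 13; 5; 6; 11; 2; 19]; [:: 26; 11; 6; 23; 16; 14; 1; 18; 4; 9];
              [:: 21; 16; 2; 26; 10; 9; 5; 13; 23; 1]])
        (Some (Certificate 5 25 0
          [:: [:: 44; 23; 3; 37; 41; 43; 5; 0; 24; 8]; [:: 4; 27; 35; 7; 9; 0; 12; 28; 20; 37];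
              [:: 49; 40; 13; 22; 0; 21; 37; 24; 7; 9];
              [:: 24; 29; 44; 13; 42; 32; 1; 22; 7; 18];
              [:: 6; 3; 33; 38; 17; 27; 9; 36; 23; 40];
              [:: 23; 49; 20; 30; 3; 39; 10; 34; 18; 37];
              [:: 26; 20; 5; 35; 17; 7; 42; 38; 41; 36];
              [:: 22; 11; 30; 3; 0; 49; 44; 33; 17; 24];
              [:: 49; 43; 36; 32; 30; 12; 22; 29; 41; 5];
              [:: 5; 11; 0; 40; 6; 2; 28; 19; 23; 37];
              [:: 27; 19; 32; 11; 24; 22; 36; 47; 5; 17];
              [:: 10; 6; 17; 30; 28; 0; 36; 15; 42; 34];
              [:: 44; 15; 16; 38; 19; 25; 13; 1; 43; 36];
              [:: 32; 12; 29; 26; 42; 19; 16; 22; 38; 37];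
              [:: 42; 23; 9; 32; 14; 20; 18; 5; 34; 44];
              [:: 10; 1; 30; 15; 43; 39; 6; 16; 40; 9];
              [:: 36; 27; 28; 15; 11; 45; 13; 49; 19; 1];
              [:: 49; 29; 32; 18; 3; 35; 23; 36; 44; 38];
              [:: 44; 26; 17; 0; 33; 20; 49; 9; 5; 42];
              [:: 19; 14; 45; 28; 46; 48; 35; 9; 42; 10];
              [:: 40; 33; 4; 29; 23; 38; 45; 9; 48; 43];
              [:: 45; 17; 32; 43; 46; 19; 11; 22; 15; 0];
              [:: 24; 48; 22; 47; 0; 31; 10; 42; 16; 19];
              [:: 34; 46; 24; 19; 8; 1; 28; 6; 38; 27]]))];
  Plan [:: 2; 2; 6] 10 [:: 3; 4; 8]
    (Certificate 10 30 0
      [:: [:: 40; 25; 54; 7; 31; 47; 11; 32; 13; 59]; [:: 46; 18; 27; 54; 24; 3; 59; 23; 4; 50];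
          [:: 55; 8; 23; 1; 34; 14; 51; 25; 7; 42]; [:: 0; 30; 49; 22; 7; 36; 19; 38; 9; 27]])
    (Some ([:: 2; 0; 0; 2; 0; 2; 0; 1; 2; 1],
      (Certificate 10 40 30
        [:: [:: 14; 63; 50; 70; 28; 56; 73; 46; 21; 11];
            [:: 71; 18; 23; 77; 36; 7; 25; 5; 50; 14];
            [:: 9; 71; 48; 78; 33; 59; 23; 50; 35; 12];
            [:: 69; 30; 11; 74; 51; 14; 42; 78; 52; 5]])))
    [:: Filling 1
        (Certificate 11 11 0
          [:: [:: 4; 17; 6; 11; 8; 0; 3; 13; 19; 15]; [:: 11; 2; 6; 8; 18; 4; 21; 15; 12; 0]])
        no_certificate
        (Some (Certificate 21 21 0
          [:: [:: 30; 26; 35; 13; 7; 22; 20; 33; 38; 37];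
              [:: 15; 34; 10; 38; 20; 25; 6; 40; 0; 17];
              [:: 38; 28; 1; 19; 11; 22; 41; 33; 24; 17];
              [:: 29; 0; 40; 24; 26; 38; 7; 4; 11; 17]]));
      Filling 5
        (Certificate 7 14 0
          [:: [:: 12; 28; 14; 3; 18; 23; 24; 6; 20; 0]; [:: 23; 4; 27; 6; 16; 3; 12; 20; 14; 0];
              [:: 5; 6; 9; 1; 26; 24; 20; 19; 14; 13]; [:: 5; 9; 26; 29; 24; 16; 0; 12; 18; 22];
              [:: 8; 19; 24; 12; 17; 7; 5; 27; 10; 29]; [:: 15; 22; 12; 7; 28; 24; 3; 27; 4; 9]])
        (Certificate 1 0 10
          [:: [:: 29; 5; 17; 27; 8; 7; 10; 12; 15; 2]; [:: 13; 20; 23; 10; 5; 7; 18; 17; 29; 3];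
              [:: 3; 25; 18; 27; 17; 10; 14; 9; 4; 12]; [:: 6; 24; 14; 29; 13; 9; 5; 0; 18; 3];
              [:: 29; 13; 21; 16; 11; 5; 14; 7; 0; 27]; [:: 16; 22; 7; 27; 2; 10; 1; 8; 24; 5];
              [:: 12; 27; 1; 25; 16; 2; 14; 19; 9; 7]; [:: 19; 28; 0; 20; 16; 10; 8; 14; 6; 3];
              [:: 2; 23; 14; 27; 10; 0; 16; 4; 7; 13]; [:: 18; 23; 1; 29; 6; 21; 10; 24; 8; 13];
              [:: 7; 29; 20; 5; 10; 19; 3; 8; 16; 15]; [:: 9; 20; 10; 29; 2; 6; 18; 16; 14; 1];
              [:: 26; 3; 4; 23; 20; 10; 25; 13; 1; 7]; [:: 15; 21; 22; 6; 4; 11; 8; 19; 12; 25];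
              [:: 17; 25; 28; 8; 4; 14; 18; 12; 22; 0]; [:: 27; 9; 2; 20; 17; 13; 15; 1; 18; 4];
              [:: 15; 23; 25; 18; 16; 9; 1; 26; 10; 6]; [:: 23; 8; 25; 14; 1; 12; 5; 18; 10; 3];
              [:: 18; 21; 4; 26; 22; 13; 2; 29; 16; 1]])
        (Some (Certificate 5 25 0
          [:: [:: 10; 5; 33; 28; 49; 9; 25; 41; 45; 19];
              [:: 6; 10; 33; 27; 16; 31; 8; 43; 44; 41];
              [:: 40; 5; 37; 10; 31; 33; 47; 25; 9; 35];
              [:: 44; 20; 49; 26; 30; 2; 15; 22; 35; 25];
              [:: 16; 24; 35; 15; 22; 47; 20; 13; 19; 44];
              [:: 31; 40; 5; 29; 16; 35; 10; 33; 19; 37];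
              [:: 37; 44; 25; 27; 4; 23; 43; 39; 10; 49];
              [:: 42; 10; 26; 23; 49; 1; 9; 5; 16; 20]; [:: 24; 14; 38; 26; 9; 33; 4; 43; 0; 34];
              [:: 21; 35; 23; 30; 3; 41; 33; 46; 6; 9]; [:: 13; 10; 47; 31; 4; 48; 2; 38; 14; 7];
              [:: 5; 35; 7; 46; 48; 33; 37; 15; 21; 44];
              [:: 46; 36; 7; 26; 45; 15; 29; 30; 11; 2];
              [:: 24; 11; 38; 31; 9; 12; 46; 15; 17; 45];
              [:: 48; 36; 32; 39; 17; 43; 15; 7; 9; 2];
              [:: 15; 3; 6; 28; 25; 42; 39; 47; 21; 40];
              [:: 44; 46; 16; 23; 3; 12; 14; 27; 28; 21];
              [:: 8; 25; 39; 28; 14; 6; 37; 48; 41; 18]; [:: 20; 48; 34; 1; 4; 15; 44; 2; 9; 22];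
              [:: 15; 10; 5; 26; 12; 30; 18; 20; 7; 24];
              [:: 17; 1; 26; 22; 37; 14; 20; 40; 6; 39];
              [:: 1; 21; 8; 30; 11; 48; 15; 26; 47; 40];
              [:: 17; 7; 37; 11; 4; 33; 2; 44; 19; 43];
              [:: 17; 26; 23; 31; 32; 45; 38; 28; 35; 7]]))];
  Plan [:: 2; 3; 5] 10 [:: 4; 7; 9]
    (Certificate 10 30 0
      [:: [:: 5; 59; 24; 52; 15; 33; 17; 44; 27; 2]; [:: 29; 56; 32; 47; 8; 26; 11; 49; 1; 54];
          [:: 39; 57; 54; 20; 16; 28; 9; 25; 15; 43]; [:: 39; 19; 20; 54; 1; 33; 16; 45; 26; 3]])
    (Some ([:: 1; 2; 2; 1; 0; 2; 0; 0; 1; 2],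
      (Certificate 10 40 30
        [:: [:: 64; 54; 78; 41; 32; 36; 1; 73; 5; 76];
            [:: 65; 41; 44; 62; 26; 8; 42; 14; 39; 47];
            [:: 62; 9; 51; 16; 36; 6; 75; 39; 18; 22];
            [:: 41; 63; 15; 42; 25; 22; 56; 18; 29; 68]])))
    [:: Filling 1
        (Certificate 11 11 0
          [:: [:: 12; 0; 8; 5; 19; 14; 10; 17; 3; 20]; [:: 20; 19; 16; 5; 3; 12; 10; 14; 1; 6]])
        no_certificate
        (Some (Certificate 21 21 0
          [:: [:: 26; 23; 13; 24; 1; 40; 7; 29; 17; 14];
              [:: 32; 23; 29; 36; 12; 26; 18; 31; 25; 2];
              [:: 4; 32; 39; 7; 13; 11; 16; 23; 19; 21];
              [:: 35; 6; 40; 19; 2; 29; 27; 5; 22; 30]]));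
      Filling 5
        (Certificate 7 14 0
          [:: [:: 21; 16; 13; 24; 1; 18; 2; 23; 14; 28];
              [:: 4; 27; 28; 13; 21; 6; 22; 11; 15; 8]; [:: 0; 14; 24; 16; 26; 6; 5; 29; 13; 23];
              [:: 7; 2; 29; 0; 24; 11; 20; 8; 27; 5]; [:: 26; 6; 20; 24; 18; 4; 8; 0; 15; 11];
              [:: 24; 27; 14; 23; 11; 1; 12; 8; 3; 16]])
        (Certificate 1 0 10
          [:: [:: 28; 0; 6; 16; 5; 11; 24; 13; 3; 14]; [:: 18; 28; 2; 5; 22; 25; 7; 15; 9; 1];
              [:: 1; 26; 13; 24; 6; 16; 10; 5; 9; 3]; [:: 27; 14; 20; 7; 2; 4; 12; 1; 16; 18];
              [:: 5; 20; 22; 15; 13; 2; 25; 8; 27; 10]; [:: 2; 28; 4; 0; 22; 18; 15; 12; 6; 8];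
              [:: 8; 22; 21; 0; 18; 10; 25; 14; 16; 4];
              [:: 13; 29; 20; 17; 6; 18; 24; 9; 26; 11]; [:: 26; 2; 5; 15; 8; 1; 24; 17; 29; 10];
              [:: 28; 5; 17; 13; 18; 3; 21; 11; 7; 1]; [:: 7; 26; 23; 3; 18; 20; 0; 10; 17; 14];
              [:: 25; 5; 19; 6; 11; 14; 0; 9; 13; 2]; [:: 19; 27; 5; 7; 14; 13; 1; 17; 28; 10];
              [:: 7; 22; 5; 12; 18; 15; 28; 9; 2; 11]; [:: 23; 11; 9; 6; 29; 24; 15; 21; 16; 2];
              [:: 4; 26; 7; 19; 0; 8; 11; 21; 12; 17]; [:: 22; 16; 8; 13; 21; 19; 3; 7; 28; 15];
              [:: 12; 27; 14; 22; 1; 9; 21; 18; 25; 17]; [:: 26; 16; 1; 4; 2; 19; 8; 10; 12; 23]])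
        (Some (Certificate 5 25 0
          [:: [:: 41; 48; 36; 14; 39; 25; 32; 12; 6; 18];
              [:: 38; 29; 4; 8; 3; 37; 35; 13; 45; 18];
              [:: 22; 2; 42; 11; 6; 29; 37; 30; 35; 41];
              [:: 3; 22; 35; 29; 26; 5; 31; 17; 7; 36];
              [:: 41; 32; 47; 2; 18; 20; 45; 13; 37; 42];
              [:: 26; 36; 45; 1; 5; 14; 18; 11; 32; 47];
              [:: 31; 26; 18; 45; 33; 14; 12; 47; 16; 25];
              [:: 13; 25; 43; 38; 49; 11; 37; 3; 29; 14];
              [:: 49; 21; 27; 17; 14; 13; 2; 5; 22; 39];
              [:: 20; 27; 47; 42; 37; 32; 11; 49; 0; 13];
              [:: 10; 6; 22; 0; 8; 48; 29; 13; 21; 18];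
              [:: 4; 34; 28; 44; 48; 17; 43; 15; 20; 7];
              [:: 7; 12; 43; 3; 24; 44; 32; 38; 37; 18];
              [:: 47; 5; 20; 10; 12; 34; 40; 25; 49; 14];
              [:: 33; 5; 8; 0; 31; 10; 2; 43; 28; 14]; [:: 49; 36; 33; 42; 4; 31; 29; 21; 40; 6];
              [:: 10; 44; 18; 29; 1; 21; 35; 27; 5; 8]; [:: 46; 48; 1; 29; 27; 43; 33; 6; 11; 8];
              [:: 47; 39; 29; 4; 43; 33; 8; 41; 37; 20];
              [:: 9; 24; 15; 45; 28; 35; 22; 21; 47; 18];
              [:: 21; 27; 0; 37; 41; 5; 29; 35; 18; 22];
              [:: 40; 5; 16; 37; 8; 35; 31; 27; 44; 23];
              [:: 18; 36; 35; 9; 33; 10; 1; 42; 49; 29];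
              [:: 1; 33; 15; 10; 3; 28; 12; 43; 5; 41]]))];
  Plan [:: 2; 4; 4] 10 [:: 1; 4; 7]
    (Certificate 10 30 20
      [:: [:: 40; 18; 9; 56; 3; 38; 58; 10; 44; 36]; [:: 27; 40; 11; 31; 15; 34; 22; 50; 28; 18]])
    (Some ([:: 2; 0; 1; 0; 0; 0; 2; 0; 1; 1],
      (Certificate 10 40 0
        [:: [:: 13; 33; 71; 16; 63; 50; 38; 2; 57; 76];
            [:: 60; 40; 8; 42; 35; 56; 30; 44; 17; 58];
            [:: 7; 49; 18; 64; 10; 35; 26; 63; 51; 3];
            [:: 15; 64; 24; 68; 57; 8; 12; 75; 37; 60];
            [:: 30; 52; 28; 67; 5; 72; 62; 39; 46; 25];
            [:: 46; 33; 4; 78; 16; 59; 18; 73; 3; 64]; [:: 16; 37; 5; 34; 19; 29; 30; 1; 55; 67];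
            [:: 75; 39; 30; 58; 24; 0; 4; 72; 2; 71]])))
    [:: Filling 1
        (Certificate 11 11 0
          [:: [:: 7; 15; 18; 16; 12; 3; 21; 11; 9; 0]; [:: 10; 16; 4; 8; 20; 3; 13; 0; 15; 18]])
        no_certificate
        (Some (Certificate 21 21 0
          [:: [:: 12; 9; 40; 34; 18; 24; 23; 32; 27; 31];
              [:: 1; 29; 41; 6; 23; 38; 11; 21; 14; 32]; [:: 17; 34; 8; 21; 6; 30; 3; 1; 33; 10];
              [:: 41; 29; 37; 6; 10; 8; 12; 23; 31; 32]]));
      Filling 5
        (Certificate 7 14 0
          [:: [:: 16; 5; 13; 6; 22; 10; 25; 0; 15; 9]; [:: 23; 9; 24; 28; 27; 5; 13; 7; 20; 2];
              [:: 10; 12; 9; 5; 27; 16; 21; 3; 23; 24]; [:: 5; 22; 3; 6; 16; 26; 14; 18; 8; 29];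
              [:: 25; 16; 9; 28; 10; 5; 26; 14; 20; 18]; [:: 20; 5; 27; 1; 12; 6; 2; 28; 22; 25]])
        (Certificate 1 0 10
          [:: [:: 29; 1; 16; 18; 6; 22; 25; 13; 15; 10];
              [:: 17; 28; 5; 13; 14; 25; 22; 9; 2; 18]; [:: 1; 23; 12; 21; 14; 6; 9; 10; 24; 4];
              [:: 20; 9; 17; 2; 7; 25; 1; 27; 11; 18]; [:: 19; 26; 5; 11; 1; 3; 7; 23; 12; 17];
              [:: 7; 21; 13; 11; 16; 0; 2; 28; 9; 19]; [:: 18; 20; 26; 5; 6; 0; 15; 22; 3; 17];
              [:: 17; 26; 10; 1; 4; 18; 20; 14; 9; 13]; [:: 12; 28; 16; 20; 4; 15; 10; 6; 8; 26];
              [:: 19; 28; 5; 20; 16; 1; 15; 3; 9; 25]; [:: 10; 21; 29; 8; 19; 15; 2; 13; 1; 6];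
              [:: 2; 26; 25; 8; 17; 13; 10; 22; 18; 5]; [:: 27; 12; 14; 1; 8; 22; 6; 4; 16; 25];
              [:: 21; 3; 23; 16; 10; 13; 15; 9; 6; 26]; [:: 0; 25; 29; 4; 23; 2; 18; 17; 6; 13];
              [:: 25; 18; 7; 10; 14; 26; 2; 12; 9; 5]; [:: 1; 20; 11; 3; 14; 28; 17; 4; 26; 9];
              [:: 28; 7; 3; 0; 8; 10; 14; 4; 13; 19]; [:: 25; 2; 11; 28; 4; 22; 19; 6; 15; 1]])
        (Some (Certificate 5 25 0
          [:: [:: 39; 26; 32; 9; 49; 24; 29; 19; 36; 14];
              [:: 45; 35; 43; 10; 30; 46; 6; 9; 40; 38];
              [:: 29; 39; 7; 21; 9; 27; 15; 0; 43; 12];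
              [:: 20; 14; 24; 45; 29; 47; 18; 1; 13; 31];
              [:: 27; 39; 47; 0; 4; 25; 18; 35; 33; 11];
              [:: 4; 20; 36; 44; 8; 32; 10; 16; 46; 35]; [:: 2; 15; 5; 43; 29; 18; 1; 8; 23; 11];
              [:: 16; 0; 19; 33; 22; 13; 45; 24; 31; 10];
              [:: 47; 45; 20; 22; 17; 37; 49; 8; 30; 19];
              [:: 32; 4; 20; 42; 0; 2; 30; 14; 39; 48]; [:: 42; 22; 46; 29; 4; 49; 39; 9; 2; 10];
              [:: 40; 33; 17; 22; 5; 49; 43; 25; 10; 15];
              [:: 48; 13; 7; 27; 21; 34; 40; 3; 32; 38];
              [:: 25; 17; 20; 45; 41; 22; 35; 9; 36; 33];
              [:: 12; 26; 25; 33; 47; 20; 42; 3; 7; 31];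
              [:: 34; 20; 23; 10; 0; 44; 8; 31; 14; 27];
              [:: 5; 14; 39; 20; 9; 28; 42; 45; 11; 2]; [:: 16; 42; 4; 28; 3; 34; 11; 7; 9; 13];
              [:: 25; 22; 27; 43; 1; 34; 8; 5; 31; 47];
              [:: 39; 36; 49; 14; 30; 45; 21; 24; 28; 11];
              [:: 30; 24; 17; 10; 34; 48; 7; 12; 4; 42];
              [:: 13; 40; 2; 48; 16; 47; 10; 31; 44; 29];
              [:: 38; 45; 8; 15; 3; 25; 41; 46; 12; 30];
              [:: 2; 39; 29; 6; 37; 32; 20; 18; 16; 44]]))];
  Plan [:: 2; 8] 10 [:: 3; 4; 8]
    (Certificate 10 30 20
      [:: [:: 58; 32; 4; 52; 36; 44; 9; 28; 6; 24]; [:: 49; 2; 0; 31; 8; 44; 37; 7; 55; 39]])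
    (Some ([:: 1; 0; 2; 1; 2; 1; 0; 1; 0; 2],
      (Certificate 10 40 0
        [:: [:: 32; 40; 38; 1; 63; 59; 13; 23; 68; 16];
            [:: 54; 63; 10; 28; 78; 33; 72; 48; 3; 59];
            [:: 36; 45; 20; 1; 22; 2; 32; 11; 46; 71]; [:: 6; 63; 35; 14; 43; 71; 9; 27; 52; 4];
            [:: 74; 34; 45; 63; 37; 67; 11; 72; 1; 38];
            [:: 20; 57; 38; 72; 11; 33; 59; 62; 28; 54];
            [:: 74; 21; 63; 10; 46; 0; 48; 76; 27; 7];
            [:: 64; 47; 30; 71; 53; 37; 63; 11; 56; 1]])))
    [:: Filling 1
        (Certificate 11 11 0
          [:: [:: 2; 7; 14; 4; 20; 11; 16; 1; 9; 18]; [:: 1; 3; 10; 16; 15; 7; 19; 4; 13; 9]])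
        no_certificate
        (Some (Certificate 21 21 0
          [:: [:: 16; 30; 37; 7; 0; 2; 9; 11; 40; 24]; [:: 13; 35; 6; 25; 14; 18; 10; 4; 9; 3];
              [:: 22; 32; 9; 28; 31; 6; 24; 36; 15; 0];
              [:: 40; 25; 13; 20; 31; 28; 15; 7; 33; 37]]));
      Filling 5
        (Certificate 7 14 0
          [:: [:: 17; 1; 18; 20; 5; 2; 8; 23; 11; 26]; [:: 24; 7; 2; 15; 11; 28; 18; 27; 20; 16];
              [:: 16; 19; 8; 28; 13; 2; 11; 1; 22; 4]; [:: 27; 7; 20; 1; 29; 16; 14; 19; 5; 12];
              [:: 3; 26; 6; 15; 21; 0; 12; 9; 17; 4]; [:: 13; 23; 8; 11; 24; 14; 28; 17; 26; 0]])
        (Certificate 1 0 10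
          [:: [:: 13; 28; 0; 15; 19; 24; 17; 9; 21; 3]; [:: 22; 2; 12; 8; 1; 6; 10; 16; 4; 24];
              [:: 24; 10; 3; 5; 1; 21; 15; 27; 7; 8]; [:: 2; 26; 16; 7; 20; 15; 10; 1; 18; 23];
              [:: 5; 21; 11; 6; 14; 2; 8; 19; 25; 13];
              [:: 20; 11; 14; 29; 17; 18; 13; 22; 6; 24];
              [:: 28; 11; 27; 1; 3; 21; 18; 12; 7; 9]; [:: 28; 1; 2; 15; 23; 18; 11; 8; 4; 7];
              [:: 6; 28; 23; 9; 15; 26; 11; 3; 12; 1]; [:: 25; 8; 14; 22; 5; 11; 12; 2; 17; 19];
              [:: 0; 25; 8; 20; 6; 19; 4; 13; 14; 17]; [:: 24; 2; 4; 14; 7; 17; 10; 18; 27; 9];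
              [:: 4; 28; 11; 26; 16; 13; 1; 20; 19; 9];
              [:: 17; 21; 19; 5; 13; 23; 1; 11; 15; 28]; [:: 29; 9; 12; 16; 0; 18; 26; 7; 5; 14];
              [:: 3; 28; 5; 16; 23; 7; 13; 8; 0; 27]; [:: 23; 11; 6; 0; 14; 24; 4; 27; 16; 2];
              [:: 13; 26; 22; 8; 15; 17; 29; 18; 3; 4]; [:: 20; 12; 11; 4; 1; 16; 24; 6; 18; 2]])
        (Some (Certificate 5 25 0
          [:: [:: 7; 30; 17; 44; 0; 4; 37; 32; 29; 11];
              [:: 23; 37; 8; 32; 27; 46; 29; 25; 48; 18];
              [:: 18; 9; 1; 20; 13; 7; 47; 33; 42; 39];
              [:: 42; 22; 2; 46; 11; 35; 45; 37; 49; 20];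
              [:: 36; 1; 25; 5; 33; 34; 41; 15; 16; 44];
              [:: 40; 42; 36; 28; 8; 22; 0; 19; 44; 12];
              [:: 47; 16; 11; 14; 3; 5; 37; 12; 8; 43]; [:: 26; 11; 3; 39; 35; 4; 42; 7; 40; 44];
              [:: 28; 34; 3; 27; 49; 33; 40; 43; 46; 4];
              [:: 23; 4; 19; 20; 44; 37; 43; 33; 1; 46];
              [:: 21; 29; 35; 26; 42; 11; 47; 8; 49; 15];
              [:: 14; 49; 19; 0; 17; 41; 9; 6; 24; 32]; [:: 0; 30; 2; 23; 33; 46; 38; 19; 7; 10];
              [:: 9; 22; 44; 29; 18; 11; 15; 2; 4; 43];
              [:: 27; 20; 30; 6; 32; 38; 41; 24; 13; 11];
              [:: 4; 20; 17; 45; 22; 28; 38; 31; 33; 26];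
              [:: 9; 2; 0; 23; 18; 35; 33; 48; 20; 43];
              [:: 34; 17; 45; 5; 10; 18; 24; 27; 15; 21];
              [:: 33; 17; 13; 44; 35; 49; 36; 29; 31; 18];
              [:: 3; 30; 34; 13; 5; 11; 1; 32; 39; 19];
              [:: 20; 10; 5; 44; 49; 37; 24; 46; 23; 19];
              [:: 21; 30; 24; 37; 22; 10; 40; 4; 0; 27];
              [:: 31; 13; 9; 24; 11; 29; 7; 19; 26; 38];
              [:: 34; 12; 43; 7; 45; 27; 4; 19; 23; 49]]))];
  Plan [:: 3; 3; 4] 10 [:: 6; 7; 9]
    (Certificate 10 30 30
      [:: [:: 52; 0; 21; 48; 14; 31; 22; 13; 50; 19]; [:: 12; 47; 32; 5; 29; 43; 56; 38; 8; 24]])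
    (Some ([:: 2; 1; 1; 2; 0; 1; 2; 2; 0; 0],
      (Certificate 10 40 30
        [:: [:: 43; 74; 25; 0; 55; 36; 59; 64; 22; 72];
            [:: 27; 40; 6; 38; 50; 18; 35; 49; 61; 4];
            [:: 79; 11; 35; 4; 42; 63; 29; 19; 75; 40];
            [:: 69; 25; 0; 34; 76; 19; 3; 54; 61; 40]])))
    [:: Filling 1
        (Certificate 11 11 0
          [:: [:: 13; 5; 3; 18; 21; 17; 7; 11; 1; 14]; [:: 18; 13; 2; 7; 15; 10; 1; 16; 5; 21]])
        no_certificate
        (Some (Certificate 21 21 21
          [:: [:: 29; 38; 14; 21; 37; 35; 30; 0; 7; 26];
              [:: 28; 8; 17; 36; 30; 35; 15; 38; 6; 40]]));
      Filling 5
        (Certificate 7 14 0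
          [:: [:: 3; 19; 14; 12; 16; 11; 29; 0; 20; 24]; [:: 28; 20; 25; 15; 0; 9; 22; 10; 2; 5];
              [:: 19; 12; 29; 4; 14; 0; 20; 10; 26; 24]; [:: 7; 16; 19; 28; 2; 4; 23; 9; 0; 15];
              [:: 16; 23; 15; 6; 11; 19; 13; 3; 5; 20]; [:: 5; 26; 14; 19; 11; 0; 23; 16; 12; 6]])
        (Certificate 1 0 10
          [:: [:: 18; 11; 6; 13; 5; 20; 3; 22; 1; 9]; [:: 24; 18; 13; 0; 20; 14; 4; 23; 6; 28];
              [:: 0; 24; 2; 20; 7; 8; 19; 27; 10; 4]; [:: 7; 29; 5; 8; 18; 3; 17; 23; 13; 10];
              [:: 10; 5; 21; 12; 1; 14; 9; 16; 7; 26]; [:: 7; 2; 13; 9; 0; 4; 11; 19; 15; 20];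
              [:: 18; 7; 15; 16; 26; 1; 9; 5; 24; 13]; [:: 0; 3; 29; 16; 22; 18; 27; 14; 24; 6];
              [:: 5; 0; 26; 3; 19; 16; 23; 14; 25; 8]; [:: 21; 6; 16; 14; 11; 2; 9; 12; 29; 18];
              [:: 0; 29; 16; 19; 13; 27; 11; 24; 8; 22]; [:: 0; 19; 20; 10; 27; 2; 7; 4; 17; 12];
              [:: 12; 26; 16; 24; 10; 6; 18; 22; 15; 28];
              [:: 9; 15; 29; 13; 23; 11; 2; 4; 18; 21]; [:: 6; 2; 15; 8; 21; 16; 13; 1; 11; 29];
              [:: 9; 14; 27; 7; 23; 0; 17; 29; 2; 5]; [:: 16; 14; 10; 0; 18; 24; 22; 2; 27; 5];
              [:: 28; 8; 10; 2; 21; 12; 16; 24; 4; 15]; [:: 12; 5; 15; 25; 2; 16; 10; 1; 7; 9]])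
        (Some (Certificate 5 25 25
          [:: [:: 40; 39; 1; 6; 45; 30; 10; 32; 3; 16];
              [:: 19; 34; 20; 24; 47; 45; 3; 15; 42; 49];
              [:: 9; 28; 43; 5; 48; 7; 13; 41; 1; 10]; [:: 37; 29; 12; 5; 19; 43; 21; 10; 22; 9];
              [:: 15; 6; 29; 35; 49; 39; 21; 45; 8; 3];
              [:: 28; 27; 3; 13; 44; 18; 6; 16; 46; 39];
              [:: 30; 48; 33; 19; 37; 35; 4; 46; 29; 23];
              [:: 37; 43; 49; 14; 20; 33; 10; 18; 0; 4];
              [:: 31; 20; 4; 23; 25; 45; 7; 27; 37; 8];
              [:: 17; 27; 42; 11; 32; 29; 45; 46; 20; 13];
              [:: 39; 48; 20; 30; 25; 28; 1; 33; 13; 37];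
              [:: 2; 37; 32; 24; 11; 30; 13; 6; 19; 42]]))];
  Plan [:: 3; 7] 10 [:: 1; 2; 3]
    (Certificate 10 30 30
      [:: [:: 16; 36; 40; 3; 32; 55; 8; 51; 6; 35]; [:: 20; 47; 1; 48; 25; 15; 23; 10; 52; 26]])
    (Some ([:: 0; 2; 1; 2; 0; 2; 1; 0; 1; 2],
      (Certificate 10 40 30
        [:: [:: 56; 74; 30; 21; 46; 1; 42; 65; 55; 13];
            [:: 17; 24; 76; 39; 71; 49; 3; 32; 1; 75];
            [:: 18; 39; 43; 65; 10; 79; 52; 29; 72; 46];
            [:: 61; 12; 24; 8; 52; 30; 10; 70; 41; 38]])))
    [:: Filling 1
        (Certificate 11 11 0
          [:: [:: 14; 18; 8; 3; 12; 17; 1; 20; 6; 5]; [:: 21; 2; 9; 18; 14; 7; 0; 11; 13; 4]])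
        no_certificate
        (Some (Certificate 21 21 0
          [:: [:: 11; 26; 39; 1; 37; 2; 24; 15; 33; 31];
              [:: 0; 9; 15; 17; 18; 22; 20; 7; 30; 40];
              [:: 5; 16; 19; 9; 12; 39; 23; 27; 32; 29];
              [:: 39; 6; 29; 4; 11; 32; 40; 16; 8; 20]]));
      Filling 5
        (Certificate 7 14 14
          [:: [:: 20; 22; 12; 1; 15; 24; 11; 6; 9; 18];
              [:: 13; 4; 20; 11; 15; 22; 7; 18; 17; 29];
              [:: 24; 5; 29; 1; 7; 11; 23; 15; 19; 13]])
        (Certificate 1 0 10
          [:: [:: 7; 26; 16; 29; 1; 5; 24; 11; 9; 2]; [:: 19; 13; 6; 14; 2; 10; 24; 5; 20; 8];
              [:: 4; 12; 10; 20; 7; 22; 19; 8; 15; 17]; [:: 11; 27; 8; 21; 7; 2; 12; 29; 14; 4];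
              [:: 3; 14; 29; 12; 1; 16; 11; 6; 9; 23]; [:: 15; 21; 12; 24; 7; 17; 22; 3; 10; 19];
              [:: 26; 14; 12; 23; 19; 9; 7; 0; 21; 11]; [:: 16; 26; 13; 3; 5; 23; 11; 19; 1; 20];
              [:: 14; 18; 21; 3; 24; 17; 1; 23; 5; 26]; [:: 22; 15; 1; 8; 16; 5; 12; 24; 19; 26];
              [:: 17; 11; 14; 25; 0; 12; 6; 4; 29; 8]; [:: 9; 20; 16; 10; 1; 26; 4; 3; 18; 13];
              [:: 0; 15; 24; 13; 8; 4; 16; 29; 6; 2]; [:: 4; 11; 29; 26; 18; 16; 2; 0; 6; 14];
              [:: 7; 19; 14; 22; 17; 28; 9; 0; 27; 3]; [:: 11; 28; 1; 19; 4; 7; 23; 8; 12; 16];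
              [:: 4; 9; 1; 3; 19; 28; 6; 24; 13; 21]; [:: 24; 2; 17; 22; 12; 28; 18; 20; 10; 14];
              [:: 6; 27; 10; 19; 0; 3; 9; 24; 14; 5]])
        (Some (Certificate 5 25 25
          [:: [:: 31; 6; 34; 0; 49; 36; 32; 11; 23; 25];
              [:: 46; 31; 14; 16; 12; 37; 20; 1; 9; 24];
              [:: 19; 37; 35; 21; 10; 13; 48; 28; 40; 32];
              [:: 3; 48; 46; 33; 28; 0; 37; 41; 24; 7]; [:: 48; 38; 22; 7; 41; 46; 4; 3; 18; 0];
              [:: 6; 18; 2; 36; 17; 31; 0; 13; 43; 22];
              [:: 13; 40; 27; 35; 48; 0; 10; 46; 25; 32];
              [:: 20; 9; 30; 28; 27; 5; 45; 39; 10; 12];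
              [:: 27; 35; 3; 41; 16; 13; 28; 39; 9; 18];
              [:: 25; 29; 10; 9; 16; 38; 40; 43; 2; 36];
              [:: 19; 47; 4; 32; 43; 25; 15; 26; 0; 20];
              [:: 47; 23; 28; 8; 44; 10; 30; 49; 43; 12]]))];
  Plan [:: 4; 6] 10 [:: 2; 7; 9]
    (Certificate 10 30 30
      [:: [:: 48; 24; 43; 5; 9; 39; 57; 23; 12; 21]; [:: 4; 48; 25; 58; 23; 2; 41; 6; 26; 15]])
    (Some ([:: 0; 2; 1; 2; 2; 1; 0; 2; 0; 1],
      (Certificate 10 40 30
        [:: [:: 64; 43; 68; 13; 51; 16; 29; 8; 47; 32]; [:: 32; 5; 48; 70; 20; 8; 36; 60; 30; 0];
            [:: 21; 10; 70; 44; 53; 29; 43; 5; 65; 35];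
            [:: 48; 77; 38; 63; 53; 19; 71; 15; 59; 66]])))
    [:: Filling 1
        (Certificate 11 11 0
          [:: [:: 5; 20; 2; 10; 16; 12; 18; 8; 7; 15]; [:: 16; 4; 6; 21; 9; 18; 1; 14; 12; 3]])
        no_certificate
        (Some (Certificate 21 21 21
          [:: [:: 14; 21; 35; 38; 8; 25; 4; 2; 40; 28];
              [:: 41; 12; 2; 33; 0; 25; 14; 30; 39; 36]]));
      Filling 5
        (Certificate 7 14 0
          [:: [:: 11; 14; 13; 4; 27; 17; 3; 28; 18; 25]; [:: 27; 22; 12; 24; 14; 9; 7; 3; 21; 5];
              [:: 28; 11; 16; 21; 8; 0; 12; 3; 18; 24]; [:: 21; 26; 14; 6; 16; 28; 23; 0; 13; 5];
              [:: 11; 24; 12; 20; 4; 22; 16; 2; 26; 1]; [:: 3; 23; 20; 13; 10; 15; 25; 5; 29; 9]])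
        (Certificate 1 0 10
          [:: [:: 15; 10; 26; 17; 5; 7; 23; 0; 29; 9]; [:: 28; 15; 19; 3; 9; 20; 0; 10; 7; 17];
              [:: 3; 9; 10; 6; 23; 4; 15; 26; 18; 1]; [:: 9; 6; 15; 25; 12; 20; 5; 16; 2; 1];
              [:: 22; 13; 26; 14; 10; 8; 6; 24; 0; 28]; [:: 6; 2; 24; 17; 19; 14; 12; 10; 5; 28];
              [:: 3; 10; 25; 5; 14; 20; 12; 29; 18; 0]; [:: 1; 26; 4; 3; 12; 9; 14; 17; 10; 19];
              [:: 8; 23; 18; 3; 1; 7; 20; 17; 26; 10]; [:: 17; 20; 6; 13; 24; 2; 27; 18; 4; 10];
              [:: 16; 10; 20; 18; 4; 23; 6; 14; 13; 28]; [:: 20; 11; 22; 2; 16; 13; 5; 1; 6; 25];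
              [:: 9; 25; 15; 0; 19; 6; 27; 3; 22; 16]; [:: 4; 9; 29; 7; 20; 15; 2; 12; 25; 19];
              [:: 6; 26; 0; 12; 15; 11; 3; 29; 16; 9]; [:: 8; 21; 5; 0; 18; 12; 3; 15; 28; 6];
              [:: 1; 24; 4; 16; 8; 26; 13; 10; 18; 23]; [:: 0; 20; 3; 16; 19; 4; 14; 23; 13; 9];
              [:: 29; 10; 23; 17; 9; 27; 5; 12; 24; 18]])
        (Some (Certificate 3 24 25
          [:: [:: 19; 48; 25; 39; 32; 42; 17; 10; 44; 23];
              [:: 37; 38; 12; 43; 11; 29; 5; 3; 45; 41];
              [:: 11; 1; 2; 7; 20; 13; 43; 40; 30; 16];
              [:: 3; 42; 24; 36; 31; 28; 21; 5; 49; 38];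
              [:: 9; 18; 29; 31; 15; 36; 17; 41; 35; 21];
              [:: 21; 38; 27; 11; 18; 46; 49; 16; 41; 23];
              [:: 12; 46; 37; 26; 30; 48; 40; 11; 19; 35];
              [:: 34; 11; 39; 3; 48; 12; 24; 5; 20; 9];
              [:: 39; 34; 29; 1; 45; 20; 32; 2; 10; 24];
              [:: 33; 18; 16; 35; 29; 4; 7; 39; 44; 24];
              [:: 31; 44; 43; 7; 46; 22; 35; 17; 3; 32];
              [:: 34; 28; 32; 45; 26; 43; 47; 39; 41; 20];
              [:: 34; 25; 21; 36; 45; 6; 18; 5; 33; 10];
              [:: 3; 29; 27; 20; 1; 12; 14; 46; 5; 36]; [:: 10; 31; 15; 37; 16; 1; 7; 45; 26; 9];
              [:: 9; 15; 16; 6; 25; 41; 19; 1; 47; 10]; [:: 6; 48; 33; 1; 15; 18; 11; 31; 2; 25];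
              [:: 19; 23; 43; 49; 38; 11; 13; 4; 16; 33];
              [:: 41; 1; 48; 26; 7; 16; 23; 42; 15; 28];
              [:: 46; 3; 13; 24; 43; 31; 16; 27; 19; 5]]))];
  Plan [:: 5; 5] 10 [:: 2; 6; 7]
    (Certificate 10 30 20
      [:: [:: 21; 54; 0; 53; 19; 8; 39; 43; 10; 28]; [:: 18; 21; 44; 31; 42; 46; 35; 5; 22; 3]])
    (Some ([:: 2; 1; 1; 2; 0; 1; 0; 0; 2; 2],
      (Certificate 10 40 40
        [:: [:: 8; 77; 51; 27; 41; 38; 53; 21; 71; 17];
            [:: 11; 29; 70; 2; 33; 53; 1; 74; 55; 73];
            [:: 29; 73; 31; 42; 8; 59; 14; 49; 65; 34];
            [:: 9; 60; 55; 72; 29; 3; 20; 10; 62; 47]])))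
    [:: Filling 1
        (Certificate 11 11 0
          [:: [:: 2; 16; 12; 18; 7; 10; 14; 4; 9; 0]; [:: 2; 0; 9; 20; 19; 11; 17; 15; 7; 4]])
        no_certificate
        (Some (Certificate 21 21 21
          [:: [:: 9; 18; 37; 40; 24; 38; 14; 27; 7; 0]; [:: 30; 9; 16; 28; 36; 19; 21; 35; 3; 4]]));
      Filling 5
        (Certificate 7 14 14
          [:: [:: 22; 1; 3; 9; 14; 26; 10; 24; 13; 28]; [:: 19; 14; 2; 11; 0; 20; 16; 8; 23; 5];
              [:: 0; 29; 14; 23; 24; 6; 10; 13; 19; 17]])
        (Certificate 1 0 10
          [:: [:: 18; 8; 29; 4; 22; 21; 11; 3; 24; 6]; [:: 24; 12; 0; 16; 15; 5; 6; 2; 8; 10];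
              [:: 7; 28; 18; 11; 16; 23; 13; 26; 8; 4]; [:: 27; 16; 25; 19; 5; 2; 15; 10; 0; 23];
              [:: 19; 11; 15; 28; 12; 3; 4; 17; 0; 27]; [:: 25; 6; 12; 5; 3; 14; 27; 9; 1; 21];
              [:: 1; 2; 20; 12; 24; 17; 29; 18; 7; 26]; [:: 25; 16; 8; 23; 15; 3; 12; 27; 10; 1];
              [:: 9; 14; 21; 1; 7; 28; 4; 19; 16; 13]; [:: 10; 9; 24; 19; 13; 2; 7; 0; 15; 26];
              [:: 28; 15; 18; 21; 16; 11; 25; 5; 13; 6]; [:: 1; 8; 20; 11; 28; 14; 13; 3; 23; 7];
              [:: 16; 18; 0; 5; 20; 12; 10; 29; 8; 14]; [:: 22; 14; 4; 6; 16; 12; 1; 18; 3; 8];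
              [:: 4; 26; 18; 22; 10; 21; 13; 8; 17; 2]; [:: 3; 29; 0; 4; 15; 23; 9; 25; 10; 6];
              [:: 22; 12; 16; 2; 11; 8; 21; 7; 15; 19]; [:: 1; 15; 17; 5; 25; 7; 29; 3; 19; 26];
              [:: 9; 4; 21; 18; 6; 17; 11; 27; 0; 22]])
        (Some (Certificate 5 25 25
          [:: [:: 21; 1; 42; 14; 38; 37; 19; 24; 29; 33];
              [:: 37; 16; 3; 19; 22; 33; 45; 11; 48; 47];
              [:: 28; 18; 0; 17; 26; 47; 45; 8; 10; 41];
              [:: 36; 26; 29; 6; 16; 24; 47; 40; 4; 0]; [:: 6; 34; 13; 4; 37; 15; 48; 30; 8; 46];
              [:: 1; 9; 28; 3; 45; 43; 11; 13; 25; 33]; [:: 40; 20; 8; 5; 28; 46; 6; 35; 36; 31];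
              [:: 43; 27; 21; 3; 29; 38; 22; 15; 11; 36];
              [:: 10; 40; 34; 25; 19; 22; 49; 20; 3; 39];
              [:: 38; 41; 20; 19; 27; 9; 0; 11; 7; 32];
              [:: 40; 3; 33; 11; 37; 31; 29; 42; 17; 12];
              [:: 45; 0; 41; 23; 19; 35; 10; 9; 33; 42]]))];
  Plan [:: 10] 10 [:: 2; 3; 4]
    (Certificate 10 30 30
      [:: [:: 32; 57; 9; 53; 26; 6; 24; 5; 51; 2]; [:: 36; 14; 59; 31; 55; 29; 10; 21; 18; 45]])
    (Some ([:: 1; 2; 2; 0; 2; 1; 1; 1; 0; 0],
      (Certificate 10 40 30
        [:: [:: 35; 15; 72; 44; 67; 37; 43; 17; 41; 12];
            [:: 70; 37; 67; 34; 75; 47; 2; 49; 24; 14];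
            [:: 19; 47; 71; 30; 54; 26; 79; 25; 7; 36];
            [:: 47; 70; 4; 61; 15; 34; 41; 32; 10; 69]])))
    [:: Filling 1
        (Certificate 11 11 0
          [:: [:: 18; 11; 12; 3; 21; 6; 9; 15; 17; 0]; [:: 1; 9; 21; 15; 18; 13; 5; 16; 6; 3]])
        no_certificate
        (Some (Certificate 21 21 21
          [:: [:: 20; 17; 35; 25; 38; 10; 36; 6; 8; 3];
              [:: 4; 10; 27; 31; 39; 16; 36; 25; 22; 13]]));
      Filling 5
        (Certificate 7 14 14
          [:: [:: 3; 17; 20; 28; 4; 12; 27; 8; 6; 22]; [:: 0; 9; 18; 11; 28; 14; 16; 26; 20; 5];
              [:: 26; 19; 11; 21; 9; 15; 16; 12; 2; 1]])
        (Certificate 1 0 10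
          [:: [:: 19; 4; 20; 15; 17; 0; 27; 13; 2; 11]; [:: 9; 22; 17; 3; 7; 18; 20; 10; 12; 4];
              [:: 0; 3; 23; 18; 17; 25; 9; 29; 12; 7]; [:: 17; 5; 25; 13; 1; 21; 9; 7; 23; 14];
              [:: 21; 12; 2; 0; 14; 25; 6; 9; 27; 4]; [:: 28; 13; 9; 14; 20; 19; 2; 17; 7; 1];
              [:: 8; 0; 4; 14; 11; 3; 19; 29; 16; 24]; [:: 27; 7; 14; 10; 13; 4; 23; 3; 8; 17];
              [:: 10; 23; 7; 16; 21; 2; 26; 14; 24; 19];
              [:: 28; 11; 20; 12; 25; 19; 27; 0; 9; 5]; [:: 21; 1; 10; 22; 13; 27; 17; 4; 15; 2];
              [:: 5; 27; 19; 0; 24; 10; 6; 3; 15; 23]; [:: 8; 2; 28; 0; 13; 19; 7; 5; 11; 27];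
              [:: 3; 25; 11; 9; 28; 6; 12; 22; 1; 4]; [:: 10; 9; 12; 17; 22; 19; 15; 0; 25; 5];
              [:: 12; 14; 26; 2; 24; 6; 21; 17; 29; 19];
              [:: 10; 17; 19; 14; 29; 7; 20; 8; 23; 0]; [:: 9; 18; 0; 16; 10; 26; 6; 5; 29; 15];
              [:: 4; 2; 29; 10; 7; 15; 12; 16; 8; 18]])
        (Some (Certificate 5 25 25
          [:: [:: 36; 29; 34; 6; 8; 33; 31; 23; 13; 48];
              [:: 18; 43; 0; 24; 20; 28; 27; 30; 6; 16]; [:: 29; 41; 10; 4; 3; 9; 39; 36; 27; 1];
              [:: 31; 45; 48; 3; 10; 27; 42; 16; 34; 5];
              [:: 8; 20; 18; 23; 26; 15; 7; 46; 40; 43];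
              [:: 32; 39; 25; 11; 41; 22; 14; 17; 12; 0];
              [:: 27; 39; 0; 7; 32; 10; 42; 37; 17; 41];
              [:: 26; 1; 15; 4; 29; 45; 35; 18; 24; 47];
              [:: 10; 48; 31; 25; 5; 16; 32; 21; 41; 35];
              [:: 42; 2; 44; 6; 25; 35; 14; 18; 31; 8];
              [:: 4; 25; 43; 45; 30; 16; 49; 36; 32; 40];
              [:: 13; 8; 47; 18; 29; 10; 5; 26; 41; 30]]))]].
Lemma plans_of_2_ok : all plan_ok plans_of_2.
Proof. by vm_compute. Qed.
Lemma plans_of_3_ok : all plan_ok plans_of_3.
Proof. by vm_compute. Qed.
Lemma plans_of_4_ok : all plan_ok plans_of_4.
Proof. by vm_compute. Qed.
Lemma plans_of_5_ok : all plan_ok plans_of_5.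
Proof. by vm_compute. Qed.
Lemma plans_of_6_ok : all plan_ok plans_of_6.
Proof. by vm_compute. Qed.
Lemma plans_of_7_ok : all plan_ok plans_of_7.
Proof. by vm_compute. Qed.
Lemma plans_of_8_ok : all plan_ok plans_of_8.
Proof. by vm_compute. Qed.
Lemma plans_of_9_ok : all plan_ok plans_of_9.
Proof. by vm_compute. Qed.
Lemma plans_of_10_ok : all plan_ok plans_of_10.
Proof. by vm_compute. Qed.

(** * Which orders occur *)

(** The partitions of m into nondecreasing parts, all at least lo; fuel bounds the number
    of parts. *)
Fixpoint partitions_above (fuel lo m : nat) : seq (seq nat) :=
  if m == 0 then [:: [::]] else
  if fuel is fuel'.+1 then
    flatten [seq map (cons a) (partitions_above fuel' a (m - a)) | a <- iota lo (m.+1 - lo)]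
  else [::].

Lemma mem_partitions fuel lo m r :
  0 < lo -> size r <= fuel -> path leq lo r -> sumn r = m ->
  r \in partitions_above fuel lo m.
Proof.
move=> lo_gt0; elim: r fuel lo m lo_gt0 => [|a r IHr] fuel lo m lo_gt0.
  by move=> _ _ <-; case: fuel.
case: fuel => //= fuel szr /andP[le_a path_r] <-.
have -> : (a + sumn r == 0) = false by apply/negbTE; lia.
apply/flattenP; exists (map (cons a) (partitions_above fuel a (a + sumn r - a))).
  by apply/mapP; exists a; rewrite // mem_iota; lia.
by apply: map_f; rewrite addKn; apply: IHr => //; lia.
Qed.

Definition all_plans : seq plan :=
  plans_of_2 ++ plans_of_3 ++ plans_of_4 ++ plans_of_5 ++ plans_of_6 ++
  plans_of_7 ++ plans_of_8 ++ plans_of_9 ++ plans_of_10.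

Lemma all_plans_ok : all plan_ok all_plans.
Proof.
by rewrite /all_plans !all_cat plans_of_2_ok plans_of_3_ok plans_of_4_ok
  plans_of_5_ok plans_of_6_ok plans_of_7_ok plans_of_8_ok plans_of_9_ok plans_of_10_ok.
Qed.

Definition planned ms g w even_too : bool :=
  has (fun p => [&& tables p == ms, group_size p == g & reaches even_too w p]) all_plans.

Lemma planned_decomposable ms g w even_too q n :
    planned ms g w even_too -> 0 < q -> even_too || odd q -> n = q * g + w ->
  decomposable ms (fun u v : 'I_n => u != v : nat).
Proof.
move/(all_has_witness all_plans_ok) => -[p p_ok /and3P[/eqP <- /eqP <- reach]] q_gt0 par ->.
exact: plan_sound reach q_gt0 par.
Qed.

(** The orders n = 2mk + residue, written as q groups of size group plus rest extra couples
    with q = slope * k + start. *)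
Record progression := Progression
  { residue : nat; group : nat; rest : nat; even_too : bool; slope : nat; start : nat }.

(** For m = 3 and n = 1 modulo 6 the groups have size 6: with size 3 the remainder of S is
    the diagonal, and a triangle on both outer groups and infinity would then need one pair
    of positions in two of the three classes towards infinity. *)
Definition progressions m : seq progression :=
  (if m == 3 then Progression 1 6 1 true 1 0 else Progression 1 m 1 true 2 0) ::
  (if odd m then [:: Progression m m 0 false 2 1] else [::]) ++
  (if m == 6 then [:: Progression 9 6 3 false 2 1] else [::]) ++
  (if m == 10 then [:: Progression 5 10 5 true 2 0] else [::]).

(** The last two conditions give q > 0 for all n >= m, and odd q when it is needed. *)
Definition solves m r ms (c : progression) : bool :=
  [&& residue c == r, planned ms (group c) (rest c) (even_too c),
      slope c * group c == 2 * m, start c * group c + rest c == r,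
      (0 < start c) || (0 < slope c) && (r < m)
    & even_too c || ~~ odd (slope c) && odd (start c)].

Lemma progressions_solve :
  all (fun m => all (fun ms => all (fun r =>
    odd r && (2 * m %| r * (r - 1)) ==> has (solves m r ms) (progressions m))
    (iota 0 (2 * m))) (partitions_above 10 2 m)) (iota 2 9).
Proof. by vm_compute. Qed.

Lemma complete_decomposable m n ms :
    2 <= m <= 10 -> m <= n -> odd n -> 2 * m %| n * (n - 1) ->
    ms \in partitions_above 10 2 m ->
  decomposable ms (fun u v : 'I_n => u != v : nat).
Proof.
move=> m_bd le_mn n_odd n_dvd ms_in; pose r := n %% (2 * m); pose k := n %/ (2 * m).
have nE : n = k * (2 * m) + r := divn_eq n (2 * m).
have ltr : r < 2 * m by rewrite ltn_mod; lia.
have r_odd : odd r by move: n_odd; rewrite nE oddD !oddM andbF.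
have r_dvd : 2 * m %| r * (r - 1).
  move: n_dvd; rewrite /dvdn -(modnMm n (n - 1)) -(modnMm r (r - 1)).
  have r_gt0 : 0 < r by case: (r) r_odd.
  by rewrite {2}nE -addnBA // modnMDl modn_mod.
have m_in : m \in iota 2 9 by rewrite mem_iota; lia.
have := allP progressions_solve m m_in => /allP/(_ ms ms_in)/allP/(_ r).
rewrite mem_iota add0n ltr r_odd r_dvd => /(_ isT).
have allT (s : seq progression) : all predT s by elim: s.
case/(all_has_witness (allT _)) => c _ /and5P[/eqP cE pl /eqP slopeE /eqP startE].
case/andP=> pos par.
apply: (planned_decomposable (q := k * slope c + start c) pl).
- have [//|/andP[slope_gt0 ltrm]] := orP pos; first by lia.
  have : 0 < k by case: (k) nE => // nE; lia.
  by rewrite addn_gt0 muln_gt0 => ->; rewrite slope_gt0.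
- case/orP: par => [->//|/andP[ev od]].
  by rewrite oddD oddM (negPf ev) andbF od orbT.
- by rewrite mulnDl -mulnA slopeE -addnA startE.
Qed.

Theorem theorem1p2 (s t : nat) (mm : 'I_t -> nat) (m n : nat)
    (t_ge1 : 1 <= t)
    (mm_ge2 : forall j : 'I_t, 2 <= mm j)
    (mm_sorted : forall i j : 'I_t, i <= j -> mm i <= mm j)
    (m_def : m = \sum_(j < t) mm j)
    (m_le10 : m <= 10)
    (n_def : n = s + m)
    (n_odd : odd n)
    (n_mod : n * (n - 1) = 0 %[mod 2 * m]) :
  HOP_has_solution s mm.
Proof.
have m_ge : 2 * t <= m.
  by rewrite m_def -[t in 2 * t]card_ord mulnC -sum_nat_const; apply: leq_sum.
have m_bd : 2 <= m <= 10 by lia.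
apply: HOP_of_decomposition => //; rewrite -m_def; first by lia.
rewrite -n_def; apply: complete_decomposable m_bd _ n_odd _ _; first by lia.
  by apply/eqP; rewrite n_mod mod0n.
apply: mem_partitions => //.
- by rewrite size_map size_enum_ord; lia.
- rewrite path_min_sorted; last by apply/allP => _ /mapP[j _ ->].
  rewrite sorted_map; apply: (@sub_sorted _ (fun i j : 'I_t => i <= j)).
    by move=> i j; apply: mm_sorted.
  by have := iota_sorted 0 t; rewrite -val_enum_ord sorted_map.
- by rewrite sumnE big_map big_enum m_def.
Qed.
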